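(* Let $H\in\mathcal C_+$, and write $H(x)=P_{\varphi(x)}$, with $\varphi:(0,\infty)\to\mathbb{R}$ a decreasing function satisfying $\pi/2\ge\varphi(0+)\ge\varphi(\infty)\ge-\pi/2$. (a) Then $0\in\sigma_{ess}(H)$ if and only if \[ \limsup_{x\to\infty}x\,(\varphi(x)-\varphi(\infty))=\infty . \] (b) $0$ is an eigenvalue if and only if $\varphi(x)+\pi/2\in L^2(0,\infty)$.
   Context: $J=\begin{pmatrix}0&-1\\1&0\end{pmatrix}$. For $\alpha\in\mathbb{R}$, $e_\alpha=(\cos\alpha,\sin\alpha)^t$ and $P_\alpha=e_\alpha e_\alpha^*$ (projection onto $e_\alpha$). ''Decreasing'' means non-increasing, $\varphi(0+)=\lim_{x\to0+}\varphi(x)$, $\varphi(\infty)=\lim_{x\to\infty}\varphi(x)$. Coefficient functions are identified if they agree almost everywhere, so $H(x)=P_{\varphi(x)}$ is understood for almost every $x>0$. A half line canonical system is the equation $Ju'(x)=-zH(x)u(x)$, $x\in[0,\infty)$, where $H$ is a locally integrable function with values in the real symmetric $2\times2$ matrices, $H(x)\ge0$, $\operatorname{tr}H(x)=1$; the boundary condition $u_2(0)=0$ is always imposed. $L^2_H(0,\infty)$ is the Hilbert space of measurable $f:(0,\infty)\to\mathbb{C}^2$ with $\int_0^\infty f^*Hf\,dx<\infty$, modulo functions with $\int_0^\infty f^*Hf\,dx=0$. The system generates the self-adjoint relation $\mathcal S$ of all pairs $(f,g)\in L^2_H\times L^2_H$ such that $f$ has a representative $f_0$, locally absolutely continuous on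 $[0,\infty)$, with $Jf_0'=-Hg$ a.e. and second component $f_{0,2}(0)=0$. Its multi-valued part is $\mathcal S(0)=\{g:(0,g)\in\mathcal S\}$, and $\overline{D(\mathcal S)}=\mathcal S(0)^\perp$. The self-adjoint operator $S$ of the system acts on $\overline{D(\mathcal S)}$ and has graph $\mathcal S\cap(\overline{D(\mathcal S)}\times\overline{D(\mathcal S)})$. $\sigma(H)$ and $\sigma_{ess}(H)$ denote the spectrum and essential spectrum of $S$, and ''eigenvalue'' refers to $S$. $\mathcal C_+$ is the set of such coefficient functions $H$ on $(0,\infty)$ with $\sigma(H)\subseteq[0,\infty)$. It is known that $H\in\mathcal C_+$ if and only if $H=P_\varphi$ for some $\varphi$ as in the claim, so such a $\varphi$ exists.
   Formalization: Part (b) is false as stated when H = P_{π/2} = P_{-π/2} a.e. (e.g. φ ≡ -π/2: φ+π/2 = 0 is in L², but the operator acts on {0}, so 0 is no eigenvalue); in (b), for this H only, φ is required to equal π/2 a.e. *)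

(* Defs.v *)
From HB Require Import structures.
From mathcomp Require Import all_boot all_order all_algebra.
From mathcomp Require Import all_classical all_reals all_analysis.
From mathcomp Require Import complex.

Set Implicit Arguments.
Unset Strict Implicit.
Unset Printing Implicit Defensive.

Import Order.TTheory GRing.Theory Num.Theory.
Import numFieldNormedType.Exports.

Local Open Scope classical_set_scope.
Local Open Scope ring_scope.
Local Open Scope complex_scope.

(* Functions on (0, oo) or [0, oo) are total functions on R; only their values
   on the relevant half line are ever used. *)

Definition half_line (R : realType) : set R := `]0, +oo[.

Definition Jmx (K : pzRingType) : 'M[K]_2 :=
  \matrix_(i, j) ((j < i)%N%:R - (i < j)%N%:R).

Definition evec (R : realType) (alpha : R) : 'cV[R]_2 :=
  \col_i (if i == 0 then cos alpha else sin alpha).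

Definition projP (R : realType) (alpha : R) : 'M[R]_2 :=
  evec alpha *m (evec alpha)^T.

(* Being identified up to a.e. equality, coefficient functions satisfy the
   pointwise conditions only almost everywhere. *)
Definition coefficient_function (R : realType) (H : R -> 'M[R]_2) : Prop :=
  [/\ forall i j, measurable_fun (@half_line R) (fun x => H x i j),
      forall (b : R) i j,
        (@lebesgue_measure R).-integrable `]0, b[ (fun x => (H x i j)%:E)
    & {ae lebesgue_measure, forall x : R, 0 < x ->
        [/\ (H x)^T = H x,
            forall v : 'cV[R]_2, 0 <= (v^T *m H x *m v) 0 0
          & \tr (H x) = 1]}].

Definition toC (R : realType) (A : 'M[R]_2) : 'M[R[i]]_2 :=
  map_mx (real_complex R) A.

(* f^* H f, which is real for symmetric H *)
Definition Hform (R : realType) (H : R -> 'M[R]_2) (f : R -> 'cV[R[i]]_2)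
    (x : R) : R :=
  complex.Re (((map_mx (@conjc R) (f x))^T *m toC (H x) *m f x) 0 0).

Definition Hint (R : realType) (H : R -> 'M[R]_2) (f : R -> 'cV[R[i]]_2)
    : \bar R :=
  (\int[lebesgue_measure]_(x in @half_line R) (Hform H f x)%:E)%E.

(* L^2_H is handled as a setoid: L2H says that a function represents an element
   of L^2_H, and L2H_eq that two such functions represent the same element. *)
Definition L2H (R : realType) (H : R -> 'M[R]_2) (f : R -> 'cV[R[i]]_2)
    : Prop :=
  [/\ forall i, measurable_fun (@half_line R) (fun x => complex.Re (f x i 0)),
      forall i, measurable_fun (@half_line R) (fun x => complex.Im (f x i 0))
    & (Hint H f < +oo)%E].

Definition L2H_eq (R : realType) (H : R -> 'M[R]_2)
    (f g : R -> 'cV[R[i]]_2) : Prop :=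
  Hint H (fun x => f x - g x) = 0%E.

(* meaningful for f in L^2_H only, where Hint H f is finite *)
Definition L2H_norm (R : realType) (H : R -> 'M[R]_2)
    (f : R -> 'cV[R[i]]_2) : R :=
  Num.sqrt (fine (Hint H f)).

Definition abs_cont (R : realType) (a b : R) (f : R -> R) : Prop :=
  forall eps : R, 0 < eps -> exists2 delta : R, 0 < delta &
    forall (n : nat) (s t : 'I_n -> R),
      (forall i, a <= s i <= t i /\ t i <= b) ->
      (forall i j, i != j -> t i <= s j \/ t j <= s i) ->
      \sum_(i < n) (t i - s i) < delta ->
      \sum_(i < n) `|f (t i) - f (s i)| < eps.

Definition loc_abs_cont (R : realType) (f : R -> 'cV[R[i]]_2) : Prop :=
  forall (b : R) i, abs_cont 0 b (fun x => complex.Re (f x i 0)) /\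
                    abs_cont 0 b (fun x => complex.Im (f x i 0)).

Definition has_derivative (R : realType) (f : R -> 'cV[R[i]]_2) (x : R)
    (d : 'cV[R[i]]_2) : Prop :=
  forall i, is_derive x (1 : R) (fun y => complex.Re (f y i 0)) (complex.Re (d i 0)) /\
            is_derive x (1 : R) (fun y => complex.Im (f y i 0)) (complex.Im (d i 0)).

Definition relS (R : realType) (H : R -> 'M[R]_2)
    (f g : R -> 'cV[R[i]]_2) : Prop :=
  [/\ L2H H f, L2H H g &
      exists f0 : R -> 'cV[R[i]]_2,
        [/\ L2H H f0 /\ L2H_eq H f f0,
            loc_abs_cont f0,
            {ae lebesgue_measure, forall x : R, 0 < x ->
               exists2 d, has_derivative f0 x d &
                 Jmx R[i] *m d = - (toC (H x) *m g x)}
          & f0 0 1 0 = 0]].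

(* closure of the domain of the relation in L^2_H *)
Definition domS_closure (R : realType) (H : R -> 'M[R]_2)
    (f : R -> 'cV[R[i]]_2) : Prop :=
  L2H H f /\ forall eps : R, 0 < eps ->
    exists h k, relS H h k /\ L2H_norm H (fun x => f x - h x) < eps.

(* graph of the self-adjoint operator S on domS_closure H *)
Definition opS (R : realType) (H : R -> 'M[R]_2)
    (f g : R -> 'cV[R[i]]_2) : Prop :=
  [/\ relS H f g, domS_closure H f & domS_closure H g].

(* S - z is onto with a bounded inverse; the bound makes S - z injective. *)
Definition resolvent_set (R : realType) (H : R -> 'M[R]_2) : set R[i] :=
  [set z | (forall h, domS_closure H h -> exists f g,
              opS H f g /\ L2H_eq H (fun x => g x - z *: f x) h) /\
           (exists M : R, forall f g, opS H f g ->
              L2H_norm H f <= M * L2H_norm H (fun x => g x - z *: f x))].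

Definition spectrum (R : realType) (H : R -> 'M[R]_2) : set R[i] :=
  ~` resolvent_set H.

Definition is_eigenvector (R : realType) (H : R -> 'M[R]_2) (z : R[i])
    (f : R -> 'cV[R[i]]_2) : Prop :=
  ~ L2H_eq H f (fun=> 0) /\
  exists2 g, opS H f g & L2H_eq H g (fun x => z *: f x).

Definition is_eigenvalue (R : realType) (H : R -> 'M[R]_2) (z : R[i]) : Prop :=
  exists f, is_eigenvector H z f.

Definition finite_multiplicity (R : realType) (H : R -> 'M[R]_2) (z : R[i])
    : Prop :=
  exists (n : nat) (e : 'I_n -> R -> 'cV[R[i]]_2),
    (forall k, L2H H (e k)) /\
    forall f, is_eigenvector H z f -> exists c : 'I_n -> R[i],
      L2H_eq H f (fun x => \sum_(k < n) c k *: e k x).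

Definition isolated_in_spectrum (R : realType) (H : R -> 'M[R]_2) (z : R[i])
    : Prop :=
  exists2 eps : R, 0 < eps &
    forall w, spectrum H w -> `|w - z| < eps%:C -> w = z.

(* For a self-adjoint operator: the spectrum without the isolated eigenvalues
   of finite multiplicity. *)
Definition ess_spectrum (R : realType) (H : R -> 'M[R]_2) : set R[i] :=
  [set z | spectrum H z /\
     ~ [/\ isolated_in_spectrum H z, is_eigenvalue H z
         & finite_multiplicity H z]].

Definition Cplus (R : realType) : set (R -> 'M[R]_2) :=
  [set H | coefficient_function H /\ spectrum H `<=` [set z | 0 <= z]].

Definition square_integrable (R : realType) (f : R -> R) : Prop :=
  measurable_fun (@half_line R) f /\
  (\int[lebesgue_measure]_(x in @half_line R) ((f x) ^+ 2)%:E < +oo)%E.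

(* Main.v *)
(* Since H = P_phi has rank one, L^2_H is L^2(0, oo) through f |-> F = <e_phi, f>,
   and (f, g) in S becomes
     F x = c cos (phi x) + int_0^x sin (phi x - phi t) G t dt;
   hence ker S is spanned by cos phi, which gives (b).  Put A = phi(oo) and
   theta = phi - A.  If x theta is bounded, then Hardy's inequality bounds the
   solution operator G |-> F that is normalized at infinity.  This gives
   0 in rho(S) if A > -pi/2, and, with a Neumann series, (0, e) in rho(S) if
   A = -pi/2, where 0 is then a simple eigenvalue.  Conversely, if 0 is in rho(S)
   or isolated, then <F, G> <= C |G|^2 for all (F, G) in S, because S >= 0; testing
   with G = s 1_(a, b) - t 1_(b', c) such that int cos phi G = 0, for which F is
   explicit, bounds x theta. *)

Require Import Defs.
From HB Require Import structures.
From mathcomp Require Import all_boot all_order all_algebra.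
From mathcomp Require Import all_classical all_reals all_analysis.
From mathcomp Require Import complex.
From mathcomp Require Import measurable_realfun ring lra.

Set Implicit Arguments.
Unset Strict Implicit.
Unset Printing Implicit Defensive.

Import Order.TTheory GRing.Theory Num.Theory.
Import numFieldNormedType.Exports.

Local Open Scope classical_set_scope.
Local Open Scope ring_scope.

(* [lra] inspects the whole context, so we hand it the relevant hypotheses only. *)
Ltac clra :=
  repeat match goal with H : ?T |- _ => match type of T with Prop => clear H end end;
  intros; lra.

(** The relation may be multivalued, so a resolvent first gives bounds only on the graph of the
    operator. Symmetry of the whole relation extends them to all its pairs, and test pairs need not
    lie in the closure of the domain. Symmetry is a limit point argument: the Wronskian of two pairs
    has a limit at infinity, and a nonzero limit contradicts square integrability. Together with the
    surjectivity in the definition of the resolvent set it stands in for self-adjointness, and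
    approximate eigenvectors stand in for spectral calculus. Since [H] is real, real and imaginary
    parts decouple, so the analysis concerns real scalar functions. The kernel sin (phi x - phi t)
    depends on differences only, so [phi] can be replaced by theta. For A = -pi/2 the mass of cos
    phi on (x, 2x) is balanced by a bump on a fixed interval; this only compares theta at 2x with
    theta at x, and an iteration is needed. For |A| < pi/2 the balancing bump lies beyond x and is
    so long and flat that its contribution stays bounded. For A = pi/2 the function [phi] is
    constant and the domain is {0}. *)

(** * Absolutely continuous functions with vanishing derivative *)

Section absolutely_continuous.
Context {R : realType}.
Local Notation mu := (@lebesgue_measure R).

Lemma small_increment_of_derivative0 (f : R -> R) (x e : R) : 0 < e ->
  is_derive x 1 f 0 ->
  exists2 eta, 0 < eta & forall y, `|y - x| <= eta -> `|f y - f x| <= e * `|y - x|.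
Proof.
move=> e0 [df dfE].
have : (fun h => h^-1 *: (f (h *: 1 + x) - f x)) @ 0^' --> (0 : R).
  by rewrite -[X in _ --> X]dfE; exact: df.
move=> /cvgrPdist_le /(_ _ e0) /= [d d0 hd].
exists (d / 2); first by rewrite divr_gt0.
move=> y yx; have [->|yx0] := eqVneq y x; first by rewrite !subrr normr0 mulr0.
have yx0' : y - x != 0 by rewrite subr_eq0.
have := hd (y - x); rewrite /ball_/= sub0r normrN => /(_ _ yx0').
have : `|y - x| < d by apply: (le_lt_trans yx); rewrite ltr_pdivrMr// ltr_pMr// ltr1n.
move=> yd /(_ yd); rewrite sub0r normrN /GRing.scale/= mulr1 subrK normrM normfV.
by rewrite ler_pdivrMl ?normr_gt0// mulrC.
Qed.

(* Cousin-type argument: near points where the derivative vanishes the increment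
   is at most [e] times the length; the other points are covered by an open set
   of measure less than [delta], where absolute continuity controls it. *)
Lemma abs_cont_derivative0 (f : R -> R) (b : R) : 0 <= b -> abs_cont 0 b f ->
  {ae mu, forall x : R, 0 < x < b -> is_derive x 1 f 0} -> f b = f 0.
Proof.
move=> b0 acf [N [mN muN hN]].
have key e : 0 < e -> `|f b - f 0| <= e * b + e.
  move=> e0; have [d d0 hd] := acf _ e0.
  (* The derivative is known only inside ]0, b[, so both endpoints join the exceptional null set and
     are covered by [U] as well. *)
  pose N1 := N `|` [set 0; b].
  have mN1 : measurable N1.
    by apply: measurableU => //; apply: measurableU; exact: measurable_set1.
  have muN1 : mu N1 = 0%E.
    have mA : measurable [set 0 : R] by exact: measurable_set1.
    have mB : measurable [set b] by exact: measurable_set1.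
    rewrite /N1 measureU0//; first exact: measurableU.
    by rewrite measureU0//; exact: lebesgue_measure_set1.
  have [U [oU NU muU]] : exists U : set R,
      [/\ open U, N1 `<=` U & (mu (U `\` N1) < d%:E)%E].
    have mN1oo : (mu N1 < +oo)%E by rewrite muN1.
    exact: lebesgue_regularity_outer.
  have mU : measurable U by exact: measurable_realfun.open_measurable.
  have muUd : (mu U < d%:E)%E.
    rewrite -(@setDUK _ N1 U)// setUC measureU0//; exact: measurableD.
  (* Invariant of a real induction: finitely many successive intervals carry the uncontrolled part
     of the increment, and their total length is at most the measure of [U] below [x]. An extension
     inside [U] preserves it by additivity of the measure; an extension around a point of vanishing
     derivative costs [e] times its length. *)
  pose P x := exists n (s t : nat -> R), [/\
    forall i, (i < n)%N -> 0 <= s i /\ s i <= t i /\ t i <= x,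
    forall i j, (i < j)%N -> (j < n)%N -> t i <= s j,
    `|f x - f 0| <= e * x + \sum_(i < n) `|f (t i) - f (s i)|
    & ((\sum_(i < n) (t i - s i))%:E <= mu (U `&` `[0%R, x[%classic))%E].
  have P0 : P 0.
    exists 0%N, (fun=> 0), (fun=> 0); split => //; last by rewrite big_ord0.
    by rewrite subrr normr0 mulr0 big_ord0 addr0.
  have step x : 0 <= x <= b -> exists2 eta, 0 < eta &
      forall y z, 0 <= y -> z <= b -> x - eta <= y <= x -> x <= z <= x + eta ->
        P y -> P z.
    move=> /andP[x0 xb]; have [Ux|nUx] := pselect (U x).
      have [r /= r0 rU] := (open_nbhs_nbhs (conj oU Ux)).
      exists (r / 2); first by rewrite divr_gt0.
      move=> y z y0 zb /andP[xy yx] /andP[xz zx] [n [s [t [h1 h2 h3 h4]]]].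
      have yz : y <= z by exact: le_trans xz.
      exists n.+1, (fun i => if i == n then y else s i),
                   (fun i => if i == n then z else t i).
      have sumE (F : R -> R -> R) : \sum_(i < n.+1)
          F (if i == n :> nat then y else s i) (if i == n :> nat then z else t i)
          = \sum_(i < n) F (s i) (t i) + F y z.
        rewrite big_ord_recr/= eqxx; congr (_ + _).
        by apply: eq_bigr => i _; rewrite ltn_eqF.
      split.
      - move=> i; rewrite ltnS leq_eqVlt => /predU1P[->|ni]; first by rewrite eqxx.
        rewrite ltn_eqF//; have [? [? ?]] := h1 _ ni; split=> //; split=> //.
        exact: le_trans yz.
      - move=> i j ij; rewrite ltnS leq_eqVlt => /predU1P[jn|jn].
          by subst j; rewrite eqxx (ltn_eqF ij); have [_ []] := h1 _ ij.
        by rewrite (ltn_eqF jn) (ltn_eqF (ltn_trans ij jn)); exact: h2.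
      - rewrite (sumE (fun a b => `|f b - f a|)) addrA.
        have -> : f z - f 0 = (f y - f 0) + (f z - f y) by ring.
        apply: (le_trans (ler_normD _ _)).
        by rewrite lerD2r (le_trans h3)// lerD2r ler_wpM2l// ltW.
      - rewrite (sumE (fun a b => b - a)).
        have -> : U `&` `[0, z[%classic = (U `&` `[0, y[%classic) `|` `[y, z[%classic.
          apply/seteqP; split => u /=.
            rewrite !in_itv/= => -[Uu /andP[u0 uz]].
            by have [uy|yu] := ltP u y; [left; rewrite u0|right].
          rewrite !in_itv/= => -[[Uu /andP[-> uy]]|/andP[yu uz]].
            by split=> //; exact: lt_le_trans yz.
          split; last by rewrite (le_trans y0 yu).
          apply: rU; rewrite /ball_/= ltr_distlC.
          have r2 : r / 2 < r by rewrite ltr_pdivrMr// ltr_pMr// ltr1n.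
          apply/andP; split; lra.
        rewrite measureU//=.
        + rewrite EFinD leeD// lebesgue_measure_itv/= lte_fin.
          by case: ltP => // zy; rewrite lee_fin subr_le0.
        + exact: measurableI.
        + apply/seteqP; split=> u //= [[_]]; rewrite !in_itv/= => /andP[_ uy].
          by rewrite leNgt uy.
    have x0' : x != 0 by apply: contra_notN nUx => /eqP ->; apply: NU; right; left.
    have xb' : x != b by apply: contra_notN nUx => /eqP ->; apply: NU; right; right.
    have dfx : is_derive x 1 f 0.
      apply: contrapT => ndf; apply: nUx; apply: NU; left; apply: hN => /= h.
      by apply: ndf; apply: h; rewrite !lt_neqAle xb' xb eq_sym x0' x0.
    have [eta eta0 he] := small_increment_of_derivative0 e0 dfx.
    exists eta => // y z y0 zb /andP[xy yx] /andP[xz zx] [n [s [t [h1 h2 h3 h4]]]].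
    have yz : y <= z by exact: le_trans xz.
    exists n, s, t; split => //.
    - by move=> i ni; have [? [? ?]] := h1 _ ni; split=> //; split=> //; exact: le_trans yz.
    - have hz : `|f z - f x| <= e * (z - x).
        by have := he z; rewrite ger0_norm ?subr_ge0//; apply; lra.
      have hy : `|f x - f y| <= e * (x - y).
        by have := he y; rewrite distrC (distrC (f y)) ger0_norm ?subr_ge0//; apply; lra.
      have : `|f z - f 0| <= `|f z - f x| + (`|f x - f y| + `|f y - f 0|).
        rewrite -(subrKA (f x)); apply: (le_trans (ler_normD _ _)); rewrite lerD2l.
        by rewrite -(subrKA (f y)); exact: ler_normD.
      nra.
    - apply: (le_trans h4); apply: le_measure; rewrite ?inE//.
      + exact: measurableI.
      + exact: measurableI.
      + apply: setIS => u /=; rewrite !in_itv/= => /andP[-> /= uy].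
        exact: lt_le_trans yz.
  have Pb : P b.
    (* A step from just below the supremum [c] reaches the minimum of [c + eta] and [b], which would
       lie above [c] if [c < b]. *)
    pose S := [set x | 0 <= x <= b /\ P x].
    have S0 : S 0 by split => //; rewrite lexx.
    have ubS : ubound S b by move=> x [/andP[]].
    have hsS : has_sup S by split; [exists 0|exists b].
    set c := sup S.
    have c0 : 0 <= c by apply: sup_upper_bound.
    have cb : c <= b by apply: sup_le_ub => //; exists 0.
    have [] := step c; first by rewrite c0.
    move=> eta eta0 hc.
    have [y [/andP[y0 yb] Py] cy] : exists2 y, S y & c - eta < y.
      exact: sup_adherent.
    have yc : y <= c by apply: sup_upper_bound => //; split; rewrite ?y0.
    pose z := Num.min (c + eta) b.
    have zb : z <= b by rewrite /z ge_min lexx orbT.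
    have cz : c <= z by rewrite /z le_min cb andbT; lra.
    have Pz : P z.
      apply: (hc y z) => //; first by rewrite (ltW cy) yc.
      by rewrite cz /= /z ge_min lexx.
    have zc : z <= c.
      by apply: sup_upper_bound => //; split; rewrite // zb (le_trans c0 cz).
    have : z = b.
      move: zc; rewrite /z minEle; case: ifP => // _; lra.
    by move=> <-.
  have [n [s [t [h1 h2 h3 h4]]]] := Pb.
  apply: (le_trans h3); rewrite lerD2l ltW//.
  apply: (hd n (fun i => s i) (fun i => t i)).
  - by move=> i; have [-> [-> ->]] := h1 i (ltn_ord i).
  - move=> i j; rewrite -val_eqE neq_ltn => /orP[ij|ij]; [left|right]; exact: h2.
  - rewrite -lte_fin; apply: (le_lt_trans h4); apply: le_lt_trans muUd.
    by apply: le_measure; rewrite ?inE//; exact: measurableI.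
apply/eqP; rewrite -subr_eq0 -normr_le0; apply/ler_addgt0Pr => e e0.
rewrite add0r; have b1 : 0 < b + 1 by rewrite ltr_wpDl.
apply: (le_trans (key (e / (b + 1)) _)); first by rewrite divr_gt0.
by rewrite -[X in _ + X]mulr1 -mulrDr divfK// gt_eqF.
Qed.

End absolutely_continuous.

(** * Local integrability and indefinite integrals *)

Section indefinite_integral.
Context {R : realType}.
Local Notation mu := (@lebesgue_measure R).
Local Notation D := (@half_line R).
Implicit Types F G : R -> R.

Lemma aeS (P Q : R -> Prop) : (forall x : R, P x -> Q x) ->
  {ae mu, forall x : R, P x} -> {ae mu, forall x : R, Q x}.
Proof. by move=> PQ; apply: filterS; first exact: (ae_filter_ringOfSetsType mu). Qed.

Lemma aeS2 (P1 P2 Q : R -> Prop) : (forall x : R, P1 x -> P2 x -> Q x) ->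
  {ae mu, forall x : R, P1 x} -> {ae mu, forall x : R, P2 x} ->
  {ae mu, forall x : R, Q x}.
Proof. by move=> PQ; apply: filterS2; first exact: (ae_filter_ringOfSetsType mu). Qed.

Lemma aeS3 (P1 P2 P3 Q : R -> Prop) :
  (forall x : R, P1 x -> P2 x -> P3 x -> Q x) ->
  {ae mu, forall x : R, P1 x} -> {ae mu, forall x : R, P2 x} ->
  {ae mu, forall x : R, P3 x} -> {ae mu, forall x : R, Q x}.
Proof. by move=> PQ; apply: filterS3; first exact: (ae_filter_ringOfSetsType mu). Qed.

Definition loc_int G := measurable_fun D G /\
  forall b : R, mu.-integrable `]0, b] (EFin \o G).

Definition prim G (x : R) : R := \int[mu]_(t in `]0, x]) G t.

Lemma measurable_half_line : measurable D.
Proof. exact: measurable_itv. Qed.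

Lemma half_lineE (x : R) : D x = (0 < x) :> Prop.
Proof. by rewrite /half_line /= in_itv/= andbT. Qed.

Lemma sub_half_line (x y : R) : 0 <= x -> `]x, y] `<=` D.
Proof.
by move=> x0 t /=; rewrite /half_line/= !in_itv/= andbT => /andP[/(le_lt_trans x0)].
Qed.

Lemma integrable_itv G x y : loc_int G -> 0 <= x ->
  mu.-integrable `]x, y] (EFin \o G).
Proof.
move=> [_ iG] x0; apply: integrableS (iG y) => //.
by apply: subset_itvr; rewrite bnd_simp.
Qed.

Lemma prim0 G : prim G 0 = 0.
Proof. by rewrite /prim set_itv_ge ?bnd_simp ?ltxx// Rintegral_set0. Qed.

Lemma primB G x y : loc_int G -> 0 <= x -> x <= y ->
  prim G y - prim G x = \int[mu]_(t in `]x, y]) G t.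
Proof. by move=> [_ iG] x0 xy; apply: Rintegral_itvB => //; rewrite bnd_simp. Qed.

Lemma loc_intD F G : loc_int F -> loc_int G -> loc_int (fun x => F x + G x).
Proof.
move=> [mF iF] [mG iG]; split; first exact: measurable_funD.
by move=> b; have := integrableD _ (iF b) (iG b); exact.
Qed.

Lemma loc_intZ (c : R) G : loc_int G -> loc_int (fun x => c * G x).
Proof.
move=> [mG iG]; split; first exact: measurable_funM.
by move=> b; have := integrableZl _ c (iG b); exact.
Qed.

Lemma loc_intB F G : loc_int F -> loc_int G -> loc_int (fun x => F x - G x).
Proof.
move=> [mF iF] [mG iG]; split; first exact: measurable_funB.
by move=> b; have := integrableB _ (iF b) (iG b); exact.
Qed.

Lemma loc_int_norm G : loc_int G -> loc_int (fun x => `|G x|).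
Proof.
move=> [mG iG]; split; first exact: measurableT_comp.
by move=> b; have := integrable_norm (iG b); exact.
Qed.

Lemma primD F G x : loc_int F -> loc_int G ->
  prim (fun x => F x + G x) x = prim F x + prim G x.
Proof. by move=> [_ iF] [_ iG]; rewrite /prim RintegralD. Qed.

Lemma primN F G x : loc_int F -> loc_int G ->
  prim (fun x => F x - G x) x = prim F x - prim G x.
Proof. by move=> [_ iF] [_ iG]; rewrite /prim RintegralB. Qed.

Lemma primZ (c : R) G x : loc_int G ->
  prim (fun x => c * G x) x = c * prim G x.
Proof. by move=> [_ iG]; rewrite /prim RintegralZl. Qed.

Lemma eq_prim F G x : (forall t, 0 < t -> F t = G t) -> prim F x = prim G x.
Proof.
move=> FG; apply: eq_Rintegral => t; rewrite inE/= in_itv/= => /andP[t0 _].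
exact: FG.
Qed.

Lemma le_prim F G x : loc_int F -> loc_int G ->
  (forall t, 0 < t -> t <= x -> F t <= G t) -> prim F x <= prim G x.
Proof.
move=> [_ iF] [_ iG] FG; apply: le_Rintegral => // t.
by rewrite /= in_itv/= => /andP[]; exact: FG.
Qed.

Lemma prim_ge0 G x : (forall t, 0 < t -> t <= x -> 0 <= G t) -> 0 <= prim G x.
Proof.
move=> G0; apply: Rintegral_ge0 => t.
by rewrite /= in_itv/= => /andP[]; exact: G0.
Qed.

Lemma ler_norm_primB G x y : loc_int G -> 0 <= x -> x <= y ->
  `|prim G y - prim G x| <= prim (fun t => `|G t|) y - prim (fun t => `|G t|) x.
Proof.
move=> lG x0 xy; rewrite !primB//; last exact: loc_int_norm.
by apply: le_normr_Rintegral => //; exact: integrable_itv.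
Qed.

Lemma ler_norm_prim G x : loc_int G -> 0 <= x ->
  `|prim G x| <= prim (fun t => `|G t|) x.
Proof.
move=> lG x0; have := ler_norm_primB lG (lexx 0) x0.
by rewrite !prim0 !subr0.
Qed.

Lemma prim_homo G x y : loc_int G -> 0 <= x -> x <= y ->
  (forall t, x < t -> t <= y -> 0 <= G t) -> prim G x <= prim G y.
Proof.
move=> lG x0 xy G0; rewrite -subr_ge0 primB//; apply: Rintegral_ge0 => t.
by rewrite /= in_itv/= => /andP[]; exact: G0.
Qed.

(** Absolute continuity of the integral, applied to the union of the given intervals. Taken
    half-open, intervals that may share endpoints become disjoint, so that the measure of the union
    is the sum of the lengths. *)
Lemma prim_abs_cont G b : loc_int G -> abs_cont 0 b (prim G).
Proof.
move=> lG e e0.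
have iGb : mu.-integrable setT (EFin \o (G \_ `]0, b])).
  by have := lG.2 b; rewrite integrable_mkcond//= restrict_EFin.
have [d [d0 hd]] := integral_normr_continuous iGb e0.
exists d => // n s t st disj std.
pose A (i : 'I_n) := `]s i, t i]%classic.
have mA i : measurable (A i) by exact: measurable_itv.
have tA : trivIset setT A.
  apply/trivIsetP => i j _ _ ij; apply/seteqP; split=> x //=.
  rewrite /A/= !in_itv/= => -[/andP[six xti] /andP[sjx xtj]].
  by have [tisj|tjsi] := disj i j ij; lra.
pose U := \big[setU/set0]_(i < n) A i.
have mU : measurable U by exact: bigsetU_measurable.
have muA i : mu (A i) = (t i - s i)%:E.
  rewrite /A lebesgue_measure_itv/= lte_fin; have [/andP[_ sti] _] := st i.
  case: ltP => [_|tsi]; first by rewrite EFinB.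
  by rewrite (@le_anti _ _ (s i) (t i)) ?sti ?subrr.
have muU : (mu U < d%:E)%E.
  have -> : mu U = (\sum_(i < n) mu (A i))%E by exact: measure_bigsetU_ord.
  by under eq_bigr do rewrite muA; rewrite sumEFin lte_fin.
apply: le_lt_trans (hd U mU muU).
have -> : \int[mu]_(x in U) `|(G \_ `]0%R, b]) x| =
    \sum_(i < n) \int[mu]_(x in A i) `|(G \_ `]0%R, b]) x|.
  rewrite /Rintegral ge0_integral_bigsetU//.
  - rewrite (eq_bigr (fun i => (fine (\int[mu]_(x in A i)
        `|(G \_ `]0%R, b]) x|%:E))%:E)) ?sumEFin//.
    move=> i _; rewrite fineK//; apply: integrable_fin_num => //.
      exact: mA.
    by apply: integrableS (integrable_norm iGb) => //; exact: mA.
  - exact: index_enum_uniq.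
  - by apply: sub_trivIset tA.
  - apply/measurable_EFinP; apply: measurable_funTS.
    by have /measurable_int/measurable_EFinP := integrable_norm iGb.
apply: ler_sum => i _; have [/andP[si sti] tib] := st i.
rewrite primB//; apply: le_trans.
  by apply: le_normr_Rintegral => //; exact: integrable_itv.
rewrite le_eqVlt; apply/orP; left; apply/eqP.
apply: eq_Rintegral => x; rewrite inE/= in_itv/= => /andP[sx xt].
rewrite patchE mem_set//= in_itv/= (le_lt_trans si sx)/=.
exact: le_trans tib.
Qed.

(** Lebesgue differentiation for the extension of [G] by zero, which is locally integrable on the
    whole line. *)
Lemma prim_is_derive G : loc_int G ->
  {ae mu, forall x : R, 0 < x -> is_derive x 1 (prim G) (G x)}.
Proof.
move=> [mG iG]; pose f := G \_ D.
have fG b : {in `]0, b], f =1 G}.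
  move=> x; rewrite in_itv/= => /andP[x0 _]; rewrite /f patchE mem_set//.
  by rewrite half_lineE.
have iff b : mu.-integrable `]0, b] (EFin \o f).
  apply: eq_integrable (iG b) => //= x; rewrite inE/= => xb.
  by congr (_%:E); rewrite (fG b).
have mfT : measurable_fun setT f.
  by have [h _] := measurable_restrictT G measurable_half_line; exact: h.
have lf : locally_integrable setT f.
  split; [exact: mfT|exact: openT|].
  move=> K _ cK; have [M [_ hM]] := compact_bounded cK.
  pose b := `|M| + 1.
  have Kb x : K x -> `|x| <= b.
    by move=> Kx; apply: hM Kx; rewrite /b (le_lt_trans (ler_norm M))// ltrDl.
  have mK : measurable K by exact: compact_measurable.
  have iT : mu.-integrable setT (EFin \o (f \_ `]0, b])).
    by have := iff b; rewrite integrable_mkcond//= restrict_EFin.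
  have iK : mu.-integrable K (EFin \o (f \_ `]0, b])) by apply: integrableS iT.
  suff /integrableP[_] : mu.-integrable K (EFin \o f) by [].
  apply: eq_integrable iK => // x; rewrite inE => Kx.
  rewrite /= patchE; case: ifPn => // xb; congr EFin.
  rewrite /f patchE; case: ifPn => //; rewrite inE half_lineE => x0.
  exfalso; move/negP: xb; apply; rewrite inE/= in_itv/= x0/=.
  by apply: (le_trans (ler_norm _)); exact: Kb.
have := FTC1 iff lf; apply: aeS => x hx x0.
have [|dx dE] := hx; first by rewrite ?bnd_simp.
have pE : (fun y => \int[mu]_(t in `]0, y]) f t) = prim G.
  apply/funext => y; apply: eq_Rintegral => t; rewrite inE => tb.
  exact: (fG y).
rewrite pE in dx dE; apply: DeriveDef => //.
by rewrite -derive1E dE (fG x)// in_itv/= x0 lexx.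
Qed.

Lemma abs_contB (f g : R -> R) a b : abs_cont a b f -> abs_cont a b g ->
  abs_cont a b (fun x => f x - g x).
Proof.
move=> cf cg e e0; have e20 : 0 < e / 2 by rewrite divr_gt0.
have [d1 d10 h1] := cf _ e20; have [d2 d20 h2] := cg _ e20.
exists (Num.min d1 d2); first by rewrite lt_min d10.
move=> n s t st disj; rewrite lt_min => /andP[sd1 sd2].
have := h1 n s t st disj sd1; have := h2 n s t st disj sd2 => H2 H1.
rewrite [ltRHS]splitr; apply: le_lt_trans (ltrD H1 H2).
rewrite -big_split/=; apply: ler_sum => i _.
have -> : f (t i) - g (t i) - (f (s i) - g (s i)) =
  (f (t i) - f (s i)) - (g (t i) - g (s i)) by ring.
exact: ler_normB.
Qed.

(** The difference with [prim d] is absolutely continuous with derivative zero almost everywhere,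
    hence constant. This turns the differential equation in [relS] into the integral formula in
    [rel]. *)
Lemma abs_cont_prim (f d : R -> R) b : 0 <= b -> abs_cont 0 b f -> loc_int d ->
  {ae mu, forall x : R, 0 < x < b -> is_derive x 1 f (d x)} ->
  f b = f 0 + prim d b.
Proof.
move=> b0 cf ld df.
have : (fun x => f x - prim d x) b = (fun x => f x - prim d x) 0.
  apply: (@abs_cont_derivative0 R (fun x => f x - prim d x)) => //.
    by apply: abs_contB => //; exact: prim_abs_cont.
  have := prim_is_derive ld; apply: aeS2 df => x dfx dpx xb.
  have x0 : 0 < x by case/andP: xb.
  have h1 := dfx xb; have h2 := dpx x0.
  have := is_deriveB h1 h2; rewrite subrr; exact.
by rewrite /= prim0 subr0 => /eqP; rewrite subr_eq => /eqP.
Qed.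

End indefinite_integral.

(** * The real L^2 space over a measurable set *)

Section square_integrable_functions.
Context {R : realType}.
Local Notation mu := (@lebesgue_measure R).
Variable E : set R.
Hypothesis mE : @measurable _ (measurableTypeR R) E.
Implicit Types F G : R -> R.

Definition L2 F := measurable_fun E F /\
  mu.-integrable E (EFin \o (fun x => F x ^+ 2)).

Definition ip F G : R := \int[mu]_(x in E) (F x * G x).

Lemma le_measurable_integrable F G : measurable_fun E F ->
  mu.-integrable E (EFin \o G) -> (forall x, E x -> `|F x| <= G x) ->
  mu.-integrable E (EFin \o F).
Proof.
move=> mF iG FG; apply: le_integrable iG => //; first exact/measurable_EFinP.
move=> x Ex /=; rewrite lee_fin; apply: (le_trans (FG _ Ex)); exact: ler_norm.
Qed.

Lemma measurable_funX2 F : measurable_fun E F ->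
  measurable_fun E (fun x => F x ^+ 2).
Proof. by move=> mF; apply: measurable_funX. Qed.

Lemma L2_le F G : measurable_fun E F -> L2 G ->
  (forall x, E x -> `|F x| <= `|G x|) -> L2 F.
Proof.
move=> mF [mG iG] FG; split => //.
apply: (le_measurable_integrable _ iG); first exact: measurable_funX2.
move=> x Ex; rewrite normrX -[leRHS]real_normK ?num_real//.
by rewrite lerXn2r ?nnegrE// FG.
Qed.

Lemma L2_integrableM F G : L2 F -> L2 G ->
  mu.-integrable E (EFin \o (fun x => F x * G x)).
Proof.
move=> [mF iF] [mG iG].
have iFG : mu.-integrable E (EFin \o (fun x => F x ^+ 2 + G x ^+ 2)).
  by have := integrableD mE iF iG; exact.
apply: (le_measurable_integrable _ iFG); first exact: measurable_funM.
move=> x _; rewrite ler_norml; apply/andP; split; nra.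
Qed.

Lemma L20 : L2 (fun=> 0).
Proof.
split; first exact: measurable_cst.
by apply: eq_integrable (integrable0 _ _) => // x _ /=; rewrite expr0n.
Qed.

Lemma L2D F G : L2 F -> L2 G -> L2 (fun x => F x + G x).
Proof.
move=> [mF iF] [mG iG]; split; first exact: measurable_funD.
have iFG : mu.-integrable E (EFin \o (fun x => 2 * F x ^+ 2 + 2 * G x ^+ 2)).
  have := integrableD mE (integrableZl mE 2 iF) (integrableZl mE 2 iG); exact.
apply: (le_measurable_integrable _ iFG).
  by apply: measurable_funX2; exact: measurable_funD.
move=> x _; rewrite ger0_norm ?sqr_ge0//.
have := sqr_ge0 (F x - G x); nra.
Qed.

Lemma L2Z (c : R) F : L2 F -> L2 (fun x => c * F x).
Proof.
move=> [mF iF]; split; first exact: measurable_funM.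
have := integrableZl mE (c ^+ 2) iF; apply: eq_integrable => // x _ /=.
by rewrite exprMn.
Qed.

Lemma L2B F G : L2 F -> L2 G -> L2 (fun x => F x - G x).
Proof.
move=> lF lG; have := L2D lF (L2Z (-1) lG).
by congr L2; apply/funext => x; rewrite mulN1r.
Qed.

Lemma L2_norm F : L2 F -> L2 (fun x => `|F x|).
Proof.
move=> lF; apply: (L2_le _ lF); first exact: measurableT_comp lF.1.
by move=> x _; rewrite normr_id.
Qed.

Lemma ipC F G : ip F G = ip G F.
Proof. by apply: eq_Rintegral => x _; rewrite mulrC. Qed.

Lemma ipDl F F' G : L2 F -> L2 F' -> L2 G ->
  ip (fun x => F x + F' x) G = ip F G + ip F' G.
Proof.
move=> lF lF' lG; rewrite /ip -RintegralD//; try exact: L2_integrableM.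
by apply: eq_Rintegral => x _; rewrite mulrDl.
Qed.

Lemma ipZl (c : R) F G : L2 F -> L2 G -> ip (fun x => c * F x) G = c * ip F G.
Proof.
move=> lF lG; rewrite /ip -RintegralZl//; try exact: L2_integrableM.
by apply: eq_Rintegral => x _; rewrite mulrA.
Qed.

Lemma ipBl F F' G : L2 F -> L2 F' -> L2 G ->
  ip (fun x => F x - F' x) G = ip F G - ip F' G.
Proof.
move=> lF lF' lG; rewrite /ip -RintegralB//; try exact: L2_integrableM.
by apply: eq_Rintegral => x _; rewrite mulrBl.
Qed.

Lemma ipDr F F' G : L2 F -> L2 F' -> L2 G ->
  ip G (fun x => F x + F' x) = ip G F + ip G F'.
Proof. by move=> lF lF' lG; rewrite ipC ipDl// !(ipC _ G). Qed.

Lemma ipBr F F' G : L2 F -> L2 F' -> L2 G ->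
  ip G (fun x => F x - F' x) = ip G F - ip G F'.
Proof. by move=> lF lF' lG; rewrite ipC ipBl// !(ipC _ G). Qed.

Lemma ipZr (c : R) F G : L2 F -> L2 G -> ip G (fun x => c * F x) = c * ip G F.
Proof. by move=> lF lG; rewrite ipC ipZl// ipC. Qed.

Lemma nsq_ge0 F : 0 <= ip F F.
Proof. by apply: Rintegral_ge0 => x _; rewrite -expr2 sqr_ge0. Qed.

Lemma nsqD F G : L2 F -> L2 G ->
  ip (fun x => F x + G x) (fun x => F x + G x) = ip F F + 2 * ip F G + ip G G.
Proof.
move=> lF lG; rewrite ipDl ?ipDr//; try exact: L2D.
by rewrite (ipC G F); ring.
Qed.

Lemma nsqB F G : L2 F -> L2 G ->
  ip (fun x => F x - G x) (fun x => F x - G x) = ip F F - 2 * ip F G + ip G G.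
Proof.
move=> lF lG; rewrite ipBl ?ipBr//; try exact: L2B.
by rewrite (ipC G F); ring.
Qed.

Lemma nsqZ (c : R) F : L2 F ->
  ip (fun x => c * F x) (fun x => c * F x) = c ^+ 2 * ip F F.
Proof. by move=> lF; rewrite ipZl ?ipZr//; [ring|exact: L2Z]. Qed.

Lemma nsqD_le F G : L2 F -> L2 G ->
  ip (fun x => F x + G x) (fun x => F x + G x) <= 2 * ip F F + 2 * ip G G.
Proof.
by move=> lF lG; have := nsq_ge0 (fun x => F x - G x); rewrite (nsqB lF lG) (nsqD lF lG); lra.
Qed.

Lemma nsqB_le F G : L2 F -> L2 G ->
  ip (fun x => F x - G x) (fun x => F x - G x) <= 2 * ip F F + 2 * ip G G.
Proof.
by move=> lF lG; have := nsq_ge0 (fun x => F x + G x); rewrite (nsqB lF lG) (nsqD lF lG); lra.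
Qed.

Lemma ip_CauchySchwarz F G : L2 F -> L2 G -> ip F G ^+ 2 <= ip F F * ip G G.
Proof.
move=> lF lG.
have H t : 0 <= ip F F - 2 * t * ip F G + t ^+ 2 * ip G G.
  have := nsq_ge0 (fun x => F x - t * G x).
  have lt := L2Z t lG; rewrite nsqB// nsqZ// ipZr//; lra.
have := nsq_ge0 F; have := nsq_ge0 G => nG nF.
have [G0|G0] := eqVneq (ip G G) 0.
  suff -> : ip F G = 0 by rewrite G0 mulr0 expr0n.
  apply/eqP; apply: contraT => FG0.
  (* For [ip G G = 0] the quadratic polynomial in [t] is affine, and at this point it takes the
     value -1. *)
  have := H ((ip F F + 1) / (2 * ip F G)); rewrite G0 mulr0 addr0.
  have -> : 2 * ((ip F F + 1) / (2 * ip F G)) * ip F G = ip F F + 1 by field.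
  lra.
have {}G0 : 0 < ip G G by rewrite lt_neqAle eq_sym G0.
have := H (ip F G / ip G G).
have -> : ip F F - 2 * (ip F G / ip G G) * ip F G + (ip F G / ip G G) ^+ 2 * ip G G
  = (ip F F * ip G G - ip F G ^+ 2) / ip G G by field; rewrite gt_eqF.
by rewrite pmulr_lge0 ?invr_gt0// subr_ge0.
Qed.

Lemma nsq_eq0 F : L2 F -> ip F F = 0 -> {ae mu, forall x : R, E x -> F x = 0}.
Proof.
move=> lF F0.
have iF := L2_integrableM lF lF.
have mF2 : measurable_fun E (EFin \o (fun x => F x * F x)).
  exact: measurable_int iF.
have : (\int[mu]_(x in E) `|(F x * F x)%:E| = 0)%E.
  have -> : (\int[mu]_(x in E) `|(F x * F x)%:E| =
             \int[mu]_(x in E) (F x * F x)%:E)%E.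
    apply: eq_integral => x _; rewrite gee0_abs// lee_fin -expr2.
    exact: sqr_ge0.
  by rewrite -[LHS]fineK ?integrable_fin_num//; congr EFin.
move=> /(ae_eq_integral_abs mu mE mF2); apply: aeS => x FE Ex.
by have [/eqP] := FE Ex; rewrite mulf_eq0 orbb => /eqP.
Qed.

Lemma ae_eq_ip F F' G : L2 F -> L2 F' -> L2 G ->
  {ae mu, forall x : R, E x -> F x = F' x} -> ip F G = ip F' G.
Proof.
move=> lF lF' lG FF'; congr fine; apply: ae_eq_integral => //.
- by have /measurable_int := L2_integrableM lF lG.
- by have /measurable_int := L2_integrableM lF' lG.
- by apply: aeS FF' => x h Ex; rewrite h.
Qed.

Lemma ae_eq_nsq F F' : L2 F -> L2 F' ->
  {ae mu, forall x : R, E x -> F x = F' x} -> ip F F = ip F' F'.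
Proof.
by move=> lF lF' FF'; rewrite (ae_eq_ip lF lF' lF FF') ipC (ae_eq_ip lF lF' lF' FF').
Qed.

Lemma ae_eq0_nsq F : L2 F -> {ae mu, forall x : R, E x -> F x = 0} -> ip F F = 0.
Proof.
move=> lF F0; rewrite (ae_eq_nsq lF L20 F0) /ip (@eq_Rintegral _ _ _ _ _ (fun=> 0)).
  by rewrite /Rintegral integral0.
by move=> x _; rewrite mul0r.
Qed.

Lemma eq_ip F F' G G' : (forall x, E x -> F x = F' x) ->
  (forall x, E x -> G x = G' x) -> ip F G = ip F' G'.
Proof.
by move=> FF GG; apply: eq_Rintegral => x; rewrite inE => Ex; rewrite FF ?GG.
Qed.

End square_integrable_functions.

(** * Calculus on the half line *)

Section half_line_calculus.
Context {R : realType}.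
Local Notation mu := (@lebesgue_measure R).
Local Notation D := (@half_line R).
Implicit Types F G P Q : R -> R.

Lemma mD : @measurable _ (measurableTypeR R) D.
Proof. exact: measurable_itv. Qed.

Lemma mitv (a b : R) : @measurable _ (measurableTypeR R) `]a, b].
Proof. exact: measurable_itv. Qed.

Lemma measurable_sub_half_line F (b : R) : measurable_fun D F ->
  measurable_fun `]0, b] F.
Proof.
move=> mF; apply: measurable_funS mF; first exact: measurable_half_line.
exact: sub_half_line.
Qed.

Definition locally_bounded F :=
  forall b : R, exists M : R, forall x, 0 < x -> x <= b -> `|F x| <= M.

Lemma loc_int_bounded F : measurable_fun D F -> locally_bounded F -> loc_int F.
Proof.
move=> mF bF; split=> // b; have [M hM] := bF b.
apply: measurable_bounded_integrable => //.
- have H : (mu `]0%R, b] < +oo)%E.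
    by rewrite lebesgue_measure_itv/=; case: ifP => //= _; rewrite -EFinB ltry.
  exact: H.
- exact: measurable_sub_half_line.
- exists M; split; first exact: num_real.
  move=> N MN x /=; rewrite in_itv/= => /andP[x0 xb].
  by apply: (le_trans (hM _ x0 xb)); exact: ltW.
Qed.

Lemma loc_int_mul_bounded h G : measurable_fun D h -> locally_bounded h ->
  loc_int G -> loc_int (fun x => h x * G x).
Proof.
move=> mh bh [mG iG]; split; first exact: measurable_funM.
move=> b; have [M hM] := bh b.
apply: (@le_measurable_integrable _ _ (mitv 0 b) _ (fun x => M * `|G x|)).
- by apply: measurable_sub_half_line; exact: measurable_funM.
- have := integrableZl (mitv 0 b) M (integrable_norm (iG b)); exact.
- move=> x; rewrite /= in_itv/= => /andP[x0 xb].
  by rewrite normrM ler_wpM2r// hM.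
Qed.

Lemma abs_cont_continuous F (b x : R) : abs_cont 0 b F -> 0 < x < b ->
  {for x, continuous F}.
Proof.
move=> cF /andP[x0 xb]; apply/cvgrPdist_lt => e e0.
have [d d0 hd] := cF _ e0.
have key s t : 0 <= s -> s <= t -> t <= b -> t - s < d -> `|F t - F s| < e.
  move=> s0 st tb ts; have := hd 1%N (fun=> s) (fun=> t).
  rewrite !big_ord1; apply => //; first by move=> _; rewrite s0 st.
  by move=> i j; rewrite (ord1 i) (ord1 j) eqxx.
exists (Num.min d (Num.min x (b - x))); first by rewrite /= !lt_min d0 x0 subr_gt0.
move=> y; rewrite /= !lt_min !ltr_norml => /andP[/andP[d1 d2] /andP[/andP[_ x2] /andP[x3 _]]].
have [xy|yx] := leP x y.
- by rewrite -ltr_norml distrC; apply: key; lra.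
- by rewrite -ltr_norml; apply: key; lra.
Qed.

Lemma measurable_prim G : loc_int G -> measurable_fun D (prim G).
Proof.
move=> lG; apply: open_continuous_measurable_fun.
  by rewrite /half_line; exact: interval_open.
move=> x; rewrite inE half_lineE => x0.
apply: (@abs_cont_continuous _ (x + 1)); first exact: prim_abs_cont.
by rewrite x0 ltrDl ltr01.
Qed.

Lemma ler_norm_prim_homo G x b : loc_int G -> 0 <= x -> x <= b ->
  `|prim G x| <= prim (fun t => `|G t|) b.
Proof.
move=> lG x0 xb; apply: (le_trans (ler_norm_prim lG x0)).
by apply: prim_homo => //; exact: loc_int_norm.
Qed.

Lemma prim_locally_bounded G : loc_int G -> locally_bounded (prim G).
Proof.
move=> lG b; exists (prim (fun t => `|G t|) b) => x x0 xb.
by apply: ler_norm_prim_homo => //; exact: ltW.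
Qed.

Lemma abs_contM (f g : R -> R) a b M : (forall x, a <= x <= b -> `|f x| <= M) ->
  (forall x, a <= x <= b -> `|g x| <= M) ->
  abs_cont a b f -> abs_cont a b g -> abs_cont a b (fun x => f x * g x).
Proof.
move=> fM gM cf cg e e0; set N := `|M| + 1.
have N0 : 0 < N by rewrite ltr_wpDl.
have MN : M <= N by rewrite (le_trans (ler_norm M))// lerDl.
have e20 : 0 < e / 2 / N by rewrite !divr_gt0.
have [d1 d10 h1] := cf _ e20; have [d2 d20 h2] := cg _ e20.
exists (Num.min d1 d2); first by rewrite lt_min d10.
move=> n s t st disj; rewrite lt_min => /andP[sd1 sd2].
have H1 := h1 n s t st disj sd1; have H2 := h2 n s t st disj sd2.
apply: (@le_lt_trans _ _ (N * (\sum_(i < n) `|f (t i) - f (s i)| +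
  \sum_(i < n) `|g (t i) - g (s i)|))).
  rewrite -big_split/= mulr_sumr; apply: ler_sum => i _.
  have [/andP[si sti] tib] := st i.
  have -> : f (t i) * g (t i) - f (s i) * g (s i) =
    g (t i) * (f (t i) - f (s i)) + f (s i) * (g (t i) - g (s i)) by ring.
  apply: (le_trans (ler_normD _ _)); rewrite !normrM mulrDr.
  apply: lerD; apply: ler_wpM2r => //; apply: le_trans MN.
    by apply: gM; rewrite tib andbT (le_trans si).
  by apply: fM; rewrite si (le_trans sti).
by rewrite -ltr_pdivlMl// mulrC [ltRHS](_ : _ = e / 2 / N + e / 2 / N) ?ltrD//; field; rewrite gt_eqF.
Qed.

(** The product of two indefinite integrals is absolutely continuous on [0, x], vanishes at 0 and
    obeys the product rule almost everywhere. *)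
Lemma prim_parts P Q x : loc_int P -> loc_int Q -> 0 <= x ->
  prim P x * prim Q x =
  prim (fun t => P t * prim Q t) x + prim (fun t => prim P t * Q t) x.
Proof.
move=> lP lQ x0.
have l1 : loc_int (fun t => P t * prim Q t).
  have := loc_int_mul_bounded (measurable_prim lQ) (prim_locally_bounded lQ) lP.
  by congr loc_int; apply/funext => t; rewrite mulrC.
have l2 : loc_int (fun t => prim P t * Q t).
  exact: loc_int_mul_bounded (measurable_prim lP) (prim_locally_bounded lP) lQ.
rewrite -primD//.
rewrite (@abs_cont_prim _ (fun y => prim P y * prim Q y)
  (fun t => P t * prim Q t + prim P t * Q t) x)//.
- by rewrite !prim0 mul0r add0r.
- pose M := Num.max (prim (fun t => `|P t|) x) (prim (fun t => `|Q t|) x).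
  apply: (@abs_contM _ _ _ _ M).
  + move=> y /andP[y0 yx]; rewrite /M le_max; apply/orP; left.
    exact: ler_norm_prim_homo.
  + move=> y /andP[y0 yx]; rewrite /M le_max; apply/orP; right.
    exact: ler_norm_prim_homo.
  + exact: prim_abs_cont.
  + exact: prim_abs_cont.
- exact: loc_intD.
- have := prim_is_derive lP; have := prim_is_derive lQ.
  apply: aeS2 => y hQ hP /andP[y0 _].
  have := is_deriveM (hP y0) (hQ y0).
  by move=> h; apply: is_derive_eq h _; rewrite /GRing.scale/= [RHS]addrC; ring.
Qed.

Lemma L2_loc_int F : L2 D F -> loc_int F.
Proof.
move=> [mF iF]; split => // b.
have i1 : mu.-integrable `]0, b] (EFin \o (fun=> 1 : R)).
  have := @loc_int_bounded (fun=> 1); case.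
  - exact: measurable_cst.
  - by move=> c; exists 1 => x _ _; rewrite normr1.
  - by move=> _; exact.
have i2 : mu.-integrable `]0, b] (EFin \o (fun x => F x ^+ 2)).
  by apply: integrableS iF; [exact: mD|exact: mitv|exact: sub_half_line].
apply: (@le_measurable_integrable _ _ (mitv 0 b) _ (fun x => 1 + F x ^+ 2)).
- exact: measurable_sub_half_line.
- by have := integrableD (mitv 0 b) i1 i2; exact.
- move=> x _; rewrite ler_norml; apply/andP; split; nra.
Qed.

Lemma L2_loc_intM F G : L2 D F -> L2 D G -> loc_int (fun x => F x * G x).
Proof.
move=> lF lG; split; first exact: measurable_funM lF.1 lG.1.
move=> b; apply: integrableS (L2_integrableM mD lF lG); [exact: mD|exact: mitv|].
exact: sub_half_line.
Qed.

Lemma prim_nsq_le F b : L2 D F -> prim (fun x => F x * F x) b <= ip D F F.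
Proof.
move=> lF; rewrite /prim /ip /Rintegral fine_le//.
- by apply: integrable_fin_num; [exact: mitv|exact: (L2_loc_intM lF lF).2].
- by apply: integrable_fin_num; [exact: mD|exact: (L2_integrableM mD)].
- apply: ge0_subset_integral => //.
  + exact: mD.
  + by apply: measurable_int (L2_integrableM mD lF lF).
  + by move=> x _; rewrite lee_fin -expr2 sqr_ge0.
  + exact: sub_half_line.
Qed.

Lemma half_line_bigcup : D = \bigcup_n `]0, (n%:R : R)]%classic.
Proof.
apply/seteqP; split => x.
  rewrite half_lineE => x0; exists (Num.trunc x).+1 => //.
  by rewrite /= in_itv/= x0/= ltW// truncnS_gt.
move=> [n _]; exact: sub_half_line.
Qed.

Lemma cvg_integral_half_line F : measurable_fun D F -> (forall x, 0 <= F x) ->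
  (\int[mu]_(x in `]0%R, n%:R]) (F x)%:E @[n --> \oo] -->
   \int[mu]_(x in D) (F x)%:E)%E.
Proof.
move=> mF F0; rewrite half_line_bigcup.
apply: ge0_nondecreasing_set_cvg_integral.
- apply/nondecreasing_seqP => n; rewrite subsetEset => x /=; rewrite !in_itv/=.
  by move=> /andP[-> /= xn]; rewrite (le_trans xn)// ler_nat.
- by move=> i; exact: mitv.
- by move=> i; apply/measurable_EFinP; exact: measurable_sub_half_line.
- by move=> i x _; rewrite lee_fin.
Qed.

(** Monotone convergence along the intervals ]0, n]. Membership in L^2 is obtained in this way from
    estimates on bounded intervals, where the integrals are known to exist. *)
Lemma L2_bounded_prim F (C : R) : loc_int (fun x => F x * F x) ->
  measurable_fun D F ->
  (forall n : nat, prim (fun x => F x * F x) n%:R <= C) ->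
  L2 D F /\ ip D F F <= C.
Proof.
move=> lF mF hC.
have FF0 x : 0 <= F x * F x by rewrite -expr2 sqr_ge0.
have hle : (\int[mu]_(x in D) (F x * F x)%:E <= C%:E)%E.
  have cF := @cvg_integral_half_line (fun x => F x * F x) (measurable_funM mF mF) FF0.
  rewrite -(cvg_lim _ cF)//; apply: lime_le; first exact: (cvgP _ cF).
  apply: nearW => n; have := hC n; rewrite -lee_fin /prim /Rintegral fineK//.
  by apply: integrable_fin_num; [exact: mitv|exact: lF.2].
suff iF : mu.-integrable D (EFin \o (fun x => F x * F x)).
  split; first by split.
  by rewrite /ip /Rintegral -lee_fin fineK// integrable_fin_num//; exact: mD.
apply/integrableP; split; first by apply/measurable_EFinP; exact: measurable_funM.
under eq_integral do rewrite /= ger0_norm//.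
by apply: le_lt_trans hle _; rewrite ltry.
Qed.

Lemma cvg_prim_nsq F : L2 D F ->
  prim (fun x => F x * F x) n%:R @[n --> \oo] --> ip D F F.
Proof.
move=> lF; rewrite /prim /ip /Rintegral.
apply: fine_cvg; rewrite fineK; last first.
  by apply: integrable_fin_num; [exact: mD|exact: (L2_integrableM mD)].
apply: cvg_integral_half_line; first exact: measurable_funM lF.1 lF.1.
by move=> x; rewrite -expr2 sqr_ge0.
Qed.

Lemma L2_itv F b : L2 D F -> L2 `]0, b] F.
Proof.
move=> [mF iF]; split; first exact: measurable_sub_half_line.
by apply: integrableS iF; [exact: mD|exact: mitv|exact: sub_half_line].
Qed.

Lemma prim_cst (c b : R) : 0 <= b -> prim (fun=> c) b = c * b.
Proof.
move=> b0; rewrite /prim Rintegral_cst; last exact: mitv.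
congr (_ * _); rewrite /= lebesgue_measure_itv/= lte_fin.
by case: ltP => [_|b0'] /=; rewrite ?subr0//; apply/eqP; rewrite eq_le b0.
Qed.

Lemma prim_norm_sqr_le F b : L2 D F -> 0 <= b ->
  prim (fun x => `|F x|) b ^+ 2 <= b * ip D F F.
Proof.
move=> lF b0.
have l1 : L2 `]0, b] (fun=> 1 : R).
  have [|//|m1 i1] := @loc_int_bounded (fun=> 1 : R); first exact: measurable_cst.
    by move=> c; exists 1 => x _ _; rewrite normr1.
  split; first exact: measurable_cst.
  by apply: eq_integrable (i1 b) => [|x _ /=]; [exact: mitv|rewrite expr1n].
have := ip_CauchySchwarz (mitv 0 b) l1 (L2_itv b (L2_norm mD lF)).
rewrite [X in X ^+ 2](_ : _ = prim (fun x => `|F x|) b); last first.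
  by apply: (@eq_prim _ (fun x => 1 * `|F x|)) => x _; rewrite mul1r.
move=> /le_trans; apply; apply: ler_pM.
- exact: nsq_ge0.
- exact: nsq_ge0.
- have -> : ip `]0, b] (fun=> 1) (fun=> 1) = prim (fun=> 1) b.
    by apply: (@eq_prim _ (fun=> 1 * 1)) => x _; rewrite mul1r.
  by rewrite prim_cst// mul1r.
- have -> : ip `]0, b] (fun x => `|F x|) (fun x => `|F x|) =
      prim (fun x => F x * F x) b.
    apply: (@eq_prim _ (fun x => `|F x| * `|F x|)) => x _.
    by rewrite -normrM ger0_norm// -expr2 sqr_ge0.
  exact: prim_nsq_le.
Qed.

Lemma cvg_prim_nsq_pinfty F : L2 D F ->
  prim (fun x => F x * F x) x @[x --> +oo] --> ip D F F.
Proof.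
move=> lF; apply/cvgrPdist_lt => e e0.
have /cvgrPdist_lt /(_ _ e0) [N _ hN] := cvg_prim_nsq lF.
exists N%:R; split; first exact: num_real.
move=> x Nx; have := hN N (leqnn N) => hNN.
have l := L2_loc_intM lF lF; have le := prim_nsq_le x lF; have leN := prim_nsq_le N%:R lF.
have h : prim (fun x => F x * F x) N%:R <= prim (fun x => F x * F x) x.
  by apply: prim_homo => //; [exact: ltW|move=> t _ _; rewrite -expr2 sqr_ge0].
rewrite ger0_norm ?subr_ge0//; rewrite ger0_norm ?subr_ge0// in hNN.
by apply: le_lt_trans hNN; rewrite lerB.
Qed.

(** Polarization reduces the mixed product to squares, whose indefinite integrals are monotone. *)
Lemma cvg_prim_ip_pinfty F G : L2 D F -> L2 D G ->
  prim (fun x => F x * G x) x @[x --> +oo] --> ip D F G.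
Proof.
move=> lF lG.
have lD := L2D mD lF lG; have lB := L2B mD lF lG.
have -> : ip D F G = 4^-1 * (ip D (fun x => F x + G x) (fun x => F x + G x) -
    ip D (fun x => F x - G x) (fun x => F x - G x)).
  by rewrite (nsqD mD lF lG) (nsqB mD lF lG); field.
have -> : (fun x : R => prim (fun x => F x * G x) x) = (fun x : R => 4^-1 *
    (prim (fun x => (F x + G x) * (F x + G x)) x -
     prim (fun x => (F x - G x) * (F x - G x)) x)).
  apply/funext => x; rewrite -primN; [|exact: L2_loc_intM..].
  rewrite -primZ; last by apply: loc_intB; exact: L2_loc_intM.
  by apply: eq_prim => t _; field.
by apply: cvgMr; apply: cvgB; exact: cvg_prim_nsq_pinfty.
Qed.

End half_line_calculus.

(** * The scalar relation and its symmetry *)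

Section scalar_model.
Context {R : realType}.
Local Notation mu := (@lebesgue_measure R).
Local Notation D := (@half_line R).
Implicit Types F G th : R -> R.

Lemma measurable_cos_fun th : measurable_fun D th ->
  measurable_fun D (fun x => cos (th x)).
Proof.
move=> mth; apply: (measurableT_comp _ mth).
by apply: continuous_measurable_fun; exact: continuous_cos.
Qed.

Lemma measurable_sin_fun th : measurable_fun D th ->
  measurable_fun D (fun x => sin (th x)).
Proof.
move=> mth; apply: (measurableT_comp _ mth).
by apply: continuous_measurable_fun; exact: continuous_sin.
Qed.

Lemma ler_norm_cos (a : R) : `|cos a| <= 1.
Proof. by rewrite ler_norml cos_geN1 cos_le1. Qed.

Lemma ler_norm_sin (a : R) : `|sin a| <= 1.
Proof. by rewrite ler_norml sin_geN1 sin_le1. Qed.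

Lemma loc_int_cosM th G : measurable_fun D th -> loc_int G ->
  loc_int (fun x => cos (th x) * G x).
Proof.
move=> mth; apply: loc_int_mul_bounded; first exact: measurable_cos_fun.
by move=> b; exists 1 => x _ _; exact: ler_norm_cos.
Qed.

Lemma loc_int_sinM th G : measurable_fun D th -> loc_int G ->
  loc_int (fun x => sin (th x) * G x).
Proof.
move=> mth; apply: loc_int_mul_bounded; first exact: measurable_sin_fun.
by move=> b; exists 1 => x _ _; exact: ler_norm_sin.
Qed.

(* [volterra phi G x] is the integral of [sin (phi x - phi t) * G t] over
   (0, x], split so that each integral no longer depends on [phi x]. *)
Definition volterra th G (x : R) : R :=
  sin (th x) * prim (fun t => cos (th t) * G t) x -
  cos (th x) * prim (fun t => sin (th t) * G t) x.

(** The kernel depends only on differences of the angle, that is, rotating the frame by a constant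
    changes nothing. With [A] the limit of the angle, this replaces [phi] by an angle tending to
    zero. *)
Lemma volterra_shift (A : R) th G x : measurable_fun D th -> loc_int G ->
  volterra (fun t => A + th t) G x = volterra th G x.
Proof.
move=> mth lG; rewrite /volterra.
have lc := loc_int_cosM mth lG; have ls := loc_int_sinM mth lG.
have -> : prim (fun t => cos (A + th t) * G t) x =
    cos A * prim (fun t => cos (th t) * G t) x -
    sin A * prim (fun t => sin (th t) * G t) x.
  rewrite -!primZ// -primN; try exact: loc_intZ.
  by apply: eq_prim => t _; rewrite cosD; ring.
have -> : prim (fun t => sin (A + th t) * G t) x =
    sin A * prim (fun t => cos (th t) * G t) x +
    cos A * prim (fun t => sin (th t) * G t) x.
  rewrite -!primZ// -primD; try exact: loc_intZ.
  by apply: eq_prim => t _; rewrite sinD; ring.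
rewrite cosD sinD; have := cos2Dsin2 A.
set p := prim _ _; set q := prim _ _ => h.
rewrite -[RHS]mul1r -h; ring.
Qed.

Lemma measurable_volterra th G : measurable_fun D th -> loc_int G ->
  measurable_fun D (volterra th G).
Proof.
move=> mth lG; apply: measurable_funB; apply: measurable_funM.
- exact: measurable_sin_fun.
- by apply: measurable_prim; exact: loc_int_cosM.
- exact: measurable_cos_fun.
- by apply: measurable_prim; exact: loc_int_sinM.
Qed.

Lemma volterraD th F G x : measurable_fun D th -> loc_int F -> loc_int G ->
  volterra th (fun t => F t + G t) x = volterra th F x + volterra th G x.
Proof.
move=> mth lF lG; rewrite /volterra.
rewrite (@eq_prim _ _ (fun t => cos (th t) * F t + cos (th t) * G t)); last first.
  by move=> t _; ring.
rewrite (@eq_prim _ (fun t => sin (th t) * _) (fun t => sin (th t) * F t + sin (th t) * G t)); last first.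
  by move=> t _; ring.
by rewrite !primD; try (by apply: loc_int_cosM); try (by apply: loc_int_sinM); ring.
Qed.

Lemma volterraZ th (c : R) G x : measurable_fun D th -> loc_int G ->
  volterra th (fun t => c * G t) x = c * volterra th G x.
Proof.
move=> mth lG; rewrite /volterra.
rewrite (@eq_prim _ _ (fun t => c * (cos (th t) * G t))); last first.
  by move=> t _; ring.
rewrite (@eq_prim _ (fun t => sin (th t) * _) (fun t => c * (sin (th t) * G t))); last first.
  by move=> t _; ring.
by rewrite !primZ; try (by apply: loc_int_cosM); try (by apply: loc_int_sinM); ring.
Qed.

Variable phi : R -> R.
Hypothesis mphi : measurable_fun D phi.

(* [rel], and below [domain_closure], [op_graph] and [resolvent], are [relS],
   [domS_closure], [opS] and [resolvent_set] (at a real point) in terms of the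
   component [F] of [f] along [e_phi], for real [F]. *)
Definition rel F G := [/\ L2 D F, L2 D G & exists c : R,
  {ae mu, forall x : R, 0 < x -> F x = c * cos (phi x) + volterra phi G x}].

Lemma relD F G F' G' : rel F G -> rel F' G' ->
  rel (fun x => F x + F' x) (fun x => G x + G' x).
Proof.
move=> [lF lG [c hc]] [lF' lG' [c' hc']]; split; [exact: L2D mD _ _ _ _|exact: L2D mD _ _ _ _|].
exists (c + c'); apply: aeS2 hc hc' => x h h' x0.
rewrite h// h'// volterraD//; try exact: L2_loc_int.
by ring.
Qed.

Lemma relZ (k : R) F G : rel F G -> rel (fun x => k * F x) (fun x => k * G x).
Proof.
move=> [lF lG [c hc]]; split; [exact: L2Z mD _ _ _|exact: L2Z mD _ _ _|].
exists (k * c); apply: aeS hc => x h x0.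
by rewrite h// volterraZ//; [ring|exact: L2_loc_int].
Qed.

Lemma L2_ae_eq F G : L2 D F -> measurable_fun D G ->
  {ae mu, forall x : R, 0 < x -> F x = G x} -> L2 D G.
Proof.
move=> [mF /integrableP[mF2 iF]] mG FG; split => //; apply/integrableP; split.
  by apply/measurable_EFinP; exact: measurable_funX.
apply: le_lt_trans iF; rewrite le_eqVlt; apply/orP; left; apply/eqP.
apply: ge0_ae_eq_integral => //.
- exact: mD.
- apply: measurableT_comp => //; apply/measurable_EFinP.
  exact: measurable_funX.
- exact: measurableT_comp.
- by apply: aeS FG => x h; rewrite half_lineE => x0; rewrite /= h.
Qed.

(* For a representative F, the pair (q, p) = (c - prim (sin * G), prim (cos * G))
   is the vector solution; F is its component along e_phi, and the Wronskian of
   two solutions is invariant under rotation of the frame. *)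
Lemma rel_symmetric F G F1 G1 : rel F G -> rel F1 G1 -> ip D F G1 = ip D G F1.
Proof.
move=> [lF lG [c hc]] [lF1 lG1 [c1 hc1]].
have lliG := L2_loc_int lG; have lliG1 := L2_loc_int lG1.
pose p := prim (fun t => cos (phi t) * G t).
pose s := prim (fun t => sin (phi t) * G t).
pose p1 := prim (fun t => cos (phi t) * G1 t).
pose s1 := prim (fun t => sin (phi t) * G1 t).
have lc := loc_int_cosM mphi lliG; have lc1 := loc_int_cosM mphi lliG1.
have ls := loc_int_sinM mphi lliG; have ls1 := loc_int_sinM mphi lliG1.
pose X x := c * cos (phi x) + volterra phi G x.
pose X1 x := c1 * cos (phi x) + volterra phi G1 x.
have mX : measurable_fun D X.
  apply: measurable_funD; last exact: measurable_volterra.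
  by apply: measurable_funM => //; exact: measurable_cos_fun.
have mX1 : measurable_fun D X1.
  apply: measurable_funD; last exact: measurable_volterra.
  by apply: measurable_funM => //; exact: measurable_cos_fun.
have lX := L2_ae_eq lF mX hc; have lX1 := L2_ae_eq lF1 mX1 hc1.
have hD (P Q : R -> R) : {ae mu, forall x : R, 0 < x -> P x = Q x} ->
    {ae mu, forall x : R, D x -> P x = Q x}.
  by apply: aeS => x h; rewrite half_lineE.
rewrite (ae_eq_ip mD lF lX lG1 (hD _ _ hc)) (ipC D G).
rewrite (ae_eq_ip mD lF1 lX1 lG (hD _ _ hc1)) (ipC D X1).
(* The Wronskian vanishes at 0 because both second components do. By [WE] it is a difference of two
   inner products over ]0, x], hence it converges, and its limit [w] has to be shown to be zero. *)
pose W x := (c - s x) * p1 x - p x * (c1 - s1 x).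
have WE x : 0 <= x -> W x = prim (fun t => X t * G1 t) x - prim (fun t => G t * X1 t) x.
  move=> x0.
  have e1 : s x * p1 x = _ := prim_parts ls lc1 x0.
  have e2 : p x * s1 x = _ := prim_parts lc ls1 x0.
  have mbp := (measurable_prim lc, prim_locally_bounded lc).
  have mbs := (measurable_prim ls, prim_locally_bounded ls).
  have mbp1 := (measurable_prim lc1, prim_locally_bounded lc1).
  have mbs1 := (measurable_prim ls1, prim_locally_bounded ls1).
  have comm (f g : R -> R) : loc_int (fun x => f x * g x) -> loc_int (fun x => g x * f x).
    by congr loc_int; apply/funext => t; rewrite mulrC.
  have l1 : loc_int (fun t => (sin (phi t) * G t) * p1 t).
    by apply: comm; exact: loc_int_mul_bounded mbp1.1 mbp1.2 ls.
  have l2 : loc_int (fun t => s t * (cos (phi t) * G1 t)).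
    exact: loc_int_mul_bounded mbs.1 mbs.2 lc1.
  have l3 : loc_int (fun t => (cos (phi t) * G t) * s1 t).
    by apply: comm; exact: loc_int_mul_bounded mbs1.1 mbs1.2 lc.
  have l4 : loc_int (fun t => p t * (sin (phi t) * G1 t)).
    exact: loc_int_mul_bounded mbp.1 mbp.2 ls1.
  rewrite -primN; [|exact: L2_loc_intM..].
  have -> : W x = c * p1 x - c1 * p x - s x * p1 x + p x * s1 x by rewrite /W; ring.
  have k1 := loc_intB (loc_intZ c lc1) (loc_intZ c1 lc).
  have k2 := loc_intD l1 l2; have k3 := loc_intD l3 l4.
  rewrite -(primZ c x lc1 : _ = c * p1 x) -(primZ c1 x lc : _ = c1 * p x).
  rewrite -(primN x (loc_intZ c lc1) (loc_intZ c1 lc)).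
  rewrite e1 e2.
  rewrite -(primD _ l1 l2) -(primD _ l3 l4) -(primN _ k1 k2).
  rewrite -(primD _ (loc_intB k1 k2) k3).
  by apply: eq_prim => t _; rewrite /X /X1 /volterra -/p -/s -/p1 -/s1; ring.
apply/eqP; rewrite -subr_eq0; apply/eqP; set w := _ - _.
apply/eqP; apply: contraT => w0.
have w20 : 0 < `|w| / 2 by rewrite divr_gt0// normr_gt0.
have [M0 [_ hM0]] : \forall x \near +oo, `|w| / 2 < `|W x|.
  have cW : prim (fun t => X t * G1 t) x - prim (fun t => G t * X1 t) x
      @[x --> +oo] --> w.
    exact: cvgB (cvg_prim_ip_pinfty lX lG1) (cvg_prim_ip_pinfty lG lX1).
  move/cvgrPdist_lt : cW => /(_ _ w20) [M0 [M0r hM]].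
  exists (Num.max M0 0); split; first exact: num_real.
  move=> x; rewrite gt_max => /andP[M0x x0]; rewrite WE; last exact: ltW.
  have := hM x M0x; set z := prim _ _ - prim _ _ => /= wz.
  have := lerB_dist w z; lra.
have Gle0 : 0 <= ip D G G by exact: nsq_ge0.
have G1le0 : 0 <= ip D G1 G1 by exact: nsq_ge0.
pose K := 4 * c ^+ 2 + 4 * c1 ^+ 2 + 6 * ip D G G + 6 * ip D G1 G1 + 1.
have K0 : 0 < K by have := sqr_ge0 c; have := sqr_ge0 c1; rewrite /K; lra.
have prim_sq (h H : R -> R) x : 0 <= x -> measurable_fun D h ->
    (forall t, `|h t| <= 1) -> L2 D H ->
    prim (fun t => h t * H t) x ^+ 2 <= x * ip D H H.
  move=> x0 mh h1 lH; apply: le_trans (prim_norm_sqr_le lH x0).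
  have lhH : loc_int (fun t => h t * H t).
    apply: loc_int_mul_bounded => //; last exact: L2_loc_int.
    by move=> b; exists 1.
  rewrite -[leLHS]real_normK ?num_real// lerXn2r ?nnegrE//.
    by apply: prim_ge0.
  apply: (le_trans (ler_norm_prim lhH x0)).
  apply: le_prim; [exact: loc_int_norm|exact/loc_int_norm/L2_loc_int|].
  by move=> t _ _; rewrite normrM ler_piMl.
have mc := measurable_cos_fun mphi; have ms := measurable_sin_fun mphi.
(* In the rotated frame a solution has the component [X] along e_phi and [Y] across it. By
   Cauchy-Schwarz [Y] grows at most like the square root of 1 + x, so W = X Y1 - Y X1 can stay away
   from zero only if X^2 + X1^2 is at least a multiple of 1/(1 + x). *)
have Wbound x : 0 <= x -> W x ^+ 2 <= 2 * K * (1 + x) * (X x * X x + X1 x * X1 x).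
  move=> x0.
  have p2 : p x ^+ 2 <= x * ip D G G by apply: prim_sq => // t; exact: ler_norm_cos.
  have s2 : s x ^+ 2 <= x * ip D G G by apply: prim_sq => // t; exact: ler_norm_sin.
  have p12 : p1 x ^+ 2 <= x * ip D G1 G1 by apply: prim_sq => // t; exact: ler_norm_cos.
  have s12 : s1 x ^+ 2 <= x * ip D G1 G1 by apply: prim_sq => // t; exact: ler_norm_sin.
  pose Y := - sin (phi x) * (c - s x) + cos (phi x) * p x.
  pose Y1 := - sin (phi x) * (c1 - s1 x) + cos (phi x) * p1 x.
  have cs := cos2Dsin2 (phi x).
  have WY : W x = X x * Y1 - Y * X1 x.
    rewrite /W /X /X1 /Y /Y1 /volterra -/p -/s -/p1 -/s1 -[LHS]mul1r -cs; ring.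
  have Yle (q r : R) : (- sin (phi x) * q + cos (phi x) * r) ^+ 2 <= q ^+ 2 + r ^+ 2.
    have := sqr_ge0 (cos (phi x) * q + sin (phi x) * r) => h.
    rewrite -[leRHS]mul1r -cs -subr_ge0.
    by rewrite [X in 0 <= X](_ : _ = (cos (phi x) * q + sin (phi x) * r) ^+ 2)//; ring.
  have Y2 : Y ^+ 2 <= K * (1 + x).
    apply: (le_trans (Yle _ _)); have := sqr_ge0 (c + s x); have := sqr_ge0 c1.
    have : 0 <= x * ip D G1 G1 by rewrite mulr_ge0.
    have : 0 <= x * c ^+ 2 by rewrite mulr_ge0// sqr_ge0.
    have : 0 <= x * c1 ^+ 2 by rewrite mulr_ge0// sqr_ge0.
    have : 0 <= x * ip D G G by rewrite mulr_ge0.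
    rewrite /K; nra.
  have Y12 : Y1 ^+ 2 <= K * (1 + x).
    apply: (le_trans (Yle _ _)); have := sqr_ge0 (c1 + s1 x); have := sqr_ge0 c.
    have : 0 <= x * ip D G1 G1 by rewrite mulr_ge0.
    have : 0 <= x * c ^+ 2 by rewrite mulr_ge0// sqr_ge0.
    have : 0 <= x * c1 ^+ 2 by rewrite mulr_ge0// sqr_ge0.
    have : 0 <= x * ip D G G by rewrite mulr_ge0.
    rewrite /K; nra.
  have X2 := sqr_ge0 (X x); have X12 := sqr_ge0 (X1 x).
  have := ler_wpM2l X2 Y12; have := ler_wpM2l X12 Y2.
  have := sqr_ge0 (X x * Y1 + Y * X1 x); rewrite WY; nra.
have lXX := L2_loc_intM lX lX; have lX1X1 := L2_loc_intM lX1 lX1.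
pose S x := prim (fun t => X t * X t + X1 t * X1 t) x.
have cS : S x @[x --> +oo] --> ip D X X + ip D X1 X1.
  have -> : S = (fun x => prim (fun t => X t * X t) x + prim (fun t => X1 t * X1 t) x).
    by apply/funext => x; rewrite /S primD.
  by apply: cvgD; exact: cvg_prim_nsq_pinfty.
(* On ]b, 2b] the sum X^2 + X1^2 is at least k/(1 + 2b). For b >= 1 its integral is then at least
   k/3, whereas convergence of [S] within k/8 allows less than k/4. *)
pose k := w ^+ 2 / (8 * K).
have k0 : 0 < k.
  by apply: divr_gt0; [rewrite exprn_even_gt0|rewrite mulr_gt0].
have k80 : 0 < k / 8 by rewrite divr_gt0.
have /cvgrPdist_lt /(_ _ k80) [M1 [_ hM1]] := cS.
pose b := 1 + Num.max (Num.max M0 M1) 0.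
have [bM0 bM1 b1] : [/\ M0 < b, M1 < b & 1 <= b].
  rewrite /b; split.
  - by rewrite (@le_lt_trans _ _ (Num.max (Num.max M0 M1) 0))// ?ltrDr// !le_max lexx.
  - by rewrite (@le_lt_trans _ _ (Num.max (Num.max M0 M1) 0))// ?ltrDr// !le_max lexx orbT.
  - by rewrite lerDl le_max lexx orbT.
have b0 : 0 <= b by lra.
have hb := hM1 b bM1; have h2b : `|ip D X X + ip D X1 X1 - S (2 * b)| < k / 8.
  by apply: hM1; lra.
have : k / (1 + 2 * b) * b <= S (2 * b) - S b.
  rewrite /S primB; [|exact: loc_intD|lra|lra].
  apply: (@le_trans _ _ (\int[mu]_(t in `]b, 2 * b]) (k / (1 + 2 * b)))).
    rewrite Rintegral_cst; last exact: mitv.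
    apply: ler_wpM2l; first by apply: divr_ge0; [exact: ltW|lra].
    rewrite /= lebesgue_measure_itv/= lte_fin; case: ltP => /= h; lra.
  apply: le_Rintegral; [exact: mitv| | |].
  - have [|//|_ i] := @loc_int_bounded R (fun=> k / (1 + 2 * b)).
      exact: measurable_cst.
      by move=> z; exists `|k / (1 + 2 * b)| => x _ _.
    by apply: integrable_itv b0; split => //; exact: measurable_cst.
  - by apply: integrable_itv => //; exact: loc_intD.
  - move=> t; rewrite /= in_itv/= => /andP[bt tb].
    have t0 : 0 <= t by lra.
    have /= Wt : `|w| / 2 < `|W t| by apply: hM0; lra.
    have W2 : w ^+ 2 / 4 <= W t ^+ 2.
      rewrite -[w ^+ 2]real_normK ?num_real// -[W t ^+ 2]real_normK ?num_real//.
      by have := normr_ge0 w; nra.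
    have XX0 : 0 <= X t * X t + X1 t * X1 t by rewrite addr_ge0 -?expr2 ?sqr_ge0.
    rewrite ler_pdivrMr; last lra.
    rewrite /k ler_pdivrMr; last by rewrite mulr_gt0.
    have := Wbound t t0.
    have : 0 <= K * (X t * X t + X1 t * X1 t) * (2 * b - t).
      by apply: mulr_ge0; [apply: mulr_ge0 => //; exact: ltW|lra].
    lra.
have : k / 3 <= k / (1 + 2 * b) * b.
  rewrite -mulrA; apply: ler_wpM2l; first exact: ltW.
  by rewrite mulrC ler_pdivlMr; move: b1; clear => b1; lra.
move: hb h2b; rewrite !ltr_norml => /andP[_ h1] /andP[h2 _] h3 h4.
move: k0 h1 h2 h3 h4; move: (k) (k / _ * b) (S b) (S (2 * b)) (ip D X X + _).
by clear => k y u v z ? ? ? ? ?; lra.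
Qed.

End scalar_model.

(** * Resolvent estimates and the form bound *)

Section resolvent_model.
Context {R : realType}.
Local Notation mu := (@lebesgue_measure R).
Local Notation D := (@half_line R).
Implicit Types F G th : R -> R.
Local Notation nsq F := (ip D F F).

Variable phi : R -> R.
Hypothesis mphi : measurable_fun D phi.
Local Notation rel := (rel phi).

Definition domain_closure F := L2 D F /\ forall e : R, 0 < e ->
  exists h k, rel h k /\ nsq (fun x => F x - h x) < e.

Definition op_graph F G := rel F G /\ domain_closure G.

Definition resolvent (w : R) :=
  (forall h, domain_closure h -> exists F G, op_graph F G /\
     {ae mu, forall x : R, 0 < x -> G x - w * F x = h x}) /\
  exists M : R, forall F G, op_graph F G ->
     nsq F <= M * nsq (fun x => G x - w * F x).

Lemma ae_half_line (P Q : R -> R) : {ae mu, forall x : R, 0 < x -> P x = Q x} ->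
  {ae mu, forall x : R, D x -> P x = Q x}.
Proof. by apply: aeS => x h; rewrite half_lineE. Qed.

Lemma nsq0 : nsq (fun=> 0) = 0.
Proof. by rewrite (ae_eq0_nsq mD (L20 mD))//; apply: aeW. Qed.

Lemma nsq_subrr F : nsq (fun x => F x - F x) = 0.
Proof.
rewrite /ip (@eq_Rintegral _ _ _ _ _ (fun=> 0)) ?/Rintegral ?integral0//.
by move=> x _; rewrite subrr mul0r.
Qed.

Lemma rel_cl F G : rel F G -> domain_closure F.
Proof.
move=> h; have [lF _ _] := h; split => // e e0; exists F, G; split => //.
by rewrite nsq_subrr.
Qed.

Lemma op0 : op_graph (fun=> 0) (fun=> 0).
Proof.
have r0 : rel (fun=> 0) (fun=> 0).
  split; [exact: L20 mD|exact: L20 mD|exists 0; apply: aeW => x x0].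
  have pz h : prim (fun t => h t * 0) x = 0 :> R.
    by rewrite (@eq_prim _ _ (fun=> 0)) ?prim_cst ?mul0r ?ltW// => t _; rewrite mulr0.
  by rewrite mul0r add0r /volterra !pz !mulr0 subrr.
by split=> //; exact: rel_cl r0.
Qed.

Lemma clD F G : domain_closure F -> domain_closure G -> domain_closure (fun x => F x + G x).
Proof.
move=> [lF hF] [lG hG]; split; first exact: L2D mD _ _ _ _.
move=> e e0; have e40 : 0 < e / 4 by rewrite divr_gt0.
have [h [k [hk he]]] := hF _ e40; have [h' [k' [hk' he']]] := hG _ e40.
exists (fun x => h x + h' x), (fun x => k x + k' x); split; first exact: relD.
have [lh _ _] := hk; have [lh' _ _] := hk'.
have -> : (fun x => F x + G x - (h x + h' x)) =
    (fun x => (F x - h x) + (G x - h' x)) by apply/funext => x; ring.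
apply: (le_lt_trans (nsqD_le mD (L2B mD lF lh) (L2B mD lG lh'))); lra.
Qed.

Lemma clZ (c : R) F : domain_closure F -> domain_closure (fun x => c * F x).
Proof.
move=> [lF hF]; split; first exact: L2Z mD _ _ _.
move=> e e0; have c0 : 0 < c ^+ 2 + 1 by rewrite ltr_wpDl// sqr_ge0.
have [h [k [hk he]]] := hF _ (divr_gt0 e0 c0).
exists (fun x => c * h x), (fun x => c * k x); split; first exact: relZ.
have [lh _ _] := hk.
have -> : (fun x => c * F x - c * h x) = (fun x => c * (F x - h x)).
  by apply/funext => x; ring.
rewrite (nsqZ mD c (L2B mD lF lh)).
move: he; rewrite ltr_pdivlMr//; have := nsq_ge0 D (fun x => F x - h x).
move: (nsq _) => u; nra.
Qed.

Lemma opD F G F' G' : op_graph F G -> op_graph F' G' ->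
  op_graph (fun x => F x + F' x) (fun x => G x + G' x).
Proof. by move=> [? ?] [? ?]; split; [exact: relD|exact: clD]. Qed.

Lemma opZ (c : R) F G : op_graph F G -> op_graph (fun x => c * F x) (fun x => c * G x).
Proof. by move=> [? ?]; split; [exact: relZ|exact: clZ]. Qed.

(* If g = (S - w) g' then |g|^2 = <g', (S - w) g>, so a lower bound for S - w on
   the graph of the operator passes to the whole relation. *)
Lemma res_bound_rel w M : resolvent w -> 0 <= M ->
  (forall F G, op_graph F G -> nsq F <= M * nsq (fun x => G x - w * F x)) ->
  forall F G, rel F G -> nsq F <= M * nsq (fun x => G x - w * F x).
Proof.
move=> [surj _] M0 hM g k hgk.
have [g' [k' [hop hae]]] := surj _ (rel_cl hgk).
have hg' := hop.1; have [lg lk _] := hgk; have [lg' lk' _] := hg'.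
have lw := L2B mD lk (L2Z mD w lg); have lw' := L2B mD lk' (L2Z mD w lg').
have e1 : nsq (fun x => k' x - w * g' x) = nsq g.
  by apply: (ae_eq_nsq mD) => //; exact: ae_half_line.
have e2 : nsq g = ip D g' (fun x => k x - w * g x).
  rewrite -(ae_eq_ip mD lw' lg lg (ae_half_line hae)).
  rewrite (ipBl mD) ?(ipBr mD) ?(ipZl mD) ?(ipZr mD)//; try exact: (L2Z mD).
  by rewrite (rel_symmetric mphi hg' hgk) (ipC D k').
have CS := ip_CauchySchwarz mD lg' lw; rewrite -e2 in CS.
have := hM _ _ hop; rewrite e1 => hM'.
have g0 := nsq_ge0 D g; have w0 := nsq_ge0 D (fun x => k x - w * g x).
have {CS} : nsq g ^+ 2 <= nsq g * (M * nsq (fun x => k x - w * g x)).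
  apply: (le_trans CS); apply: le_trans (ler_wpM2r w0 hM') _.
  by rewrite mulrA (mulrC (nsq g)).
rewrite le_eqVlt in g0; case/predU1P: g0 => [<-|g0].
  by rewrite mulr_ge0.
by rewrite expr2 ler_pM2l.
Qed.

(** A one-sided bound for the quadratic form of the inverse relation, [F] being in the role of the
    inverse applied to [G]. As it is stated for [rel], it can be tested with pairs outside the graph
    of the operator. *)
Definition form_bound := exists2 C : R, 0 <= C &
  forall F G, rel F G -> ip D F G <= C * nsq G.

(** From 2 <g, k> <= |g|^2 + |k|^2, where the resolvent bound, extended to the whole relation,
    controls |g|^2 by |k|^2. The maximum with 0 is taken because the constant in [resolvent] may be
    negative. *)
Lemma form_bound_resolvent0 : resolvent 0 -> form_bound.
Proof.
move=> r0; have [_ [M hM]] := r0.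
have hM' F G : op_graph F G -> nsq F <= Num.max M 0 * nsq (fun x => G x - 0 * F x).
  move=> h; apply: (le_trans (hM _ _ h)); apply: ler_wpM2r; first exact: nsq_ge0.
  by rewrite le_max lexx.
have M0 : 0 <= Num.max M 0 by rewrite le_max lexx orbT.
exists (Num.max M 0 + 1); first by rewrite addr_ge0.
move=> g k hgk; have := res_bound_rel r0 M0 hM' hgk.
have [lg lk _] := hgk.
have -> : (fun x => k x - 0 * g x) = k by apply/funext => x; rewrite mul0r subr0.
have := nsq_ge0 D (fun x => g x - k x); rewrite (nsqB mD lg lk).
have := nsq_ge0 D k; have := nsq_ge0 D g; move: (Num.max M 0) (nsq g) (nsq k) (ip D g k).
clear => M a b c; lra.
Qed.

(* With T = (S - w0)^-1 and w0 = e/2: if |T|^2 = B > w0^-2, then T^2 f is close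
   to B f for almost maximizing f, so S - w0 - m or S - w0 + m, m = B^(-1/2),
   is not bounded below although both points lie in (0, e).  Hence
   |(S - w0) F|^2 >= w0^2 |F|^2, which expands to the form bound. *)
Lemma gap_lower_bound (e : R) : 0 < e -> (forall w, 0 < w < e -> resolvent w) ->
  forall F G, op_graph F G ->
    nsq F <= (e / 2) ^- 2 * nsq (fun x => G x - e / 2 * F x).
Proof.
move=> e0 hres; set w0 := e / 2.
have w00 : 0 < w0 by rewrite divr_gt0.
have w0e : 0 < w0 < e by rewrite w00 /w0 ltr_pdivrMr// ltr_pMr// ltr1n.
have [surj [M hM]] := hres _ w0e.
(* The supremum [B] of this set is the squared operator norm of the inverse of S - w0. *)
pose E := [set b | exists F G, [/\ op_graph F G, nsq (fun x => G x - w0 * F x) <= 1 & b = nsq F]].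
have opL2 F G : op_graph F G -> L2 D F /\ L2 D G by move=> [[]].
have opL2w w F G : op_graph F G -> L2 D (fun x => G x - w * F x).
  by move=> /opL2[lF lG]; apply: (L2B mD) => //; exact: (L2Z mD).
have E0 : E 0.
  exists (fun=> 0), (fun=> 0); split; [exact: op0| |by rewrite nsq0].
  have -> : (fun x : R => 0 - w0 * 0) = (fun=> 0 : R).
    by apply/funext => x; rewrite mulr0 subrr.
  by rewrite nsq0.
have hsE : has_sup E.
  split; first by exists 0.
  exists (Num.max M 0) => _ [F [G [h1 h2 ->]]].
  apply: (le_trans (hM _ _ h1)).
  apply: (@le_trans _ _ (Num.max M 0 * nsq (fun x => G x - w0 * F x))).
    by apply: ler_wpM2r; [exact: nsq_ge0|rewrite le_max lexx].
  by rewrite ler_piMr// le_max lexx orbT.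
set B := sup E.
have B0 : 0 <= B by apply: sup_upper_bound.
have hB F G : op_graph F G -> nsq F <= B * nsq (fun x => G x - w0 * F x).
  move=> h; have [lF lG] := opL2 _ _ h; have lH := opL2w w0 _ _ h.
  set n := nsq (fun x => G x - w0 * F x).
  have n0 : 0 <= n by exact: nsq_ge0.
  have [nE|n1] := eqVneq n 0.
    by have := hM _ _ h; rewrite -/n nE !mulr0.
  have {n1}n0 : 0 < n by rewrite lt_neqAle eq_sym n1.
  pose c := (Num.sqrt n)^-1.
  have c2 : c ^+ 2 = n^-1 by rewrite /c exprVn sqr_sqrtr// ltW.
  have : nsq (fun x => c * F x) <= B.
    apply: sup_upper_bound => //; exists (fun x => c * F x), (fun x => c * G x).
    split => //; first exact: opZ.
    have -> : (fun x => c * G x - w0 * (c * F x)) = (fun x => c * (G x - w0 * F x)).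
      by apply/funext => x; ring.
    by rewrite (nsqZ mD c lH) c2 -/n mulVf ?gt_eqF.
  by rewrite (nsqZ mD c lF) c2 ler_pdivrMl// mulrC.
suff Bw : B <= w0 ^- 2.
  move=> F G h; apply: (le_trans (hB _ _ h)).
  by apply: ler_wpM2r Bw; exact: nsq_ge0.
rewrite leNgt; apply/negP => Bw.
have Bp : 0 < B by apply: lt_trans Bw; rewrite invr_gt0 exprn_gt0.
pose b := Num.sqrt B.
have b2 : b ^+ 2 = B by rewrite sqr_sqrtr.
have b0 : 0 < b by rewrite sqrtr_gt0.
pose m := b^-1.
have m0 : 0 < m by rewrite invr_gt0.
have bm : b * m = 1 by rewrite divff// gt_eqF.
have mw : m < w0.
  rewrite -(ltr_pXn2r (ltn0Sn 1)) ?nnegrE ?ltW// /m exprVn b2.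
  by rewrite -[ltRHS]invrK ltf_pV2// posrE invr_gt0 exprn_gt0.
have hp : 0 < w0 + m < e by rewrite addr_gt0//= [ltRHS](splitr e) ltrD2l.
have hm : 0 < w0 - m < e.
  by rewrite subr_gt0 mw /= (lt_trans _ (andP w0e).2)// ltrBlDr ltrDl.
have [_ [M1 hM1]] := hres _ hp; have [_ [M2 hM2]] := hres _ hm.
(* Composes the estimates of [F] by [y], of [y] by [u] and [v], of [u] by [v], and of [v] by
   [eta]. *)
have chain (N Y U V W a1 a2 q : R) : 0 <= a1 -> 0 <= a2 -> 0 <= q ->
    N <= a2 * (q * Y) -> Y <= 2 * (q * (U + V)) -> U <= a1 * (q * V) -> V <= W ->
    N <= a2 * q * (2 * (q * (a1 * (q * W) + W))).
  move=> a10 a20 q0 h1 h2 h3 h4; rewrite -mulrA; apply: (le_trans h1).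
  do 2 (apply: ler_wpM2l => //); apply: (le_trans h2).
  do 2 (apply: ler_wpM2l => //); apply: lerD => //; apply: (le_trans h3).
  by do 2 (apply: ler_wpM2l => //).
(* For an almost maximizing [f], the functions [F] and [F2] are T f and T^2 f. Symmetry gives <F2,
   f> = |F|^2, which makes [v] small; the two resolvent bounds then make |F|^2 small with [eta],
   although it exceeds B - eta. *)
have key eta : 0 < eta -> exists2 N, B - eta < N &
    N <= `|M2| * m ^+ 2 * (2 * (m ^+ 2 * (`|M1| * (m ^+ 2 * (2 * B * eta))
       + 2 * B * eta))).
  move=> eta0.
  have [_ [F [G [hop h1 ->]]] hN] : exists2 N, E N & B - eta < N.
    exact: sup_adherent.
  exists (nsq F) => //; move: h1; set f := (fun x => G x - w0 * F x) => h1.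
  have lf : L2 D f by exact: opL2w.
  have [lF lG] := opL2 _ _ hop; have relFG := hop.1.
  have [F2 [G2 [hop2 hae2]]] := surj _ (rel_cl relFG).
  have [lF2 lG2] := opL2 _ _ hop2; have lf2 := opL2w w0 _ _ hop2.
  have e2 : nsq (fun x => G2 x - w0 * F2 x) = nsq F.
    by apply: (ae_eq_nsq mD) => //; exact: ae_half_line.
  have ipF2f : ip D F2 f = nsq F.
    rewrite -(ae_eq_ip mD lf2 lF lF (ae_half_line hae2)) /f.
    rewrite (ipBl mD) ?(ipBr mD) ?(ipZl mD) ?(ipZr mD)//; try exact: (L2Z mD).
    by rewrite (rel_symmetric mphi hop2.1 relFG).
  pose v x := F2 x - B * f x.
  have lv : L2 D v by apply: (L2B mD) => //; exact: (L2Z mD).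
  have nv : nsq v <= 2 * B * eta.
    rewrite /v (nsqB mD lF2 (L2Z mD B lf)) (nsqZ mD B lf) (ipZr mD B lf lF2) ipF2f.
    have := hB _ _ hop2; rewrite e2 => hF2.
    have := hB _ _ hop; rewrite -/f => hF.
    have h3 : B * nsq F <= B * B by apply: ler_wpM2l => //; nra.
    have h4 : B ^+ 2 * nsq f <= B ^+ 2 by rewrite ler_piMr// sqr_ge0.
    have h5 : B * (B - eta) <= B * nsq F by apply: ler_wpM2l => //; exact: ltW.
    move: h3 h4 h5 hF2 hN; move: (nsq F) (nsq F2) (nsq f) (B) (eta).
    by clear => a c d BB ee; nra.
  (* T^2 - B factors as (T - b)(T + b). Here [u] is (T + b) T f, and since m b = 1 it solves (S - w0
     - m) u = - m v. *)
  pose u x := F2 x + b * F x.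
  have hopu : op_graph u (fun x => G2 x + b * G x) by apply: opD => //; exact: opZ.
  (* This is (T + b) f, which equals m (u - v), and (S - w0 + m) F = m y. *)
  pose y x := F x + b * f x.
  have lu : L2 D u by apply: (L2D mD) => //; exact: (L2Z mD).
  have ly : L2 D y by apply: (L2D mD) => //; exact: (L2Z mD).
  have nu : nsq u <= `|M1| * (m ^+ 2 * nsq v).
    apply: (le_trans (hM1 _ _ hopu)).
    have lz := opL2w (w0 + m) _ _ hopu.
    have -> : nsq (fun x => G2 x + b * G x - (w0 + m) * u x) =
              nsq (fun x => - m * v x).
      apply: (ae_eq_nsq mD lz (L2Z mD (- m) lv)).
      apply: aeS (ae_half_line hae2) => x h Dx.
      have {}h : G2 x = F x + w0 * F2 x by rewrite -h//; ring.
      rewrite /u /v h -b2 /f.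
      have -> : F x + w0 * F2 x + b * G x - (w0 + m) * (F2 x + b * F x) =
        F x * (1 - b * m) - m * F2 x + (b * G x - w0 * b * F x) by ring.
      have -> : - m * (F2 x - b ^+ 2 * (G x - w0 * F x)) =
        - m * F2 x + (b * m) * (b * G x - w0 * b * F x) by ring.
      by rewrite bm; ring.
    rewrite (nsqZ mD (- m) lv) sqrrN; apply: ler_wpM2r; last exact: ler_norm.
    by rewrite mulr_ge0 ?sqr_ge0// nsq_ge0.
  have ny : nsq y <= 2 * (m ^+ 2 * (nsq u + nsq v)).
    have -> : y = (fun x => m * (u x - v x)).
      apply/funext => x; rewrite /y /u /v -b2.
      have -> : m * (F2 x + b * F x - (F2 x - b ^+ 2 * f x)) =
        (b * m) * F x + (b * m) * b * f x by ring.
      by rewrite bm !mul1r.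
    rewrite (nsqZ mD m (L2B mD lu lv)).
    have := nsqB_le mD lu lv; have := sqr_ge0 m.
    move: (nsq (fun x => u x - v x)) (nsq u) (nsq v) (m ^+ 2); clear => a c d q; nra.
  have nF : nsq F <= `|M2| * (m ^+ 2 * nsq y).
    apply: (le_trans (hM2 _ _ hop)).
    have -> : (fun x => G x - (w0 - m) * F x) = (fun x => m * y x).
      apply/funext => x; rewrite /y /f.
      have -> : m * (F x + b * (G x - w0 * F x)) =
        m * F x + (b * m) * (G x - w0 * F x) by ring.
      by rewrite bm; ring.
    rewrite (nsqZ mD m ly); apply: ler_wpM2r; last exact: ler_norm.
    by rewrite mulr_ge0 ?sqr_ge0// nsq_ge0.
  exact: (chain _ _ _ _ _ `|M1| `|M2| (m ^+ 2) _ _ (sqr_ge0 m) nF ny nu nv).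
pose C := `|M2| * m ^+ 2 * (2 * (m ^+ 2 * (`|M1| * (m ^+ 2 * (2 * B)) + 2 * B))).
have C0 : 0 <= C.
  have := sqr_ge0 m; rewrite /C; move: (m ^+ 2) => q q0.
  by repeat (apply: mulr_ge0 || apply: addr_ge0).
(* [C] times eta bounds |F|^2, which exceeds B - eta; with eta = B/(C + 2) this reads B - eta < B -
   2 eta. *)
have eta0 : 0 < B / (C + 2) by rewrite divr_gt0// ltr_wpDl.
have [N N1 N2] := key _ eta0.
have C20 : 0 < C + 2 by rewrite ltr_wpDl.
have : B - B / (C + 2) < C * (B / (C + 2)).
  apply: lt_le_trans N1 _; apply: (le_trans N2).
  by rewrite le_eqVlt; apply/orP; left; apply/eqP; rewrite /C; ring.
have -> : C * (B / (C + 2)) = B - 2 * (B / (C + 2)) by field; rewrite gt_eqF.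
have fin (a c : R) : 0 < a -> c - a < c - 2 * a -> False by move=> *; lra.
exact: fin eta0.
Qed.

(** With w0 = e/2, the terms w0^2 |F|^2 on both sides of the lower bound cancel and leave 2 w0 <F,
    G> <= |G|^2; this is where e^-1 comes from. *)
Lemma form_bound_gap (e : R) : 0 < e -> (forall w, 0 < w < e -> resolvent w) ->
  form_bound.
Proof.
move=> e0 hres.
have w00 : 0 < e / 2 by rewrite divr_gt0.
have w0e : 0 < e / 2 < e by rewrite w00 /= ltr_pdivrMr// ltr_pMr// ltr1n.
have i0 : 0 <= (e / 2) ^- 2 by rewrite invr_ge0 sqr_ge0.
exists e^-1 => [|g k hgk]; first by rewrite invr_ge0 ltW.
have := res_bound_rel (hres _ w0e) i0 (gap_lower_bound e0 hres) hgk.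
have [lg lk _] := hgk.
rewrite ler_pdivlMl ?exprn_gt0//.
rewrite (nsqB mD lk (L2Z mD (e / 2) lg)) (nsqZ mD _ lg) (ipZr mD _ lg lk) (ipC D k).
rewrite ler_pdivlMl//; move: (nsq g) (nsq k) (ip D g k); clear => a b c; lra.
Qed.

End resolvent_model.

(** * Test functions with compact support *)

Section test_functions.
Context {R : realType}.
Local Notation mu := (@lebesgue_measure R).
Local Notation D := (@half_line R).
Implicit Types F G th : R -> R.
Local Notation nsq F := (ip D F F).

Lemma L2_compact_support F (T : R) : measurable_fun D F -> locally_bounded F ->
  (forall x, T < x -> F x = 0) -> L2 D F.
Proof.
move=> mF bF F0.
have lF : loc_int (fun x => F x * F x).
  exact: loc_int_mul_bounded mF bF (loc_int_bounded mF bF).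
have [|//] := @L2_bounded_prim R F (prim (fun x => F x * F x) (Num.max T 0)) lF mF.
move=> n; have [nT|Tn] := leP n%:R (Num.max T 0).
  by apply: prim_homo => // t _ _; rewrite -expr2 sqr_ge0.
have M0 : 0 <= Num.max T 0 by rewrite le_max lexx orbT.
rewrite -subr_le0 primB//; last exact: ltW.
rewrite (@eq_Rintegral _ _ _ _ _ (fun=> 0)) ?/Rintegral ?integral0//.
move=> x; rewrite inE/= in_itv/= gt_max => /andP[/andP[Tx _] _].
by rewrite F0// mul0r.
Qed.

Lemma prim_eventually0 F (T x : R) : loc_int F -> 0 <= T -> T <= x ->
  (forall t, T < t -> F t = 0) -> prim F x = prim F T.
Proof.
move=> lF T0 Tx F0; apply/eqP; rewrite -subr_eq0 primB//; apply/eqP.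
rewrite (@eq_Rintegral _ _ _ _ _ (fun=> 0)) ?/Rintegral ?integral0//.
by move=> t; rewrite inE/= in_itv/= => /andP[Tt _]; rewrite F0.
Qed.

Lemma ip_compact_support F G (T : R) : L2 D F -> L2 D G -> 0 <= T ->
  (forall t, T < t -> G t = 0) -> ip D F G = prim (fun x => F x * G x) T.
Proof.
move=> lF lG T0 G0; have h := cvg_prim_ip_pinfty lF lG.
apply/esym; apply: (cvg_unique _ _ h) => //.
apply: cvg_near_cst; exists T; split; first exact: num_real.
move=> x Tx; apply: prim_eventually0 => //; [exact: L2_loc_intM|exact: ltW|].
by move=> t Tt; rewrite G0// mulr0.
Qed.

Lemma prim_piece F k (kap x y : R) : loc_int F -> loc_int (fun t => F t * k t) ->
  0 <= x -> x <= y -> (forall t, x < t -> t <= y -> k t = kap) ->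
  prim (fun t => F t * k t) y - prim (fun t => F t * k t) x =
  kap * (prim F y - prim F x).
Proof.
move=> lF lFk x0 xy hk; rewrite !primB// -RintegralZl; last 2 first.
- exact: mitv.
- exact: integrable_itv.
apply: eq_Rintegral => t; rewrite inE/= in_itv/= => /andP[xt ty].
by rewrite hk// mulrC.
Qed.

Lemma prim_lower F (m x y : R) : loc_int F -> 0 <= x -> x <= y ->
  (forall t, x < t -> t <= y -> m <= F t) -> m * (y - x) <= prim F y - prim F x.
Proof.
move=> lF x0 xy hm; have y0 : 0 <= y by exact: le_trans xy.
have lc : loc_int (fun=> m).
  apply: loc_int_bounded; first exact: measurable_cst.
  by move=> b; exists `|m|.
have -> : m * (y - x) = prim (fun=> m) y - prim (fun=> m) x.
  by rewrite !prim_cst// mulrBr.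
rewrite !primB//; apply: le_Rintegral; [exact: mitv|exact: integrable_itv..|].
by move=> t; rewrite /= in_itv/= => /andP[]; exact: hm.
Qed.

Lemma prim_upper F (m x y : R) : loc_int F -> 0 <= x -> x <= y ->
  (forall t, x < t -> t <= y -> F t <= m) -> prim F y - prim F x <= m * (y - x).
Proof.
move=> lF x0 xy hm.
have := @prim_lower (fun t => -1 * F t) (- m) x y (loc_intZ (-1) lF) x0 xy.
rewrite !primZ// => h; have {}h := h _; suff : - m * (y - x) <=
  -1 * prim F y - -1 * prim F x by lra.
by apply: h => t xt ty; rewrite mulN1r lerN2 hm.
Qed.

Variable phi : R -> R.
Hypothesis mphi : measurable_fun D phi.

(* Since cos * k = p', integration by parts turns <g, k> into 2 int sin k p, and
   adding a multiple of p p' changes nothing. *)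
Lemma form_bound_compact (C tau T : R) k :
  (forall F G, rel phi F G -> ip D F G <= C * nsq G) ->
  measurable_fun D k -> locally_bounded k -> 0 <= T ->
  (forall t, T < t -> k t = 0) -> prim (fun t => cos (phi t) * k t) T = 0 ->
  2 * prim (fun t => (sin (phi t) - tau * cos (phi t)) *
             prim (fun t => cos (phi t) * k t) t * k t) T <=
  C * prim (fun t => k t * k t) T.
Proof.
move=> hC mk bk T0 k0 pT.
have lk := L2_compact_support mk bk k0; have lik := L2_loc_int lk.
have lc := loc_int_cosM mphi lik; have ls := loc_int_sinM mphi lik.
set p := prim (fun t => cos (phi t) * k t).
set s := prim (fun t => sin (phi t) * k t).
have mp : measurable_fun D p by exact: measurable_prim.
have ms : measurable_fun D s by exact: measurable_prim.
have bp : locally_bounded p by exact: prim_locally_bounded.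
have bs : locally_bounded s by exact: prim_locally_bounded.
have comm (f g : R -> R) : loc_int (fun x => f x * g x) -> loc_int (fun x => g x * f x).
  by congr loc_int; apply/funext => t; rewrite mulrC.
(* The coefficient [s T] is the one for which [g] vanishes beyond [T]; the other component vanishes
   there because [p T = 0]. *)
pose g x := s T * cos (phi x) + volterra phi k x.
have gE x : g x = cos (phi x) * (s T - s x) + sin (phi x) * p x.
  by rewrite /g /volterra -/p -/s; ring.
have mg : measurable_fun D g.
  apply: measurable_funD; last exact: measurable_volterra.
  by apply: measurable_funM => //; exact: measurable_cos_fun.
have bg : locally_bounded g.
  move=> b; have [M1 h1] := bp b; have [M2 h2] := bs b.
  exists (`|s T| + M2 + M1) => x x0 xb; rewrite gE.
  apply: (le_trans (ler_normD _ _)); rewrite !normrM; apply: lerD.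
    rewrite -[leRHS]mul1r; apply: ler_pM => //; first exact: ler_norm_cos.
    by apply: (le_trans (ler_normB _ _)); rewrite lerD2l h2.
  by rewrite -[leRHS]mul1r; apply: ler_pM => //; [exact: ler_norm_sin|exact: h1].
have g0 x : T < x -> g x = 0.
  move=> Tx; rewrite gE.
  have -> : p x = 0.
    rewrite /p (@prim_eventually0 _ T)//; first exact: ltW.
    by move=> t Tt; rewrite k0// mulr0.
  have -> : s x = s T.
    rewrite /s (@prim_eventually0 _ T)//; first exact: ltW.
    by move=> t Tt; rewrite k0// mulr0.
  by rewrite subrr !mulr0 addr0.
have lg := L2_compact_support mg bg g0.
have hrel : rel phi g k by split => //; exists (s T); apply: aeW.
have := hC _ _ hrel.
rewrite (ip_compact_support lg lk T0 k0) (ip_compact_support lk lk T0 k0).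
move=> h; apply: le_trans h; rewrite le_eqVlt; apply/orP; left; apply/eqP.
have l1 : loc_int (fun t => cos (phi t) * k t * s t).
  by apply: comm; exact: loc_int_mul_bounded.
have l2 : loc_int (fun t => p t * (sin (phi t) * k t)) by exact: loc_int_mul_bounded.
have l3 : loc_int (fun t => p t * (cos (phi t) * k t)) by exact: loc_int_mul_bounded.
have e1 : p T * s T = _ := prim_parts lc ls T0.
have e2 : p T * p T = _ := prim_parts lc lc T0.
rewrite /p pT !mul0r -/p -/s in e1 e2.
have -> : prim (fun x => g x * k x) T = s T * prim (fun t => cos (phi t) * k t) T
    - prim (fun t => cos (phi t) * k t * s t) T + prim (fun t => p t * (sin (phi t) * k t)) T.
  rewrite -primZ// -primN//; last exact: loc_intZ.
  rewrite -primD//; last by apply: loc_intB => //; exact: loc_intZ.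
  by apply: eq_prim => t _; rewrite gE; ring.
have -> : prim (fun t => (sin (phi t) - tau * cos (phi t)) * p t * k t) T =
    prim (fun t => p t * (sin (phi t) * k t)) T - tau * prim (fun t => p t * (cos (phi t) * k t)) T.
  rewrite -primZ// -primN//; last exact: loc_intZ.
  by apply: eq_prim => t _; ring.
have e3 : prim (fun t => cos (phi t) * k t * p t) T = prim (fun t => p t * (cos (phi t) * k t)) T.
  by apply: eq_prim => t _; rewrite mulrC.
rewrite e3 in e2; rewrite pT.
have -> : prim (fun t => p t * (cos (phi t) * k t)) T = 0.
  by move: e2; move: (prim _ _) => z; clear => e2; lra.
by move: e1; move: (prim _ _) (prim _ _) => z1 z2; clear => e1; lra.
Qed.

(** The test function is [al] on ]a, b], [- be] on ]b', c] and zero elsewhere; the balance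
    hypothesis says that its product with cos phi has integral zero. The indefinite integral [p] of
    this product is then explicit on both bumps, computed from the left end on the first and from
    the right end on the second. *)
Lemma two_bump (C tau a b b' c al be : R) :
  (forall F G, rel phi F G -> ip D F G <= C * nsq G) ->
  0 <= a -> a <= b -> b <= b' -> b' <= c ->
  let P := prim (fun t => cos (phi t)) in
  al * (P b - P a) = be * (P c - P b') ->
  exists p : R -> R, let Psi := prim (fun t => (sin (phi t) - tau * cos (phi t)) * p t) in
  [/\ loc_int (fun t => (sin (phi t) - tau * cos (phi t)) * p t),
      forall x, a <= x -> x <= b -> p x = al * (P x - P a),
      forall x, b' <= x -> x <= c -> p x = be * (P c - P x) &
      2 * (al * (Psi b - Psi a) - be * (Psi c - Psi b')) <=
      C * (al ^+ 2 * (b - a) + be ^+ 2 * (c - b'))].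
Proof.
move=> hC a0 ab bb b'c P hbal.
have b0 : 0 <= b by lra.
have b'0 : 0 <= b' by lra.
have c0 : 0 <= c by lra.
pose k t : R := if (a < t) && (t <= b) then al else
                if (b' < t) && (t <= c) then - be else 0.
have k1 t : a < t -> t <= b -> k t = al by move=> at_ tb; rewrite /k at_ tb.
have k2 t : b' < t -> t <= c -> k t = - be.
  move=> bt tc; rewrite /k bt tc ifN// negb_and -!leNgt orbC -ltNge.
  by rewrite (le_lt_trans bb bt).
have k3 t : c < t -> k t = 0.
  move=> ct; rewrite /k !ifN//.
    by rewrite negb_and -!ltNge ct orbT.
  by rewrite negb_and -!ltNge (le_lt_trans _ ct) ?orbT//; lra.
have k4 t : t <= a -> k t = 0.
  move=> ta; rewrite /k !ifN//.
    by rewrite negb_and -!leNgt (le_trans ta)//; lra.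
  by rewrite negb_and -!leNgt ta.
have k5 t : b < t -> t <= b' -> k t = 0.
  move=> bt tb; rewrite /k !ifN//.
    by rewrite negb_and -!leNgt tb.
  by rewrite negb_and -!ltNge bt orbT.
have mk : measurable_fun D k.
  have -> : k = (fun t => al * \1_(`]a, b]) t - be * \1_(`]b', c]) t).
    apply/funext => t; rewrite !indicE.
    have [ta|at_] := leP t a.
      by rewrite k4// !memNset ?mulr0 ?subrr//= in_itv/= => /andP[h _]; lra.
    have [tb|bt] := leP t b.
      rewrite k1// mem_set ?memNset ?mulr1 ?mulr0 ?subr0//= in_itv/=.
        by move=> /andP[h _]; lra.
      by rewrite at_.
    have [tb'|b't] := leP t b'.
      by rewrite k5// !memNset ?mulr0 ?subrr//= in_itv/= => /andP[h1 h2]; lra.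
    have [tc|ct] := leP t c.
      rewrite k2// memNset ?mem_set ?mulr1 ?mulr0 ?sub0r//= in_itv/=.
        by rewrite b't.
      by move=> /andP[_ h]; lra.
    by rewrite k3// !memNset ?mulr0 ?subrr//= in_itv/= => /andP[h1 h2]; lra.
  by apply: measurable_funB; apply: measurable_funM.
have bk : locally_bounded k.
  move=> z; exists (`|al| + `|be|) => x _ _; rewrite /k.
  case: ifP => _; first by rewrite lerDl.
  case: ifP => _; first by rewrite normrN lerDr.
  by rewrite normr0 addr_ge0.
have lik := loc_int_bounded mk bk.
have mc := measurable_cos_fun mphi; have ms := measurable_sin_fun mphi.
have lcos : loc_int (fun t => cos (phi t)).
  by apply: loc_int_bounded => // z; exists 1 => x _ _; exact: ler_norm_cos.
have lc := loc_int_cosM mphi lik.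
set p := prim (fun t => cos (phi t) * k t).
have mp : measurable_fun D p by exact: measurable_prim.
have bp : locally_bounded p by exact: prim_locally_bounded.
pose psi t := sin (phi t) - tau * cos (phi t).
have mpsi : measurable_fun D psi by apply: measurable_funB => //; exact: measurable_funM.
have bpsi : locally_bounded psi.
  move=> z; exists (1 + `|tau|) => x _ _; apply: (le_trans (ler_normB _ _)).
  rewrite lerD ?ler_norm_sin// normrM -[leRHS]mulr1.
  by apply: ler_wpM2l => //; exact: ler_norm_cos.
have lpsip : loc_int (fun t => psi t * p t).
  by apply: loc_int_mul_bounded => //; exact: loc_int_bounded.
have lpsipk : loc_int (fun t => psi t * p t * k t).
  have := loc_int_mul_bounded mk bk lpsip.
  by congr loc_int; apply/funext => t; rewrite mulrC.
have piece F : loc_int F -> loc_int (fun t => F t * k t) ->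
    prim (fun t => F t * k t) c = al * (prim F b - prim F a) - be * (prim F c - prim F b').
  move=> lF lFk.
  have q1 := prim_piece lF lFk a0 ab k1.
  have q2 := prim_piece lF lFk b'0 b'c k2.
  have q3 := @prim_piece F k 0 b b' lF lFk b0 bb k5.
  have q4 : prim (fun t => F t * k t) a - prim (fun t => F t * k t) 0 = 0 * (prim F a - prim F 0).
    by apply: prim_piece => // t _ ta; exact: k4.
  move: q1 q2 q3 q4; rewrite (prim0 (fun t => F t * k t)); lra.
have pa x : a <= x -> x <= b -> p x = al * (P x - P a).
  move=> ax xb.
  have q1 : p x - p a = al * (P x - P a).
    by apply: prim_piece => // t at_ tx; apply: k1 => //; exact: le_trans xb.
  have q4 : p a - p 0 = 0 * (P a - P 0).
    by apply: prim_piece => // t _ ta; exact: k4.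
  by move: q1 q4; rewrite /p prim0 -/p => q1 q4; lra.
have pc : p c = 0 by rewrite /p piece// -/P hbal subrr.
exists p; split => //.
  move=> x bx xc.
  have q1 : p c - p x = - be * (P c - P x).
    apply: prim_piece => // [|t xt tc]; first exact: le_trans bx.
    by apply: k2 => //; exact: le_lt_trans xt.
  move: q1; rewrite pc; lra.
have := @form_bound_compact C tau c k hC mk bk c0 k3 pc.
rewrite -/p piece//.
have -> : prim (fun t => k t * k t) c = al ^+ 2 * (b - a) + be ^+ 2 * (c - b').
  rewrite piece//; last first.
    exact: loc_int_mul_bounded.
  have one : loc_int (fun=> 1 : R).
    by apply: loc_int_bounded; [exact: measurable_cst|move=> z; exists 1 => x _ _; rewrite normr1].
  have kE : (fun t => 1 * k t) = k by apply/funext => t; rewrite mul1r.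
  have lk1 : loc_int (fun t => 1 * k t) by rewrite kE.
  have q1 := prim_piece one lk1 a0 ab k1.
  have q2 := prim_piece one lk1 b'0 b'c k2.
  rewrite kE !prim_cst// in q1 q2.
  rewrite q1 q2; ring.
by [].
Qed.

End test_functions.

(** * Elementary trigonometric bounds *)

Section trigonometric_bounds.
Context {R : realType}.

Let sin_MVT (t : R) : 0 <= t ->
  exists2 c, c \in `[0, t] & sin t - sin 0 = cos c * (t - 0).
Proof.
move=> t0; apply: MVT_segment => //.
by apply: continuous_subspaceT => x; exact: continuous_sin.
Qed.

Lemma sin_le_id (t : R) : 0 <= t -> sin t <= t.
Proof.
move=> t0; have [c _] := sin_MVT t0.
by rewrite sin0 !subr0 => ->; rewrite ler_piMl// cos_le1.
Qed.

(** By continuity the cosine is at least 1/2 near 0, and the mean value theorem then gives t/2 <=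
    sin t. The cap pi/2 keeps the angles where the sine increases. *)
Lemma small_angle : exists2 d : R, 0 < d <= pi / 2 &
  forall t, 0 <= t -> t < d -> 2^-1 <= cos t /\ t <= 2 * sin t.
Proof.
have e0 : 0 < 2^-1 :> R by rewrite invr_gt0.
have /cvgrPdist_lt /(_ _ e0) [d d0 hd] := @continuous_cos R 0.
have pi20 : 0 < pi / 2 :> R by rewrite divr_gt0// pi_gt0.
have hc t : 0 <= t -> t < d -> 2^-1 <= cos t.
  move=> t0 td; have := hd t; rewrite /ball_/= sub0r normrN ger0_norm// cos0.
  by move=> /(_ td); rewrite ltr_norml => /andP[_]; lra.
exists (Num.min d (pi / 2)).
  by rewrite lt_min d0 pi20 ge_min lexx orbT.
move=> t t0; rewrite lt_min => /andP[td _]; split; first exact: hc.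
have [c] := sin_MVT t0.
rewrite in_itv/= => /andP[c0 ct]; rewrite sin0 !subr0 => ->.
have := hc c c0 (le_lt_trans ct td); nra.
Qed.

Lemma le_sin_pihalf (s t : R) : 0 <= s -> s <= t -> t <= pi / 2 -> sin s <= sin t.
Proof.
move=> s0 st tp; have pi0 := @pi_ge0 R.
rewrite le_eqVlt in st; case/predU1P: st => [->//|st].
by rewrite ltW// ltr_sin// in_itv/=; apply/andP; split; lra.
Qed.

End trigonometric_bounds.

(** * Necessity of the decay when the limit angle is -pi/2 *)

Section necessity.
Context {R : realType}.
Local Notation mu := (@lebesgue_measure R).
Local Notation D := (@half_line R).
Local Notation nsq F := (ip D F F).

(** The limit at 0 enters only through the pointwise bound by pi/2 that it implies. *)
Definition decreasing_to (phi : R -> R) (A : R) :=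
  [/\ forall x y : R, 0 < x -> x <= y -> phi y <= phi x,
      phi x @[x --> +oo] --> A,
      forall x : R, 0 < x -> phi x <= pi / 2 &
      - (pi / 2) <= A].

Lemma limit_le phi A x : decreasing_to phi A -> 0 < x -> A <= phi x.
Proof.
move=> [decr lim_phi _ _] x0; rewrite leNgt; apply/negP => h.
have e0 : 0 < A - phi x by rewrite subr_gt0.
have /cvgrPdist_lt /(_ _ e0) [N [_ hN]] := lim_phi.
pose y := Num.max (N + 1) x.
have Ny : N < y by rewrite /y lt_max ltrDl ltr01.
have xy : x <= y by rewrite /y le_max lexx orbT.
have := hN y Ny; have := decr _ _ x0 xy => h1.
by rewrite gtr0_norm; lra.
Qed.

(** Continuing [phi] by pi/2 to the left of 0 keeps it monotone, now on the whole line. *)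
Lemma measurable_decreasing phi A : decreasing_to phi A -> measurable_fun D phi.
Proof.
move=> [decr _ phi_le _].
pose psi x := if 0 < x then phi x else pi / 2.
have mpsi : measurable_fun D psi.
  apply: nonincreasing_measurable; first exact: measurable_half_line.
  move=> x y xy; rewrite /psi; case: ifPn => y0; case: ifPn => x0 //.
  - exact: decr.
  - exact: phi_le.
  - by move: y0; rewrite (lt_le_trans x0 xy).
apply: eq_measurable_fun mpsi => x; rewrite inE half_lineE => x0.
by rewrite /psi x0.
Qed.

Lemma eventually_small phi A (e : R) : decreasing_to phi A -> 0 < e ->
  exists2 N : R, 0 < N & forall x, N <= x -> 0 <= phi x - A < e.
Proof.
move=> dphi e0; have [_ lim_phi _ _] := dphi; have /cvgrPdist_lt /(_ _ e0) [N [_ hN]] := lim_phi.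
exists (`|N| + 1); first by rewrite ltr_wpDl.
move=> x Nx; have x0 : 0 < x by apply: lt_le_trans Nx; rewrite ltr_wpDl.
have Nx' : N < x by apply: lt_le_trans Nx; rewrite (le_lt_trans (ler_norm N))// ltrDl.
rewrite subr_ge0 (limit_le dphi)//=; have := hN x Nx'; have := limit_le dphi x0 => h.
by rewrite distrC ger0_norm// subr_ge0.
Qed.

(* The shape of the argument for A = -pi/2: b x = x * sin (th x) satisfies
   b (2 x) <= b x / 2 + C, hence stays bounded. *)
Lemma doubling_bound (s : R -> R) (x1 K : R) : 0 < x1 -> 0 <= K ->
  (forall x, x1 <= x -> 0 <= s x <= 1) ->
  (forall x, x1 <= x -> 2 * x * s (2 * x) <= x * s x / 2 + K) ->
  forall x, x1 <= x -> x * s x <= 2 * x1 + 2 * K.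
Proof.
move=> x10 K0 s1 hs.
have key n : forall x, x1 <= x -> x <= 2 ^+ n * x1 -> x * s x <= 2 * x1 + 2 * K.
  elim: n => [|n IH] x xx1 xn.
    have [? ?] := andP (s1 _ xx1); rewrite expr0 in xn; nra.
  have [x2|x2] := leP x (2 * x1).
    have [? ?] := andP (s1 _ xx1); nra.
  have h1 : x1 <= x / 2 by lra.
  have h2 : x / 2 <= 2 ^+ n * x1 by move: xn; rewrite exprS; lra.
  have := IH _ h1 h2; have := hs _ h1.
  have -> : 2 * (x / 2) = x by field.
  by lra.
move=> x xx1; have x0 : 0 <= x by lra.
apply: (key (Num.trunc (x / x1)).+1) => //.
rewrite -ler_pdivrMr//.
have h1 : x / x1 <= (Num.trunc (x / x1)).+1%:R by rewrite ltW// truncnS_gt.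
apply: (le_trans h1); rewrite -natrX ler_nat ltnW// ltn_expl//.
Qed.

(** Here cos phi = sin theta and sin phi = - cos theta. A bump of modulus 1 on (x, 2x) is
    compensated by one of height [kap] on the fixed interval (a, a + 1). The gain is of order x^2
    sin (theta (2x)); the cost is of order kap^2 + x, where [kap] is at most a multiple of x sin
    (theta x). Dividing by x leaves a recursion from x to 2x. *)
Lemma theta_bound_Npihalf phi A : decreasing_to phi A -> A = - (pi / 2) ->
  form_bound phi -> exists C N : R, forall x, N < x -> x * (phi x - A) <= C.
Proof.
move=> dphi AE [C C0 hC]; have [decr _ _ _] := dphi.
have [d /andP[d0 dpi] hd] := @small_angle R.
have [a a0 ha] := eventually_small dphi d0.
(* Once theta vanishes it stays zero by monotonicity. Otherwise [sig] below is positive, so that cos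
   phi has positive mass on (a, a + 1). *)
have [[x0 [x00 ax0 th0]]|nz] := pselect (exists x0, [/\ 0 < x0, a <= x0 & phi x0 = A]).
  exists 0, x0 => x xx0; have xp : 0 < x by lra.
  have -> : phi x = A.
    by apply/eqP; rewrite eq_le (limit_le dphi)// andbT -th0 decr// ltW.
  by rewrite subrr mulr0.
have mphi := measurable_decreasing dphi.
pose th x := phi x - A.
have thE x : phi x = A + th x by rewrite /th; lra.
have cosE x : cos (phi x) = sin (th x).
  by rewrite thE AE cosD cosN sinN cos_pihalf sin_pihalf; ring.
have sinE x : sin (phi x) = - cos (th x).
  by rewrite thE AE sinD cosN sinN cos_pihalf sin_pihalf; ring.
have tha x : a <= x -> 0 <= th x < d by exact: ha.
have thd x y : a <= x -> x <= y -> th y <= th x.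
  by move=> ax xy; rewrite lerD2r decr//; lra.
have cos_ge x : a <= x -> 2^-1 <= cos (th x).
  by move=> /tha/andP[h1 h2]; have [] := hd _ h1 h2.
have sind x y : a <= x -> x <= y -> sin (th y) <= sin (th x).
  move=> ax xy; have /andP[h1 h2] := tha _ ax.
  have /andP[h3 h4] := tha _ (le_trans ax xy).
  by apply: le_sin_pihalf => //; [exact: thd|lra].
have sin0_ x : a <= x -> 0 <= sin (th x).
  by move=> ax; have /andP[h1 h2] := tha _ ax; have [_] := hd _ h1 h2; lra.
pose sig := sin (th (a + 1)).
have sig0 : 0 < sig.
  have h : a <= a + 1 by lra.
  have /andP[h1 h2] := tha _ h; have [_ h3] := hd _ h1 h2.
  rewrite lt_neqAle sin0_// andbT; apply: contra_notN nz => /eqP sig0.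
  exists (a + 1); split; [lra|lra|].
  by move: h1 h3; rewrite -/sig -sig0 mulr0 /th; lra.
have lcos : loc_int (fun t => cos (phi t)).
  apply: loc_int_bounded; first exact: measurable_cos_fun.
  by move=> z; exists 1 => x _ _; exact: ler_norm_cos.
pose P := prim (fun t => cos (phi t)).
have S0 : sig <= P (a + 1) - P a.
  have := @prim_lower R _ sig a (a + 1) lcos (ltW a0) _ _.
  have -> : sig * (a + 1 - a) = sig by ring.
  apply; first lra.
  by move=> t at_ ta; rewrite cosE; apply: sind => //; exact: ltW.
have S1 : P (a + 1) - P a <= 1.
  have := @prim_upper R _ 1 a (a + 1) lcos (ltW a0) _ _.
  have -> : 1 * (a + 1 - a) = 1 :> R by ring.
  by apply; [lra|move=> t _ _; exact: cos_le1].
have Spos : 0 < P (a + 1) - P a by apply: lt_le_trans S0.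
have main x : a + 1 <= x -> x ^+ 2 * sin (th (2 * x)) <=
    (4 * C + 8) * (sig ^- 2 * (x * sin (th x)) ^+ 2 + x).
  move=> ax; have x0 : 0 < x by move: a0 ax; clra.
  have a1 : a <= a + 1 by clra.
  have x2 : x <= 2 * x by move: x0; clra.
  have axx : a <= x by move: ax; clra.
  have x3 : x <= x + x / 2 by move: x0; clra.
  have x4 : x + x / 2 <= 2 * x by move: x0; clra.
  have x5 : 0 <= x + x / 2 by move: x0; clra.
  have xle0 : 0 <= x := ltW x0.
  have axt t : x <= t -> a <= t by exact: le_trans.
  pose Q := P (2 * x) - P x.
  pose kap := Q / (P (a + 1) - P a).
  have Q0 : 0 <= Q.
    have := @prim_lower R _ 0 x (2 * x) lcos (ltW x0) _ _.
    rewrite mul0r; apply => // t xt tx.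
    by rewrite cosE sin0_// axt// ltW.
  have Q1 : Q <= x * sin (th x).
    have := @prim_upper R _ (sin (th x)) x (2 * x) lcos (ltW x0) _ _.
    have -> : sin (th x) * (2 * x - x) = x * sin (th x) by ring.
    apply => // t xt tx.
    by rewrite cosE sind// ltW.
  have kap0 : 0 <= kap by rewrite divr_ge0// ltW.
  have kap1 : kap ^+ 2 <= sig ^- 2 * (x * sin (th x)) ^+ 2.
    rewrite /kap expr_div_n mulrC; apply: ler_pM; rewrite ?invr_ge0 ?sqr_ge0//.
      rewrite lef_pV2 ?posrE ?exprn_gt0//.
      by apply: lerXn2r; rewrite ?nnegrE; [exact: ltW|exact: ltW|].
    by rewrite lerXn2r ?nnegrE// (le_trans Q0).
  have bal : kap * (P (a + 1) - P a) = 1 * (P (2 * x) - P x).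
    by rewrite /kap divfK ?gt_eqF// mul1r.
  have [p] := @two_bump R phi mphi C 0 a (a + 1) x (2 * x) kap 1 hC (ltW a0) a1 ax x2 bal.
  set Psi := prim _; cbv zeta => -[lp p1 p2 hmain].
  (* The integrand is - cos theta times [p], and [p] lies between 0 and [kap] here, so the
     unfavourable sign costs at most [kap]. In the final inequality this is a multiple of
     [kap ^+ 2]. *)
  have B1 : - kap <= Psi (a + 1) - Psi a.
    have := @prim_lower R _ (- kap) a (a + 1) lp (ltW a0) a1 _.
    have -> : - kap * (a + 1 - a) = - kap by ring.
    apply => t at_ ta; rewrite mul0r subr0 sinE (p1 _ (ltW at_) ta) -/P.
    have c1 := cos_le1 (th t); have c2 : 2^-1 <= cos (th t) by apply: cos_ge; exact: ltW.
    have pt1 : P t - P a <= 1.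
      have := @prim_upper R _ 1 a t lcos (ltW a0) (ltW at_) _.
      rewrite mul1r => h; apply: (@le_trans _ _ (t - a)); last by move: ta; clra.
      by apply: h => u _ _; exact: cos_le1.
    have pt0 : 0 <= P t - P a.
      have := @prim_lower R _ 0 a t lcos (ltW a0) (ltW at_) _.
      rewrite mul0r; apply => u au ut.
      by rewrite cosE sin0_//; exact: ltW.
    have m1 : 0 <= cos (th t) * (P t - P a) <= 1.
      have c3 : 0 <= cos (th t) by apply: le_trans c2; rewrite invr_ge0.
      by apply/andP; split; [exact: mulr_ge0|exact: mulr_ile1].
    have /andP[_ m2] := m1; have := ler_wpM2l kap0 m2.
    by rewrite mulr1 mulNr lerN2 mulrCA.
  have ppos t : x <= t -> t <= 2 * x -> (2 * x - t) * sin (th (2 * x)) <= p t.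
    move=> xt tx; rewrite p2// mul1r -/P mulrC.
    have := @prim_lower R _ (sin (th (2 * x))) t (2 * x) lcos _ tx _.
    apply; first exact: le_trans xt.
    move=> u tu ux; rewrite cosE; apply: sind => //.
    by apply: axt; apply: le_trans xt (ltW tu).
  have s20 : 0 <= sin (th (2 * x)) by apply: sin0_; exact: axt.
  have cosx t : x < t -> 2^-1 <= cos (th t).
    by move=> xt; apply: cos_ge; apply: axt; exact: ltW.
  have B2 : Psi (2 * x) - Psi (x + x / 2) <= 0.
    have := @prim_upper R _ 0 (x + x / 2) (2 * x) lp _ _ _.
    rewrite mul0r; apply => // t xt tx.
    rewrite mul0r subr0 sinE mulNr oppr_le0.
    have xt' : x < t by exact: le_lt_trans xt.
    apply: mulr_ge0; first by apply: le_trans (cosx _ xt'); rewrite invr_ge0.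
    apply: le_trans (ppos t (ltW xt') tx).
    by apply: mulr_ge0 => //; rewrite subr_ge0.
  (* The main gain: on the first half of (x, 2x), [p] is at least x/2 times sin (theta (2x)), and
     cos theta is at least 1/2. *)
  have B3 : Psi (x + x / 2) - Psi x <= - (x / 4 * sin (th (2 * x))) * (x / 2).
    have := @prim_upper R _ (- (x / 4 * sin (th (2 * x)))) x (x + x / 2) lp _ _ _.
    have -> : x + x / 2 - x = x / 2 by ring.
    apply => // t xt tx; rewrite mul0r subr0 sinE mulNr lerN2.
    have pt : (x / 2) * sin (th (2 * x)) <= p t.
      apply: le_trans (ppos t (ltW xt) (le_trans tx x4)).
      by apply: ler_wpM2r => //; move: tx; clra.
    have -> : x / 4 * sin (th (2 * x)) = 2^-1 * ((x / 2) * sin (th (2 * x))) by field.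
    apply: ler_pM; [by rewrite invr_ge0|by rewrite mulr_ge0// divr_ge0|exact: cosx|exact: pt].
  move: hmain B1 B2 B3 kap1 kap0; rewrite expr1n mul1r !mul1r.
  have -> : a + 1 - a = 1 by ring.
  have -> : 2 * x - x = x by ring.
  move: (Psi _) (Psi _) (Psi _) (Psi _) (Psi _) (kap) (sig ^- 2 * _) (sin _) => u1 u2 u3 u4 u5 k W S.
  move: C0 x0; move: (C); clear => CC h1 h2 h3 h4 h5 h6 h7 h8.
  have := ler_wpM2l h8 h4; have := ler_wpM2l h1 h7; nra.
pose C1 := (4 * C + 8) * (sig ^- 2 + 1).
have sg0 : 0 <= sig ^- 2 by rewrite invr_ge0 sqr_ge0.
have C80 : 0 < 4 * C + 8 by move: C0; clra.
have C10 : 0 < C1 by rewrite mulr_gt0// ltr_wpDl.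
(* Where sin theta is below this value, the term C1 x sin^2 theta is at most a quarter of x sin
   theta; after doubling this is the factor 1/2 required by [doubling_bound]. *)
have e0 : 0 < (4 * C1)^-1 by rewrite invr_gt0 mulr_gt0.
have [N N0 hN] := eventually_small dphi e0.
pose x1 := N + a + 1.
have x10 : 0 < x1 by rewrite /x1 !addr_gt0.
have x1a x : x1 <= x -> [/\ N <= x, a <= x, a + 1 <= x & 0 < x].
  by rewrite /x1; move: N0 a0; clear => N0 a0 h; split; lra.
have bnd : forall x, x1 <= x -> x * sin (th x) <= 2 * x1 + 2 * (2 * C1).
  apply: (@doubling_bound (fun x => sin (th x)) x1 (2 * C1)) => //.
  - by rewrite mulr_ge0// ltW.
  - by move=> x /x1a[_ ax _ _]; rewrite sin_le1 andbT sin0_.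
  - move=> x /x1a[Nx ax ax1 x0].
    have := main x ax1; have s0 := sin0_ x ax.
    have st : sin (th x) * (4 * C1) <= 1.
      have /andP[h1 h2] := hN x Nx.
      have k0 : 0 < 4 * C1 by rewrite mulr_gt0.
      have h3 : sin (th x) <= (4 * C1)^-1 by apply: le_trans (ltW h2); exact: sin_le_id.
      by apply: (le_trans (ler_wpM2r (ltW k0) h3)); rewrite mulVf// gt_eqF.
    move=> h; suff h' : x * sin (th (2 * x)) <= C1 * (x * sin (th x) ^+ 2 + 1).
      have := ler_wpM2l (mulr_ge0 (ltW x0) s0) st.
      move: h'; move: (sin (th (2 * x))) (sin (th x)) => u v; clear => h1 h2; nra.
    rewrite -(ler_pM2l x0); apply: (@le_trans _ _ (x ^+ 2 * sin (th (2 * x)))).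
      by rewrite expr2 mulrA.
    apply: (le_trans h).
    have -> : x * (C1 * (x * sin (th x) ^+ 2 + 1)) = C1 * ((x * sin (th x)) ^+ 2 + x) by ring.
    rewrite /C1 -[leRHS]mulrA; apply: ler_wpM2l; first exact: ltW.
    have := sqr_ge0 (x * sin (th x)); move: ((x * sin (th x)) ^+ 2) x0 sg0.
    move: (sig ^- 2); clear => u v h1 h2 h3; nra.
exists (2 * (2 * x1 + 2 * (2 * C1))), x1 => x xx.
have := bnd x (ltW xx); have [_ ax _ x0] := x1a _ (ltW xx).
have /andP[h1 h2] := tha _ ax; have [_ h3] := hd _ h1 h2.
have := ler_wpM2l (ltW x0) h3; rewrite /th; clra.
Qed.

End necessity.

(** * Necessity of the decay when the limit angle is strictly between -pi/2 and pi/2 *)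

Section necessity_interior.
Context {R : realType}.
Local Notation mu := (@lebesgue_measure R).
Local Notation D := (@half_line R).
Local Notation nsq F := (ip D F F).

Lemma prim_le_diff (F G : R -> R) (x y : R) : loc_int F -> loc_int G ->
  0 <= x -> x <= y -> (forall t, x < t -> t <= y -> F t <= G t) ->
  prim F y - prim F x <= prim G y - prim G x.
Proof.
move=> lF lG x0 xy FG; rewrite !primB//; apply: le_Rintegral.
- exact: mitv.
- exact: integrable_itv.
- exact: integrable_itv.
- by move=> t; rewrite /= in_itv/= => /andP[]; exact: FG.
Qed.

(** A bump of height 1 on (a, N), with [N] the point at which theta is estimated, is compensated by
    one of height [- kap] on (N, L). Since cos phi is at least [gam], [kap] is at most of order N/(L
    - N). For large [L] the far bump contributes a bounded amount, and a gain of order N^2 sin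
    (theta N) is bounded by a multiple of N. *)
Lemma theta_bound_interior (phi : R -> R) (A : R) : decreasing_to phi A ->
  - (pi / 2) < A < pi / 2 -> form_bound phi ->
  exists C N : R, forall x, N < x -> x * (phi x - A) <= C.
Proof.
move=> dphi Aint [C C0 hC]; have [decr _ _ _] := dphi.
have mphi := measurable_decreasing dphi.
have cA : 0 < cos A by exact: cos_gt0_pihalf.
pose gam := cos A / 2.
have gam0 : 0 < gam by rewrite divr_gt0.
have [d1 d10 hd1] : exists2 d1 : R, 0 < d1 & forall t, `|A - t| < d1 -> gam <= cos t.
  have /cvgrPdist_lt /(_ _ gam0) [d1 d10 h] := @continuous_cos R A.
  exists d1 => // t td; have := h t td; rewrite ltr_norml => /andP[_].
  rewrite /gam; clra.
have [d /andP[d0 dpi] hd] := @small_angle R.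
have dd0 : 0 < Num.min d d1 by rewrite lt_min d0.
have [a a0 ha] := eventually_small dphi dd0.
pose th x := phi x - A.
have thE x : phi x = A + th x by rewrite /th addrC subrK.
have tha x : a <= x -> [/\ 0 <= th x, th x < d & th x < d1].
  by move=> /ha/andP[h]; rewrite lt_min => /andP[h1 h2].
have thd x y : a <= x -> x <= y -> th y <= th x.
  by move=> ax xy; rewrite lerD2r decr//; exact: lt_le_trans ax.
have cos_ge x : a <= x -> gam <= cos (phi x).
  move=> /tha[h0 _ h1]; apply: hd1.
  by rewrite thE opprD addrA subrr sub0r normrN ger0_norm.
have sind x y : a <= x -> x <= y -> sin (th y) <= sin (th x).
  move=> ax xy; have [h1 h2 _] := tha _ ax.
  have [h3 h4 _] := tha _ (le_trans ax xy).
  by apply: le_sin_pihalf => //; [exact: thd|exact: le_trans (ltW h2) dpi].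
have sin0_ x : a <= x -> 0 <= sin (th x).
  by move=> ax; have [h1 h2 _] := tha _ ax; have [_] := hd _ h1 h2; move: h1; clra.
(* This choice turns sin phi - tau cos phi into sin theta / cos A, so that only the small angle
   enters. *)
pose tau := sin A / cos A.
have psiE x : sin (phi x) - tau * cos (phi x) = sin (th x) / cos A.
  rewrite (thE x) sinD cosD /tau; have := cos2Dsin2 A => h.
  apply: (mulIf (lt0r_neq0 cA)); rewrite divfK ?lt0r_neq0// -[RHS]mul1r -h.
  by field; rewrite lt0r_neq0.
have lcos : loc_int (fun t => cos (phi t)).
  apply: loc_int_bounded; first exact: measurable_cos_fun.
  by move=> z; exists 1 => x _ _; exact: ler_norm_cos.
have mth : measurable_fun D th by apply: measurable_funB.
have lsin : loc_int (fun t => sin (th t)).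
  apply: loc_int_bounded; first exact: measurable_sin_fun.
  by move=> z; exists 1 => x _ _; exact: ler_norm_sin.
pose P := prim (fun t => cos (phi t)).
pose Sg := prim (fun t => sin (th t)).
pose K := 2 + C + C * gam ^- 2.
have ig0 : 0 <= gam ^- 2 by rewrite invr_ge0 sqr_ge0.
exists (32 * K), (2 * a + 1) => N aN.
have [N1 aN2 N0 aN1] : [/\ 1 <= N, 2 * a <= N, 0 < N & a <= N].
  by move: a0 aN; clear => h1 h2; split; lra.
have al0 : 0 <= a by exact: ltW.
have aleN t : N <= t -> a <= t by exact: le_trans.
(* The mean of sin theta over (N, L) will be at most [e]. The value is such that the bound for [kap]
   and the bound N for kap (P L - P t) combine to exactly 1 in [B3]. *)
pose e := cos A * gam / N ^+ 2.
have e0 : 0 < e by rewrite divr_gt0 ?mulr_gt0 ?exprn_gt0.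
have e20 : 0 < e / 2 by rewrite divr_gt0.
have [M M0 hM] := eventually_small dphi e20.
pose M1 := Num.max M N.
have NM1 : N <= M1 by rewrite /M1 le_max lexx orbT.
have MM1 : M <= M1 by rewrite /M1 le_max lexx.
(* Beyond [M1] the sine is at most e/2. The second term makes (M1, L) long enough to outweigh (N,
   M1), where only sin <= 1 is used; the third gives L - N >= N^2, which [B4] needs. *)
pose L := M1 + (2 * (M1 - N) / e + N ^+ 2).
have N20 : 0 < N ^+ 2 by rewrite exprn_gt0.
have q0 : 0 <= 2 * (M1 - N) / e by rewrite !mulr_ge0 ?subr_ge0// invr_ge0 ltW.
have M1L : M1 <= L by rewrite lerDl addr_ge0// ltW.
have NL : N <= L by exact: le_trans M1L.
have X2 : N ^+ 2 <= L - N.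
  by rewrite /L; move: q0 NM1; clra.
have X0 : 0 < L - N by exact: lt_le_trans X2.
have M1pos : 0 <= M1 by exact: le_trans (ltW N0) NM1.
have SgL : Sg L - Sg N <= e * (L - N).
  have s1 : Sg M1 - Sg N <= 1 * (M1 - N).
    by apply: (prim_upper lsin (ltW N0) NM1) => t _ _; exact: sin_le1.
  have s2 : Sg L - Sg M1 <= e / 2 * (L - M1).
    apply: (prim_upper lsin M1pos M1L) => t Mt tL.
    have /andP[h1 h2] := hM t (le_trans MM1 (ltW Mt)).
    by apply: le_trans (ltW h2); exact: sin_le_id.
  have s3 : M1 - N <= e / 2 * (L - M1).
    have -> : L - M1 = 2 * (M1 - N) / e + N ^+ 2 by rewrite /L; clra.
    rewrite mulrDr; have -> : e / 2 * (2 * (M1 - N) / e) = M1 - N.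
      by field; rewrite lt0r_neq0.
    by rewrite lerDl mulr_ge0// ltW.
  have s4 : e * (L - M1) <= e * (L - N) by rewrite ler_pM2l// lerB.
  move: s1 s2 s3 s4; clra.
have PX : gam * (L - N) <= P L - P N.
  apply: (prim_lower lcos (ltW N0) NL).
  by move=> t Nt _; apply: cos_ge; apply: aleN; exact: ltW.
have PX0 : 0 < P L - P N by apply: lt_le_trans PX; rewrite mulr_gt0.
have PN : P N - P a <= N.
  have := @prim_upper R _ 1 a N lcos al0 aN1 _.
  move=> h; apply: le_trans (h _) _; first by move=> t _ _; exact: cos_le1.
  by move: al0; clra.
have Pincr x y : a <= x -> x <= y -> 0 <= P y - P x.
  move=> ax xy; have := @prim_lower R _ 0 x y lcos (le_trans al0 ax) xy _.
  rewrite mul0r; apply => t xt _.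
  exact: le_trans (ltW gam0) (cos_ge _ (le_trans ax (ltW xt))).
pose kap := (P N - P a) / (P L - P N).
have kapE : kap * (P L - P N) = P N - P a by rewrite divfK// lt0r_neq0.
have kap0 : 0 <= kap by rewrite divr_ge0 ?Pincr.
have kapX : kap * (gam * (L - N)) <= N.
  by apply: le_trans PN; rewrite -kapE; exact: ler_wpM2l.
have bal : 1 * (P N - P a) = kap * (P L - P N) by rewrite mul1r kapE.
have [p] := @two_bump R phi mphi C tau a N N L 1 kap hC al0 aN1 (lexx N) NL bal.
set Psi := prim _; cbv zeta => -[lp p1 p2 hmain].
have sN0 : 0 <= sin (th N) by exact: sin0_.
(* Only the right half of (a, N) is used quantitatively, since there [p] is at least gam (N - a)/2;
   on the left half the integrand is nonnegative. *)
pose m := (a + N) / 2.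
have [am mN m0 Nm] : [/\ a <= m, m <= N, 0 <= m & N - m = (N - a) / 2].
  by rewrite /m; move: al0 aN1; clear => h1 h2; split; lra.
have B0 : 0 <= Psi m - Psi a.
  have := @prim_lower R _ 0 a m lp al0 am _; rewrite mul0r; apply => t at_ tm.
  rewrite psiE p1 ?(ltW at_)// ?(le_trans tm)// mul1r.
  apply: mulr_ge0; last by apply: Pincr => //; exact: ltW.
  by rewrite divr_ge0 ?(ltW cA)// sin0_// ltW.
have B1 : sin (th N) / cos A * (gam * ((N - a) / 2)) * ((N - a) / 2) <= Psi N - Psi m.
  have := @prim_lower R _ (sin (th N) / cos A * (gam * ((N - a) / 2))) m N lp m0 mN _.
  rewrite Nm; apply => t mt tN; have at_ : a <= t by exact: le_trans am (ltW mt).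
  rewrite psiE p1// mul1r; apply: ler_pM.
  - by rewrite divr_ge0// ltW.
  - by rewrite mulr_ge0 ?(ltW gam0)// divr_ge0// subr_ge0.
  - by rewrite ler_pM2r ?invr_gt0//; exact: sind.
  - have := @prim_lower R _ gam a t lcos al0 at_ _ => h.
    apply: le_trans (h _); last by move=> u au ut; apply: cos_ge; exact: ltW.
    by rewrite ler_pM2l//; move: mt; rewrite /m; clra.
have B2 : Psi L - Psi N <= N / cos A * (Sg L - Sg N).
  have -> : N / cos A * (Sg L - Sg N) = prim (fun t => N / cos A * sin (th t)) L -
     prim (fun t => N / cos A * sin (th t)) N by rewrite !primZ// -mulrBr.
  apply: (prim_le_diff lp (loc_intZ _ lsin) (ltW N0) NL) => t Nt tL.
  have at_ : a <= t by exact: le_trans (ltW Nt).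
  rewrite psiE (p2 _ (ltW Nt) tL) -/P.
  rewrite [leLHS](_ : _ = sin (th t) * (kap * (P L - P t)) / cos A); last by ring.
  rewrite [leRHS](_ : _ = sin (th t) * N / cos A); last by ring.
  rewrite ler_pM2r ?invr_gt0//; apply: ler_wpM2l; first exact: sin0_.
  apply: le_trans PN; rewrite -kapE; apply: ler_wpM2l => //.
  by rewrite lerD2l lerN2 -subr_ge0; apply: Pincr => //; exact: ltW.
have B3 : kap * (Psi L - Psi N) <= 1.
  apply: (@le_trans _ _ (kap * (N / cos A * (e * (L - N))))).
    apply: ler_wpM2l => //; apply: (le_trans B2); apply: ler_wpM2l => //.
    by rewrite divr_ge0// ltW.
  have -> : kap * (N / cos A * (e * (L - N))) = kap * (gam * (L - N)) / N.
    by rewrite /e; field; rewrite !lt0r_neq0.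
  by rewrite ler_pdivrMr// mul1r.
have B4 : kap ^+ 2 * (L - N) <= gam ^- 2.
  rewrite -[leRHS]mul1r ler_pdivlMr ?exprn_gt0// -(ler_pM2r X0) mul1r.
  apply: le_trans X2.
  have -> : kap ^+ 2 * (L - N) * gam ^+ 2 * (L - N) = (kap * (gam * (L - N))) ^+ 2 by ring.
  apply: lerXn2r; rewrite ?nnegrE; [|exact: ltW|exact: kapX].
  by apply: mulr_ge0 => //; apply: mulr_ge0; exact: ltW.
have B5 : sin (th N) * (N - a) ^+ 2 / 8 <= Psi N - Psi a.
  have -> : sin (th N) * (N - a) ^+ 2 / 8 =
     sin (th N) / cos A * (gam * ((N - a) / 2)) * ((N - a) / 2).
    by rewrite /gam; field; rewrite lt0r_neq0.
  by move: B0 B1; clra.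
have B6 : sin (th N) * N ^+ 2 / 4 <= sin (th N) * (N - a) ^+ 2.
  rewrite -mulrA; apply: ler_wpM2l => //.
  by move: aN2 N0; clear => h1 h2; nra.
have B7 : N * sin (th N) <= 16 * K.
  rewrite -(ler_pM2r N0).
  have := ler_wpM2l C0 B4; move: hmain B3 B5 B6 N1.
  rewrite expr1n !mul1r mulrDr; move: (ler_wpM2l C0 al0) (mulr_ge0 C0 ig0).
  rewrite /K; move: (kap ^+ 2 * _) (kap * _) (Psi N - Psi a) (gam ^- 2) (sin _) => u v w g s.
  move: C0; clear => C0 h1 h2 h3 h4 h5 h6 h7 h8.
  have := ler_wpM2l h2 h7; nra.
have [h1 h2 _] := tha _ aN1; have [_ h3] := hd _ h1 h2.
have := ler_wpM2l (ltW N0) h3; rewrite /th in B7 *; move: B7; clra.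
Qed.

End necessity_interior.

(** * Hardy's inequality and its dual *)

Section hardy.
Context {R : realType}.
Local Notation mu := (@lebesgue_measure R).
Local Notation D := (@half_line R).
Local Notation nsq F := (ip D F F).
Implicit Types F G : R -> R.

(** Takes the place of the weight 1/x in Hardy's inequality, and stays bounded near 0. *)
Definition decay (x : R) : R := (1 + x)^-1.

Lemma decay_gt0 x : 0 <= x -> 0 < decay x.
Proof. by move=> x0; rewrite invr_gt0 ltr_wpDr. Qed.

Lemma decay_ge0 x : 0 <= x -> 0 <= decay x.
Proof. by move=> /decay_gt0/ltW. Qed.

Lemma decay_le1 x : 0 <= x -> decay x <= 1.
Proof. by move=> x0; rewrite invf_le1 ?ltr_wpDr// lerDl. Qed.

Lemma mul_decay_le1 x : 0 <= x -> x * decay x <= 1.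
Proof. by move=> x0; rewrite ler_pdivrMr ?ltr_wpDr// mul1r lerDr. Qed.

Lemma measurable_decay : measurable_fun D decay.
Proof.
apply: open_continuous_measurable_fun; first exact: interval_open.
move=> x; rewrite inE half_lineE => x0.
apply: cvgV; first by rewrite gt_eqF// ltr_wpDl// ltW.
by apply: cvgD; [exact: cvg_cst|exact: cvg_id].
Qed.

Lemma decay_bounded : locally_bounded decay.
Proof.
move=> b; exists 1 => x x0 _; have x0' := ltW x0.
by rewrite ger0_norm ?decay_ge0// decay_le1.
Qed.

Lemma prim_decay2 x : 0 <= x -> prim (fun t => decay t * decay t) x = 1 - decay x.
Proof.
move=> x0.
have ld : loc_int decay := loc_int_bounded measurable_decay decay_bounded.
have l2 : loc_int (fun t => decay t * decay t).
  exact: loc_int_mul_bounded measurable_decay decay_bounded ld.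
have d0 : decay 0 = 1 by rewrite /decay addr0 invr1.
have -> : 1 - decay x = (fun t => - decay t) x - (fun t => - decay t) 0.
  by rewrite d0 opprK addrC.
rewrite [X in _ = X - _](@abs_cont_prim _ (fun t => - decay t)
  (fun t => decay t * decay t) x)//.
- by rewrite addrC addKr.
- move=> e e0; exists e => // n s t st disj; apply: le_lt_trans.
  apply: ler_sum => i _; have [/andP[si sti] _] := st i.
  have ti := le_trans si sti.
  have -> : - decay (t i) - - decay (s i) = (t i - s i) * (decay (s i) * decay (t i)).
    by rewrite /decay; field; rewrite !gt_eqF ?ltr_wpDr.
  rewrite normrM ger0_norm ?subr_ge0// ler_piMr ?subr_ge0//.
  rewrite ger0_norm ?mulr_ge0 ?decay_ge0//.
  by rewrite mulr_ile1 ?decay_ge0 ?decay_le1.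
- apply: aeW => t /andP[t0 _].
  have h : 1 + t != 0 by rewrite gt_eqF// ltr_wpDr// ltW.
  have h1 : is_derive t 1 (fun y : R => 1 + y) 1.
    by have := is_deriveD (is_derive_cst (1 : R) t 1) (is_derive_id t 1);
       rewrite add0r.
  have := is_deriveN (is_deriveV h h1).
  move=> h2; apply: is_derive_eq h2 _.
  by rewrite /GRing.scale/= /decay; field.
Qed.

(** Cauchy-Schwarz on ]x, y], where decay^2 has integral decay x - decay y, followed by the limit in
    [y]. *)
Lemma ip_tail_bound G x : L2 D G -> 0 <= x ->
  L2 D decay /\
  (ip D decay (fun t => `|G t|) - prim (fun t => decay t * `|G t|) x) ^+ 2 <=
  decay x * nsq G.
Proof.
move=> lG x0.
have ld : loc_int decay := loc_int_bounded measurable_decay decay_bounded.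
have l2 : loc_int (fun t => decay t * decay t).
  exact: loc_int_mul_bounded measurable_decay decay_bounded ld.
have [|lr _] := @L2_bounded_prim R decay 1 l2 measurable_decay.
  by move=> n; rewrite prim_decay2// lerBlDr lerDl decay_ge0.
split => //; have lnG := L2_norm mD lG.
have lrG := L2_loc_intM lr lnG.
have c1 := cvg_prim_ip_pinfty lr lnG.
have c2 : (prim (fun t => decay t * `|G t|) y - prim (fun t => decay t * `|G t|) x) ^+ 2
    @[y --> +oo] --> (ip D decay (fun t => `|G t|) - prim (fun t => decay t * `|G t|) x) ^+ 2.
  have c3 : prim (fun t => decay t * `|G t|) y - prim (fun t => decay t * `|G t|) x
      @[y --> +oo] --> ip D decay (fun t => `|G t|) - prim (fun t => decay t * `|G t|) x.
    by apply: cvgB => //; exact: cvg_cst.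
  by rewrite expr2; under eq_cvg do rewrite expr2; exact: cvgM.
rewrite -(cvg_lim _ c2)//; apply: limr_le; first exact: (cvgP _ c2).
exists x; split; first exact: num_real.
move=> y xy; have xy' := ltW xy; have y0 : 0 <= y by exact: le_trans xy'.
have sub F : L2 D F -> L2 `]x, y] F.
  move=> [mF iF]; split.
    apply: measurable_funS mF; first exact: measurable_half_line.
    exact: sub_half_line.
  by apply: integrableS iF; [exact: mD|exact: mitv|exact: sub_half_line].
have CS := ip_CauchySchwarz (mitv x y) (sub _ lr) (sub _ lnG).
rewrite primB//; apply: (le_trans CS).
have e1 : ip `]x, y] decay decay <= decay x.
  rewrite /ip -(primB l2 x0 xy') !prim_decay2//.
  by rewrite opprB addrC -addrA addKr gerBl decay_ge0.
have e2 : ip `]x, y] (fun t => `|G t|) (fun t => `|G t|) <= nsq G.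
  have lGG := L2_loc_intM lnG lnG.
  rewrite /ip -(primB lGG x0 xy').
  have -> : (fun t => `|G t| * `|G t|) = (fun t => G t * G t).
    by apply/funext => t; rewrite -normrM ger0_norm// -expr2 sqr_ge0.
  apply: le_trans (prim_nsq_le y lG); rewrite gerBl.
  by apply: prim_ge0 => t _ _; rewrite -expr2 sqr_ge0.
by apply: ler_pM => //; exact: nsq_ge0.
Qed.

(** With [U] the integral of |G|, integrate the derivative of U^2 by parts against 1 - decay, the
    integral of decay^2. The boundary term has a favourable sign, so the left side [Y] is at most
    twice the integral of decay U |G|, and Cauchy-Schwarz gives Y^2 <= 4 Y nsq G. *)
Lemma hardy G b : L2 D G -> 0 <= b ->
  prim (fun t => (decay t * prim (fun s => `|G s|) t) *
                 (decay t * prim (fun s => `|G s|) t)) b <= 4 * nsq G.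
Proof.
move=> lG b0; have lnG := L2_norm mD lG; have lg := L2_loc_int lnG.
set g := fun s => `|G s|; set U := prim g.
have mU : measurable_fun D U by exact: measurable_prim.
have bU : locally_bounded U by exact: prim_locally_bounded.
have U0 t : 0 <= t -> 0 <= U t by move=> t0; apply: prim_ge0 => s _ _; exact: normr_ge0.
have ld : loc_int decay := loc_int_bounded measurable_decay decay_bounded.
have lr2 : loc_int (fun t => decay t * decay t).
  exact: loc_int_mul_bounded measurable_decay decay_bounded ld.
have lUg : loc_int (fun t => U t * g t) by exact: loc_int_mul_bounded.
have lUg2 : loc_int (fun t => 2 * (U t * g t)) by exact: loc_intZ.
have UE x : 0 <= x -> U x * U x = prim (fun t => 2 * (U t * g t)) x.
  move=> x0; rewrite (prim_parts lg lg x0) primZ//.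
  rewrite (@eq_prim _ (fun t => g t * prim g t) (fun t => U t * g t)); first by ring.
  by move=> t _; rewrite mulrC.
have V := prim_parts lUg2 lr2 b0.
have mrU : measurable_fun D (fun t => decay t * U t).
  by apply: measurable_funM => //; exact: measurable_decay.
have brU : locally_bounded (fun t => decay t * U t).
  move=> z; have [M1 h1] := decay_bounded z; have [M2 h2] := bU z.
  by exists (M1 * M2) => x x0 xz; rewrite normrM ler_pM// ?h1 ?h2.
have lrU := loc_int_bounded mrU brU.
have lY : loc_int (fun t => (decay t * U t) * (decay t * U t)).
  exact: loc_int_mul_bounded.
set Y := prim _ b.
have lrUg : loc_int (fun t => (decay t * U t) * g t) by exact: loc_int_mul_bounded.
have YE : Y <= 2 * prim (fun t => (decay t * U t) * g t) b.
  have e1 : prim (fun t => prim (fun s => 2 * (U s * g s)) t * (decay t * decay t)) b = Y.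
    by apply: eq_prim => t t0; rewrite -UE ?(ltW t0)//; ring.
  have e2 : prim (fun t => 2 * (U t * g t) * prim (fun s => decay s * decay s) t) b =
      prim (fun t => 2 * (U t * g t)) b - 2 * prim (fun t => (decay t * U t) * g t) b.
    rewrite -primZ// -primN//; last exact: loc_intZ.
    by apply: eq_prim => t t0; rewrite prim_decay2 ?(ltW t0)//; ring.
  rewrite e1 e2 -UE// prim_decay2// in V.
  have h : 0 <= U b * U b * decay b by rewrite !mulr_ge0 ?U0 ?decay_ge0.
  have fin (u d z y : R) : u * (1 - d) = u - 2 * z + y -> 0 <= u * d -> y <= 2 * z.
    by clra.
  exact: fin V h.
have CS : prim (fun t => (decay t * U t) * g t) b ^+ 2 <= Y * nsq G.
  have lrUi : L2 `]0, b] (fun t => decay t * U t).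
    split; first exact: measurable_sub_half_line.
    by apply: eq_integrable (lY.2 b) => [|t _]; [exact: mitv|rewrite /= expr2].
  have := ip_CauchySchwarz (mitv 0 b) lrUi (L2_itv b lnG).
  move=> h; apply: (le_trans h); apply: ler_wpM2l; first exact: nsq_ge0.
  apply: le_trans (prim_nsq_le b lG); rewrite le_eqVlt; apply/orP; left; apply/eqP.
  apply: (@eq_prim _ (fun t => `|G t| * `|G t|)) => t _.
  by rewrite -normrM ger0_norm// -expr2 sqr_ge0.
have Y0 : 0 <= Y by apply: prim_ge0 => t _ _; rewrite -expr2 sqr_ge0.
have G0 := nsq_ge0 D G.
move: YE CS Y0 G0; move: Y (prim _ b) (nsq G) => y z n h1 h2 h3 h4.
have h5 : y ^+ 2 <= 4 * (y * n).
  have h6 : y ^+ 2 <= (2 * z) ^+ 2 by rewrite lerXn2r ?nnegrE// (le_trans h3).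
  by move: h2 h6; rewrite exprMn; clra.
have [->|y0] := eqVneq y 0; first by rewrite mulr_ge0.
have {}y0 : 0 < y by rewrite lt_neqAle eq_sym y0.
by rewrite -(ler_pM2l y0); move: h5; rewrite expr2; clra.
Qed.

(** Integrate the square of the tail [w] by parts against t. The boundary term b w(b)^2 is at most
    [nsq G] by the tail bound, and t decay t <= 1 reduces the rest to twice the integral of w
    |G|. *)
Lemma hardy_dual G b : L2 D G -> 0 <= b ->
  prim (fun t => (ip D decay (fun s => `|G s|) - prim (fun s => decay s * `|G s|) t) *
                 (ip D decay (fun s => `|G s|) - prim (fun s => decay s * `|G s|) t)) b
  <= 6 * nsq G.
Proof.
move=> lG b0; have lnG := L2_norm mD lG; have lg := L2_loc_int lnG.
set g := fun s => `|G s|; set T := ip D decay g; set v := prim (fun s => decay s * g s).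
have ld : loc_int decay := loc_int_bounded measurable_decay decay_bounded.
have lrg : loc_int (fun s => decay s * g s).
  exact: loc_int_mul_bounded measurable_decay decay_bounded lg.
have mv : measurable_fun D v by exact: measurable_prim.
have bv : locally_bounded v by exact: prim_locally_bounded.
have tail x : 0 <= x -> (T - v x) ^+ 2 <= decay x * nsq G.
  by move=> x0; have [] := ip_tail_bound lG x0.
pose w x := T - v x.
have mw : measurable_fun D w by apply: measurable_funB.
have bw : locally_bounded w.
  move=> z; have [M h] := bv z; exists (`|T| + M) => x x0 xz.
  by apply: (le_trans (ler_normB _ _)); rewrite lerD2l h.
have w0 x : 0 <= x -> 0 <= w x.
  move=> x0; rewrite subr_ge0.
  have c1 := cvg_prim_ip_pinfty (ip_tail_bound lG x0).1 lnG.
  rewrite -[T](cvg_lim _ c1)//; apply: limr_ge; first exact: (cvgP _ c1).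
  exists x; split; first exact: num_real.
  move=> y xy; apply: prim_homo => //; first exact: ltW.
  move=> t xt _; apply: mulr_ge0; last exact: normr_ge0.
  exact: decay_ge0 (le_trans x0 (ltW xt)).
have one : loc_int (fun=> 1 : R).
  by apply: loc_int_bounded; [exact: measurable_cst|move=> z; exists 1 => x _ _; rewrite normr1].
have lwrg : loc_int (fun t => w t * (decay t * g t)) by exact: loc_int_mul_bounded.
have lh : loc_int (fun t => - 2 * (w t * (decay t * g t))) by exact: loc_intZ.
have w2E x : 0 <= x -> w x * w x = T ^+ 2 + prim (fun t => - 2 * (w t * (decay t * g t))) x.
  move=> x0; have p1 := prim_parts lrg lrg x0.
  have lvv : loc_int (fun t => v t * (decay t * g t)) by exact: loc_int_mul_bounded.
  have -> : prim (fun t => - 2 * (w t * (decay t * g t))) x =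
      - 2 * T * v x + 2 * prim (fun t => v t * (decay t * g t)) x.
    rewrite -(primZ (- 2 * T) x lrg) -(primZ 2 x lvv) -primD//; try exact: loc_intZ.
    by apply: eq_prim => t _; rewrite /w; ring.
  have e1 : prim (fun t => decay t * g t * prim (fun s => decay s * g s) t) x =
      prim (fun t => v t * (decay t * g t)) x by apply: eq_prim => t _; rewrite mulrC.
  rewrite e1 -/v in p1; rewrite /w.
  have -> : (T - v x) * (T - v x) = T ^+ 2 - 2 * T * v x + v x * v x by ring.
  by rewrite p1; ring.
have lw := loc_int_bounded mw bw.
have lww : loc_int (fun t => w t * w t) by exact: loc_int_mul_bounded.
have lwg : loc_int (fun t => w t * g t) by exact: loc_int_mul_bounded.
set Y := prim _ b.
have YE : Y <= nsq G + 2 * prim (fun t => w t * g t) b.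
  have V := prim_parts one lh b0.
  rewrite prim_cst// mul1r in V.
  have lh1 : loc_int (prim (fun t => - 2 * (w t * (decay t * g t)))).
    by apply: loc_int_bounded; [exact: measurable_prim|exact: prim_locally_bounded].
  have e1 : Y = T ^+ 2 * b + prim (fun t => 1 * prim (fun s => - 2 * (w s * (decay s * g s))) t) b.
    rewrite -(prim_cst (T ^+ 2) b0) -primD.
    - by apply: eq_prim => t t0; rewrite mul1r -w2E ?(ltW t0).
    - by apply: loc_int_bounded; [exact: measurable_cst|move=> z; exists `|T ^+ 2|].
    - by have := lh1; congr loc_int; apply/funext => t; rewrite mul1r.
  have mid : measurable_fun D (id : R -> R) by exact: measurable_id.
  have bid : locally_bounded (id : R -> R).
    by move=> z; exists `|z| => x x0 xz; rewrite !ger0_norm ?(ltW x0)// (le_trans (ltW x0)).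
  have l3 : loc_int (fun t => t * (w t * (decay t * g t))) by exact: (loc_int_mul_bounded mid bid).
  have e2 : prim (fun t => prim (fun=> 1) t * (- 2 * (w t * (decay t * g t)))) b =
      - 2 * prim (fun t => t * (w t * (decay t * g t))) b.
    rewrite -primZ//; apply: eq_prim => t t0.
    by rewrite prim_cst ?(ltW t0)//; ring.
  have e3 : prim (fun t => t * (w t * (decay t * g t))) b <= prim (fun t => w t * g t) b.
    apply: le_prim => // t t0 tb.
    have -> : t * (w t * (decay t * g t)) = (t * decay t) * (w t * g t) by ring.
    apply: ler_piMl; last exact: mul_decay_le1 (ltW t0).
    by apply: mulr_ge0; [exact: w0 (ltW t0)|exact: normr_ge0].
  have e4 : b * (w b * w b) <= nsq G.
    have := tail b b0; rewrite -expr2 => h; apply: (le_trans (ler_wpM2l b0 h)).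
    by rewrite mulrA ler_piMl ?mul_decay_le1//; exact: nsq_ge0.
  rewrite e2 in V; rewrite w2E// mulrDr V in e4; rewrite e1.
  by move: e3 e4; rewrite (mulrC b); clra.
have CS : prim (fun t => w t * g t) b ^+ 2 <= Y * nsq G.
  have lwi : L2 `]0, b] w.
    split; first exact: measurable_sub_half_line.
    by apply: eq_integrable (lww.2 b) => [|t _]; [exact: mitv|rewrite /= expr2].
  have := ip_CauchySchwarz (mitv 0 b) lwi (L2_itv b lnG).
  move=> h; apply: (le_trans h); apply: ler_wpM2l; first exact: nsq_ge0.
  apply: le_trans (prim_nsq_le b lG); rewrite le_eqVlt; apply/orP; left; apply/eqP.
  apply: (@eq_prim _ (fun t => `|G t| * `|G t|)) => t _.
  by rewrite -normrM ger0_norm// -expr2 sqr_ge0.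
have Y0 : 0 <= Y by apply: prim_ge0 => t _ _; rewrite -expr2 sqr_ge0.
have G0 := nsq_ge0 D G.
move: YE CS Y0 G0; move: Y (prim _ b) (nsq G) => y z n h1 h2 h3 h4.
(* The inequality (y - n)^2 <= 4 y n gives y <= (3 + 2 sqrt 2) n, and 6 is the next integer. *)
rewrite leNgt; apply/negP => h5.
have h6 : 0 <= z by move: h1 h5 h4; clra.
have h7 : (y - n) ^+ 2 <= 4 * (y * n).
  have h8 : (y - n) ^+ 2 <= (2 * z) ^+ 2.
    by rewrite lerXn2r ?nnegrE//; move: h1 h5 h4 h6; clra.
  by move: h2 h8; rewrite exprMn; clra.
by move: h7 h5 h4 h3; clear => *; nra.
Qed.

End hardy.

(** * The inverse normalized at infinity, and the Neumann series *)

Section bounded_inverse.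
Context {R : realType}.
Local Notation mu := (@lebesgue_measure R).
Local Notation D := (@half_line R).
Local Notation nsq F := (ip D F F).
Implicit Types F G th : R -> R.

(* The inverse of S at angle zero at infinity: the solution that kills the
   non-decaying component. *)
Definition inverse0 th G (x : R) : R :=
  volterra th G x + cos (th x) * ip D (fun t => sin (th t)) G.

(** [inverse0] is sin theta times the integral of cos theta G up to x, plus cos theta times the
    integral of sin theta G beyond x. As sin theta <= C decay, the two terms are controlled by
    [hardy] and [hardy_dual], whence 20 = 2 (4 + 6). The pointwise bound serves the Neumann
    series. *)
Lemma inverse0_bounded th (C : R) : measurable_fun D th -> 0 <= C ->
  (forall x, 0 < x -> 0 <= sin (th x) <= C * decay x) ->
  L2 D (fun t => sin (th t)) /\
  exists2 B : R, 0 <= B & forall G, L2 D G ->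
    [/\ L2 D (inverse0 th G), nsq (inverse0 th G) <= B * nsq G &
        forall x, 0 < x -> inverse0 th G x ^+ 2 <= B * nsq G].
Proof.
move=> mth C0 hC.
have ms := measurable_sin_fun mth; have mc := measurable_cos_fun mth.
(* Used with the zero function only to learn that [decay] is square integrable. *)
have [lr _] := @ip_tail_bound R (fun=> 0) 0 (L20 mD) (lexx 0).
have ls : L2 D (fun t => sin (th t)).
  apply: (L2_le mD ms (L2Z mD C lr)) => x; rewrite half_lineE => /hC/andP[h1 h2].
  by rewrite ger0_norm// (le_trans h2)// ler_norm.
split=> //; exists (20 * C ^+ 2); first by rewrite mulr_ge0// sqr_ge0.
move=> G lG; have lliG := L2_loc_int lG; have lnG := L2_norm mD lG.
have lg := L2_loc_int lnG.
have lsG := loc_int_sinM mth lliG; have lcG := loc_int_cosM mth lliG.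
set U := prim (fun s => `|G s|); set v := prim (fun s => decay s * `|G s|).
set T := ip D decay (fun s => `|G s|).
have lrg : loc_int (fun s => decay s * `|G s|).
  exact: loc_int_mul_bounded measurable_decay decay_bounded lg.
have tail x : 0 <= x -> `|ip D (fun t => sin (th t)) G - prim (fun t => sin (th t) * G t) x|
    <= C * (T - v x).
  move=> x0.
  have c1 : C * (v y - v x) @[y --> +oo] --> C * (T - v x).
    apply: cvgMr; apply: cvgB; last exact: cvg_cst.
    exact: cvg_prim_ip_pinfty.
  have c2 : `|prim (fun t => sin (th t) * G t) y - prim (fun t => sin (th t) * G t) x|
      @[y --> +oo] --> `|ip D (fun t => sin (th t)) G - prim (fun t => sin (th t) * G t) x|.
    apply: cvg_norm; apply: cvgB; last exact: cvg_cst.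
    exact: cvg_prim_ip_pinfty.
  have c3 : C * (v y - v x) - `|prim (fun t => sin (th t) * G t) y - prim (fun t => sin (th t) * G t) x|
      @[y --> +oo] --> C * (T - v x) - `|ip D (fun t => sin (th t)) G - prim (fun t => sin (th t) * G t) x|.
    exact: cvgB.
  rewrite -subr_ge0 -(cvg_lim _ c3)//; apply: limr_ge; first exact: (cvgP _ c3).
  exists x; split; first exact: num_real.
  move=> y xy; rewrite subr_ge0.
  apply: (le_trans (ler_norm_primB lsG x0 (ltW xy))).
  rewrite mulrBr /v -!primZ//; apply: prim_le_diff => //.
  - exact: loc_int_norm.
  - exact: loc_intZ.
  - exact: ltW.
  - move=> t xt _; have t0 : 0 < t by exact: le_lt_trans xt.
    have /andP[h1 h2] := hC t t0.
    by rewrite normrM ger0_norm// mulrA ler_wpM2r.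
have primU x : 0 <= x -> `|prim (fun t => cos (th t) * G t) x| <= U x.
  move=> x0; apply: (le_trans (ler_norm_prim lcG x0)); apply: le_prim => //.
    exact: loc_int_norm.
  by move=> t _ _; rewrite normrM ler_piMl// ler_norm_cos.
have pw x : 0 < x -> inverse0 th G x ^+ 2 <=
    2 * C ^+ 2 * ((decay x * U x) * (decay x * U x)) + 2 * C ^+ 2 * ((T - v x) * (T - v x)).
  move=> x0; have x0' := ltW x0; have /andP[h1 h2] := hC x x0.
  have -> : inverse0 th G x = sin (th x) * prim (fun t => cos (th t) * G t) x +
    cos (th x) * (ip D (fun t => sin (th t)) G - prim (fun t => sin (th t) * G t) x).
    by rewrite /inverse0 /volterra; ring.
  have a1 : `|sin (th x) * prim (fun t => cos (th t) * G t) x| <= C * (decay x * U x).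
    by rewrite normrM ger0_norm// mulrA; apply: ler_pM => //; exact: primU.
  have a2 : `|cos (th x) * (ip D (fun t => sin (th t)) G - prim (fun t => sin (th t) * G t) x)|
      <= C * (T - v x).
    rewrite normrM; apply: le_trans (tail x x0'); rewrite ler_piMl//.
    exact: ler_norm_cos.
  move: a1 a2; move: (sin _ * _) (cos _ * _) (decay x * U x) (T - v x) => a b c d.
  move=> a1 a2.
  have b1 : a ^+ 2 <= (C * c) ^+ 2.
    by rewrite -[leLHS]real_normK ?num_real// lerXn2r ?nnegrE// (le_trans _ a1).
  have b2 : b ^+ 2 <= (C * d) ^+ 2.
    by rewrite -[leLHS]real_normK ?num_real// lerXn2r ?nnegrE// (le_trans _ a2).
  have := sqr_ge0 (a - b); move: b1 b2; rewrite !exprMn; clear => *; nra.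
have mU : measurable_fun D U by exact: measurable_prim.
have mv : measurable_fun D v by exact: measurable_prim.
have bU : locally_bounded U by exact: prim_locally_bounded.
have bv : locally_bounded v by exact: prim_locally_bounded.
have mrU : measurable_fun D (fun t => decay t * U t).
  by apply: measurable_funM => //; exact: measurable_decay.
have brU : locally_bounded (fun t => decay t * U t).
  move=> z; have [M1 h1] := decay_bounded z; have [M2 h2] := bU z.
  by exists (M1 * M2) => x x0 xz; rewrite normrM ler_pM// ?h1 ?h2.
have lrU : loc_int (fun t => (decay t * U t) * (decay t * U t)).
  exact: loc_int_mul_bounded mrU brU (loc_int_bounded mrU brU).
have mw : measurable_fun D (fun t => T - v t) by apply: measurable_funB.
have bw : locally_bounded (fun t => T - v t).
  move=> z; have [M h] := bv z; exists (`|T| + M) => x x0 xz.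
  by apply: (le_trans (ler_normB _ _)); rewrite lerD2l h.
have lw : loc_int (fun t => (T - v t) * (T - v t)).
  exact: loc_int_mul_bounded mw bw (loc_int_bounded mw bw).
have mI : measurable_fun D (inverse0 th G).
  apply: measurable_funD; first exact: measurable_volterra.
  by apply: measurable_funM.
have lbound := loc_intD (loc_intZ (2 * C ^+ 2) lrU) (loc_intZ (2 * C ^+ 2) lw).
have lII : loc_int (fun t => inverse0 th G t * inverse0 th G t).
  split; first exact: measurable_funM.
  move=> b; apply: (le_measurable_integrable (mitv 0 b) _ (lbound.2 b)).
    by apply: measurable_sub_half_line; exact: measurable_funM.
  move=> x; rewrite /= in_itv/= => /andP[x0 _].
  by rewrite -expr2 ger0_norm ?sqr_ge0// pw.
have G0 := nsq_ge0 D G.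
have [|l2I nI] := @L2_bounded_prim R (inverse0 th G) (20 * C ^+ 2 * nsq G) lII mI.
  move=> n; have n0 : 0 <= n%:R :> R by [].
  apply: le_trans (le_prim (x := n%:R) lII lbound _) _.
    by move=> t t0 _; rewrite -expr2 pw.
  rewrite primD; [|exact: loc_intZ..]; rewrite !primZ//.
  have h1 := hardy lG n0; have h2 := hardy_dual lG n0.
  have C2 := sqr_ge0 C.
  have := ler_wpM2l C2 h1; have := ler_wpM2l C2 h2.
  rewrite -/U -/v -/T; move: (C ^+ 2) (prim _ _) (prim _ _) (nsq G); clra.
split => //.
move=> x x0; apply: (le_trans (pw x x0)); have x0' := ltW x0.
have e1 : (decay x * U x) * (decay x * U x) <= nsq G.
  have := prim_norm_sqr_le lG x0'; rewrite -/U => h.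
  have -> : decay x * U x * (decay x * U x) = decay x ^+ 2 * U x ^+ 2 by ring.
  apply: (le_trans (ler_wpM2l (sqr_ge0 _) h)).
  have -> : decay x ^+ 2 * (x * nsq G) = decay x * (x * decay x) * nsq G by ring.
  rewrite ler_piMl// mulr_ile1 ?mul_decay_le1 ?decay_le1 ?decay_ge0//.
  by rewrite mulr_ge0 ?decay_ge0.
have e2 : (T - v x) * (T - v x) <= nsq G.
  have [_] := ip_tail_bound lG x0'; rewrite -/T -/v expr2 => h; apply: (le_trans h).
  by rewrite ler_piMl ?decay_le1.
have C2 := sqr_ge0 C; have := ler_wpM2l C2 e1; have := ler_wpM2l C2 e2.
have := mulr_ge0 C2 G0.
move: (C ^+ 2) (decay x * U x * (decay x * U x)) ((T - v x) * (T - v x)) (nsq G); clra.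
Qed.

Lemma inverse0D th F G x : measurable_fun D th -> L2 D (fun t => sin (th t)) ->
  L2 D F -> L2 D G ->
  inverse0 th (fun t => F t + G t) x = inverse0 th F x + inverse0 th G x.
Proof.
move=> mth ls lF lG; rewrite /inverse0 volterraD//; try exact: L2_loc_int.
by rewrite (ipDr mD lF lG ls); ring.
Qed.

Lemma inverse0Z th (c : R) G x : measurable_fun D th -> L2 D (fun t => sin (th t)) ->
  L2 D G -> inverse0 th (fun t => c * G t) x = c * inverse0 th G x.
Proof.
move=> mth ls lG; rewrite /inverse0 volterraZ//; last exact: L2_loc_int.
by rewrite (ipZr mD c lG ls); ring.
Qed.

(* Neumann series.  The uniform pointwise bound lets us take pointwise limits,
   so that completeness of L^2 is not needed. *)
Lemma neumann (K : (R -> R) -> R -> R) (B w : R) : 0 <= B -> w ^+ 2 * B <= 4^-1 ->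
  (forall F G x, L2 D F -> L2 D G -> K (fun t => F t - G t) x = K F x - K G x) ->
  (forall G, L2 D G -> [/\ L2 D (K G), nsq (K G) <= B * nsq G &
     forall x, 0 < x -> K G x ^+ 2 <= B * nsq G]) ->
  forall u, L2 D u -> exists2 F, L2 D F & forall x, 0 < x -> F x = u x + w * K F x.
Proof.
move=> B0 wB KB hK u lu.
pose F_ := fix F n := if n is n'.+1 then (fun x => u x + w * K (F n') x) else (fun=> 0 : R).
have lF n : L2 D (F_ n).
  elim: n => [|n IH]; first exact: L20 mD.
  by have [lK _ _] := hK _ IH; have := L2D mD lu (L2Z mD w lK).
pose d n x := F_ n.+1 x - F_ n x.
have ld n : L2 D (d n) by exact: (L2B mD (lF n.+1) (lF n)).
have dS n : d n.+1 = (fun x => w * K (d n) x).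
  apply/funext => x; rewrite /d (KB _ _ x (lF n.+1) (lF n)) /=; ring.
have nd n : nsq (d n) <= 4^-1 ^+ n * nsq u.
  elim: n => [|n IH].
    have [lK nK _] := hK _ (L20 mD).
    have z0 : nsq (fun=> 0 : R) = 0.
      by apply: ae_eq0_nsq mD _ (L20 mD) _; exact: aeW.
    rewrite z0 mulr0 in nK.
    have K0 : nsq (K (fun=> 0)) = 0 by apply/eqP; rewrite eq_le nK nsq_ge0.
    have hz := nsq_eq0 mD lK K0.
    have dE : nsq (d 0%N) = nsq u.
      apply: (ae_eq_nsq mD (ld 0%N) lu).
      by apply: aeS hz => x h Dx; rewrite /d /= h// mulr0 addr0 subr0.
    by rewrite dE expr0 mul1r.
  have [lK nK _] := hK _ (ld n).
  rewrite dS (nsqZ mD w lK); have N0 := nsq_ge0 D (d n).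
  apply: (@le_trans _ _ (w ^+ 2 * B * nsq (d n))).
    by rewrite -mulrA; apply: ler_wpM2l => //; exact: sqr_ge0.
  apply: (@le_trans _ _ (4^-1 * nsq (d n))); first exact: ler_wpM2r.
  by rewrite exprS -mulrA ler_pM2l ?invr_gt0.
pose c := Num.sqrt (nsq u).
have c2 : c ^+ 2 = nsq u by rewrite sqr_sqrtr// nsq_ge0.
have c0 : 0 <= c by exact: sqrtr_ge0.
have half0 n : 0 <= 2^-1 ^+ n :> R by rewrite exprn_ge0// invr_ge0.
have half4 n : 4^-1 ^+ n = (2^-1 ^+ n) ^+ 2 :> R.
  by rewrite exprAC; congr (_ ^+ n); rewrite exprVn -natrX.
(* The index starts at 1: [d 0] contains [u], for which no pointwise bound is available, while the
   later increments lie in the image of [K]. *)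
have pd n x : 0 < x -> `|d n.+1 x| <= c * 2^-1 ^+ n.+1.
  move=> x0; have [_ _ hp] := hK _ (ld n).
  rewrite -(ler_pXn2r (ltn0Sn 1)) ?nnegrE ?mulr_ge0// real_normK ?num_real// dS exprMn.
  apply: (@le_trans _ _ (w ^+ 2 * (B * nsq (d n)))).
    by apply: ler_wpM2l; [exact: sqr_ge0|exact: hp].
  rewrite exprMn c2 -half4 mulrA.
  apply: (@le_trans _ _ (4^-1 * nsq (d n))).
    by apply: ler_wpM2r => //; exact: nsq_ge0.
  by rewrite [4^-1 ^+ _]exprS mulrCA ler_pM2l ?invr_gt0// mulrC.
pose E n := c * 2^-1 ^+ n.
have E0 n : 0 <= E n by exact: mulr_ge0.
have ES n : E n = 2 * E n.+1 by rewrite /E exprS; field.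
have cE : E n @[n --> \oo] --> 0.
  rewrite -(mulr0 c); apply: cvgMr; apply: cvg_expr.
  by rewrite ger0_norm ?invr_ge0// invf_lt1// ltr1n.
have Elow (z k : R) : (forall n, z <= k * E n) -> z <= 0.
  move=> h; have ck : k * E n @[n --> \oo] --> k * 0 by exact: cvgMr.
  rewrite mulr0 in ck; rewrite -(cvg_lim _ ck)//.
  by apply: limr_ge; [exact: (cvgP _ ck)|exact: nearW].
(* The upper ends F_(n+1) + E n decrease and the lower ends F_(n+1) - E n increase, because
   consecutive iterates differ by at most [E n.+1], half of [E n]. Monotonicity of these nested
   brackets provides the pointwise limit. *)
pose hi x n := F_ n.+1 x + E n.
have hi_step x n : 0 < x -> `|F_ n.+2 x - F_ n.+1 x| <= E n.+1 by exact: pd.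
have hi_dec x : 0 < x -> {homo hi x : n m / (n <= m)%N >-> m <= n}.
  move=> x0; apply/nonincreasing_seqP => n; have := hi_step x n x0.
  rewrite /hi (ES n) ler_norml => /andP[_]; move: (F_ _ _) (F_ _ _) (E _); clra.
have lo_inc x n m : 0 < x -> (n <= m)%N -> F_ n.+1 x - E n <= F_ m.+1 x - E m.
  move=> x0; have /nondecreasing_seqP h : forall n, F_ n.+1 x - E n <= F_ n.+2 x - E n.+1.
    move=> k; have := hi_step x k x0.
    rewrite (ES k) ler_norml => /andP[+ _]; move: (F_ _ _) (F_ _ _) (E _); clra.
  exact: h.
have hi_cvg x : 0 < x -> cvgn (hi x).
  move=> x0; apply: nonincreasing_is_cvgn; first exact: hi_dec.
  exists (F_ 1%N x - E 0%N) => _ [n _ <-].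
  apply: (le_trans (lo_inc x 0%N n x0 (leq0n n))).
  by rewrite lerD2l (le_trans _ (E0 n))// oppr_le0.
pose F x := limn (hi x).
have F_hi x n : 0 < x -> F x <= F_ n.+1 x + E n.
  by move=> x0; exact: (nonincreasing_cvgn_ge (hi_dec x x0) (hi_cvg x x0) n).
have F_lo x n : 0 < x -> F_ n.+1 x - E n <= F x.
  move=> x0; apply: limr_ge; first exact: hi_cvg.
  exists n => // m /= nm; apply: (le_trans (lo_inc x n m x0 nm)).
  by rewrite /hi lerD2l (le_trans _ (E0 m))// oppr_le0.
have F_near x n : 0 < x -> `|F x - F_ n.+1 x| <= E n.
  move=> x0; rewrite ler_norml; have := F_hi x n x0; have := F_lo x n x0.
  by clear => h1 h2; apply/andP; split; lra.
have mF : measurable_fun D F.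
  apply: (@measurable_fun_cvg _ _ _ _ (fun n => F_ n.+1)) => [m|x].
    exact: (lF m.+1).1.
  rewrite half_lineE => x0.
  have -> : (fun n => F_ n.+1 x) = (fun n => hi x n - E n).
    by apply/funext => n; rewrite /hi addrK.
  by rewrite -[F x]subr0; apply: cvgB => //; exact: hi_cvg.
have add_sqr f g (a b : R) : L2 D f -> L2 D g -> 0 <= a -> 0 <= b ->
    nsq f <= a ^+ 2 -> nsq g <= b ^+ 2 -> nsq (fun x => f x + g x) <= (a + b) ^+ 2.
  move=> lf lg a0 b0 ha hb; rewrite (nsqD mD lf lg).
  have := ip_CauchySchwarz mD lf lg => CS.
  have h : ip D f g ^+ 2 <= (a * b) ^+ 2.
    by rewrite exprMn; apply: (le_trans CS); apply: ler_pM => //; exact: nsq_ge0.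
  have h2 : ip D f g <= a * b.
    apply: (le_trans (ler_norm _)).
    by rewrite -(ler_pXn2r (ltn0Sn 1)) ?nnegrE ?mulr_ge0// real_normK ?num_real.
  by move: h2 ha hb; move: (nsq f) (nsq g) (ip D f g); clra.
have FF n k : nsq (fun x => F_ (n + k)%N x - F_ n x) <= (2 * E n) ^+ 2.
  elim: k n => [|k IH] n.
    rewrite addn0; have -> : nsq (fun x => F_ n x - F_ n x) = 0 by exact: nsq_subrr.
    exact: sqr_ge0.
  have -> : (fun x => F_ (n + k.+1)%N x - F_ n x) =
     (fun x => (F_ (n.+1 + k)%N x - F_ n.+1 x) + d n x).
    by apply/funext => x; rewrite /d addnS addSn; ring.
  have -> : 2 * E n = 2 * E n.+1 + E n by rewrite (ES n); ring.
  apply: add_sqr => //; [exact: (L2B mD (lF (n.+1 + k)%N) (lF n.+1))|exact: mulr_ge0|].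
  by rewrite /E exprMn c2 -half4 mulrC.
have FmF n : L2 D (fun x => F x - F_ n x) /\
    nsq (fun x => F x - F_ n x) <= 2 * (2 * E n) ^+ 2.
  have mFn : measurable_fun D (fun x => F x - F_ n x).
    by apply: measurable_funB => //; exact: (lF n).1.
  have near_bd m : locally_bounded (fun x => F x - F_ m.+1 x).
    by move=> b; exists (E m) => x x0 _; exact: F_near.
  have lm m : loc_int (fun x => (F x - F_ m.+1 x) * (F x - F_ m.+1 x)).
    have mm : measurable_fun D (fun x => F x - F_ m.+1 x).
      by apply: measurable_funB => //; exact: (lF _).1.
    exact: loc_int_mul_bounded mm (near_bd m) (loc_int_bounded mm (near_bd m)).
  have l2 m : L2 D (fun x => F_ m x - F_ n x) by exact: (L2B mD (lF m) (lF n)).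
  have lb m := loc_intD (loc_intZ 2 (lm m)) (loc_intZ 2 (L2_loc_intM (l2 m.+1) (l2 m.+1))).
  have pwb m x : (F x - F_ n x) * (F x - F_ n x) <=
      2 * ((F x - F_ m.+1 x) * (F x - F_ m.+1 x)) +
      2 * ((F_ m.+1 x - F_ n x) * (F_ m.+1 x - F_ n x)).
    move: (F x) (F_ m.+1 x) (F_ n x) => a b z.
    by have := sqr_ge0 (a - b - (b - z)); clear; nra.
  have lFn : loc_int (fun x => (F x - F_ n x) * (F x - F_ n x)).
    split; first exact: measurable_funM.
    move=> b; apply: (le_measurable_integrable (mitv 0 b) _ ((lb 0%N).2 b)).
      by apply: measurable_sub_half_line; exact: measurable_funM.
    by move=> x _; rewrite -[X in `|X|]expr2 ger0_norm ?sqr_ge0// expr2 pwb.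
  have [|//] := @L2_bounded_prim R _ (2 * (2 * E n) ^+ 2) lFn mFn.
  (* On ]0, N] the uniform distance between [F] and a late iterate contributes at most 2 N c E m,
     which vanishes as [m] grows with [N] fixed. *)
  move=> N; rewrite -subr_le0; apply: (Elow _ (2 * N%:R * c)) => m.
  have N0 : 0 <= N%:R :> R by [].
  have h1 : prim (fun x => (F x - F_ n x) * (F x - F_ n x)) N%:R <=
      2 * prim (fun x => (F x - F_ (n + m).+1 x) * (F x - F_ (n + m).+1 x)) N%:R +
      2 * prim (fun x => (F_ (n + m).+1 x - F_ n x) * (F_ (n + m).+1 x - F_ n x)) N%:R.
    have q1 := lm (n + m)%N; have q2 := L2_loc_intM (l2 (n + m).+1) (l2 (n + m).+1).
    rewrite -(primZ 2 _ q1) -(primZ 2 _ q2) -(primD _ (loc_intZ 2 q1) (loc_intZ 2 q2)).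
    by apply: le_prim lFn (lb (n + m)%N) _ => t _ _; exact: pwb.
  have h2 : prim (fun x => (F_ (n + m).+1 x - F_ n x) * (F_ (n + m).+1 x - F_ n x)) N%:R
      <= (2 * E n) ^+ 2.
    by apply: le_trans (prim_nsq_le _ (l2 _)) _; rewrite -addnS; exact: FF.
  have h3 : prim (fun x => (F x - F_ (n + m).+1 x) * (F x - F_ (n + m).+1 x)) N%:R
      <= N%:R * (c * E m).
    have cst : loc_int (fun=> c * E m).
      by apply: loc_int_bounded; [exact: measurable_cst|move=> z; exists `|c * E m|].
    rewrite mulrC -(prim_cst (c * E m) N0); apply: le_prim => // t t0 _.
    rewrite -expr2 -real_normK ?num_real//.
    apply: (@le_trans _ _ (E (n + m)%N ^+ 2)).
      by rewrite lerXn2r ?nnegrE//; exact: F_near.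
    rewrite expr2; apply: ler_pM => //.
      by rewrite /E ler_piMr// exprn_ile1 ?invr_ge0// invf_le1// ler1n.
    rewrite /E; apply: ler_wpM2l => //.
    by apply: ler_wiXn2l; rewrite ?invr_ge0 ?invf_le1 ?ler1n ?leq_addl.
  by move: h1 h2 h3; move: (prim _ _) (prim _ _) (prim _ _) (E m) ((2 * E n) ^+ 2); clra.
have lFF : L2 D F.
  have := (FmF 0%N).1; congr L2; apply/funext => x; by rewrite /F_ subr0.
exists F => // x x0; apply/eqP; rewrite -subr_eq0 -normr_le0; apply: (Elow _ 8) => n.
have [lFn nFn] := FmF n.+1; have [_ _ hp] := hK _ lFn.
have -> : F x - (u x + w * K F x) = (F x - F_ n.+2 x) - w * K (fun t => F t - F_ n.+1 t) x.
  by rewrite (KB _ _ x lFF (lF n.+1)) /=; ring.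
apply: (le_trans (ler_normB _ _)).
have h1 : `|w * K (fun t => F t - F_ n.+1 t) x| <= 4 * E n.+1.
  rewrite -(ler_pXn2r (ltn0Sn 1)) ?nnegrE ?mulr_ge0// real_normK ?num_real// exprMn.
  apply: (@le_trans _ _ (w ^+ 2 * (B * nsq (fun t => F t - F_ n.+1 t)))).
    by apply: ler_wpM2l; [exact: sqr_ge0|exact: hp].
  rewrite mulrA; apply: (@le_trans _ _ (4^-1 * nsq (fun t => F t - F_ n.+1 t))).
    by apply: ler_wpM2r => //; exact: nsq_ge0.
  have h2 := sqr_ge0 (E n.+1); move: nFn h2; rewrite !exprMn.
  by move: (nsq _) (E n.+1 ^+ 2); clra.
have h2 := F_near x n.+1 x0; move: h1 h2; rewrite (ES n).
by have := E0 n.+1; move: (E n.+1) `|_ - _| `|_ * _|; clra.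
Qed.

End bounded_inverse.

(** * Sufficiency of the decay: resolvent points at and near zero *)

Section sufficiency.
Context {R : realType}.
Local Notation mu := (@lebesgue_measure R).
Local Notation D := (@half_line R).
Local Notation nsq F := (ip D F F).
Implicit Types F G : R -> R.

(** Theta lies in [0, pi], where the sine is nonnegative. Up to [M] the bound sin <= 1 is enough;
    beyond it one uses sin theta <= theta, x theta <= C and 1 + x <= 2x. *)
Lemma sin_decay (phi : R -> R) (A : R) : decreasing_to phi A ->
  (exists C N : R, forall x, N < x -> x * (phi x - A) <= C) ->
  exists2 C : R, 0 <= C & forall x, 0 < x -> 0 <= sin (phi x - A) <= C * decay x.
Proof.
move=> dphi [C [N hC]]; have [_ _ phi_le A_ge] := dphi.
pose M := `|N| + 1; have N0 := normr_ge0 N; have C0 := normr_ge0 C.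
exists (2 * `|C| + (1 + M)) => [|x x0]; first by rewrite /M; move: N0 C0; clra.
have t0 : 0 <= phi x - A by rewrite subr_ge0 (limit_le dphi).
have tpi : phi x - A <= pi by have := phi_le x x0; move: A_ge; clra.
rewrite sin_ge0_pi ?t0//= ler_pdivlMr; last by rewrite ltr_wpDl// ltW.
have [xM|Mx] := leP x M.
  have := sin_le1 (phi x - A); have : 0 <= 1 + x by rewrite addr_ge0// ltW.
  move: xM C0; move: (sin _) (`|C|) => s c h1 h2 h3 h4.
  have := ler_wpM2r h3 h4; move: h1 h2; clra.
have Nx : N < x.
  by apply: le_lt_trans (ler_norm N) (lt_trans _ Mx); rewrite ltrDl.
have x1 : 1 <= x by move: Mx N0; rewrite /M; clra.
have h := hC x Nx; have hs := sin_le_id t0; have hc := ler_norm C.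
have := ler_wpM2r (addr_ge0 ler01 (ltW x0)) hs.
have := ler_wpM2r t0 x1; move: N0 h hc C0; rewrite /M.
move: (phi x - A) (sin (phi x - A)) `|C| `|N|; clra.
Qed.

Lemma L2_not_bounded_below F (gam a : R) : L2 D F -> 0 < gam -> 0 <= a ->
  ~ (forall x, a <= x -> gam <= `|F x|).
Proof.
move=> lF g0 a0 hF.
have lFF := L2_loc_intM lF lF; have n0 := nsq_ge0 D F.
(* Over an interval of this length the integral of [F ^+ 2] would exceed [nsq F]. *)
pose t := (nsq F + 1) / gam ^+ 2.
have g20 : 0 < gam ^+ 2 by rewrite exprn_gt0.
have t0 : 0 <= t by rewrite divr_ge0 ?addr_ge0// ltW.
have := @prim_lower R _ (gam ^+ 2) a (a + t) lFF a0 _ _.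
have -> : gam ^+ 2 * (a + t - a) = nsq F + 1.
  by rewrite /t; field; rewrite gt_eqF.
have h1 := prim_nsq_le (a + t) lF.
have h2 : 0 <= prim (fun x => F x * F x) a.
  by apply: prim_ge0 => s _ _; rewrite -expr2 sqr_ge0.
suff h3 : nsq F + 1 <= prim (fun x => F x * F x) (a + t) - prim (fun x => F x * F x) a.
  by move: h1 h2 h3; clra.
apply: le_trans (prim_lower lFF a0 _ (m := gam ^+ 2) _); last 2 first.
- by rewrite lerDl.
- move=> s as_ _; rewrite -expr2 -[leRHS]real_normK ?num_real//.
  by rewrite lerXn2r ?nnegrE ?(ltW g0)// hF// ltW.
by rewrite le_eqVlt; apply/orP; left; apply/eqP; rewrite /t; field; rewrite gt_eqF.
Qed.

Lemma cos_eventually_ge (f : R -> R) (A gam : R) : f x @[x --> +oo] --> A ->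
  gam < cos A -> exists2 a : R, 0 <= a & forall x, a <= x -> gam <= cos (f x).
Proof.
move=> fA gA.
have cf : cos (f x) @[x --> +oo] --> cos A.
  by apply: continuous_cvg => //; exact: continuous_cos.
have e0 : 0 < cos A - gam by rewrite subr_gt0.
have /cvgrPdist_lt /(_ _ e0) [N [_ hN]] := cf.
exists (`|N| + 1); first by rewrite addr_ge0.
move=> x Nx; have Nx' : N < x.
  by apply: le_lt_trans (ler_norm N) (lt_le_trans _ Nx); rewrite ltrDl.
by have := hN x Nx'; rewrite ltr_norml => /andP[_]; clra.
Qed.

Lemma eq_prim_ae F G x : measurable_fun D F -> measurable_fun D G ->
  {ae mu, forall x : R, 0 < x -> F x = G x} -> prim F x = prim G x.
Proof.
move=> mF mG FG; congr fine; apply: ae_eq_integral.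
- exact: mitv.
- by apply/measurable_EFinP; exact: measurable_sub_half_line.
- by apply/measurable_EFinP; exact: measurable_sub_half_line.
- by apply: aeS FG => t ht /=; rewrite in_itv/= => /andP[t0 _]; rewrite ht.
Qed.

(** Every term of the formula for [F] contains a factor cos phi, so the domain is {0} and the
    operator acts on the zero space. *)
Lemma res0_degenerate (phi : R -> R) : measurable_fun D phi ->
  {ae mu, forall x : R, 0 < x -> cos (phi x) = 0} -> resolvent phi 0.
Proof.
move=> mphi c0.
have rel_0 F G : rel phi F G -> {ae mu, forall x : R, 0 < x -> F x = 0}.
  move=> [lF lG [c hc]].
  have p0 x : 0 < x -> prim (fun t => cos (phi t) * G t) x = 0.
    move=> x0; rewrite (@eq_prim_ae _ (fun=> 0)); first by rewrite prim_cst ?mul0r// ltW.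
    - by apply: measurable_funM lG.1; exact: measurable_cos_fun.
    - exact: measurable_cst.
    - by apply: aeS c0 => t h t0; rewrite h// mul0r.
  apply: aeS2 hc c0 => x h1 h2 x0.
  by rewrite h1// /volterra h2// p0// !mulr0 mul0r subrr addr0.
split; last first.
  exists 1 => F G [h _]; have [lF lG _] := h.
  rewrite (ae_eq0_nsq mD lF (ae_half_line (rel_0 _ _ h))) mul1r.
  exact: nsq_ge0.
move=> h [lh hcl]; exists (fun=> 0), (fun=> 0); split.
  exact: op0.
have nh : nsq h = 0.
  apply/eqP; rewrite eq_le nsq_ge0 andbT; apply/ler_addgt0Pr => e e0.
  rewrite add0r; have [k [k' [hk he]]] := hcl _ e0.
  have [lk _ _] := hk; apply: le_trans (ltW he).
  rewrite le_eqVlt; apply/orP; left; apply/eqP.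
  apply: (ae_eq_nsq mD lh (L2B mD lh lk)).
  by apply: aeS (ae_half_line (rel_0 _ _ hk)) => x hx Dx; rewrite hx// subr0.
apply: aeS (nsq_eq0 mD lh nh) => x hx x0.
by rewrite hx ?half_lineE// mulr0 subrr.
Qed.

(** [inverse0], corrected so as to satisfy the boundary condition at 0, inverts the relation on all
    of L^2. The solution is unique because cos phi tends to cos A, which is nonzero, so no nonzero
    multiple of it is square integrable. *)
Lemma res0_interior (phi : R -> R) (A : R) : decreasing_to phi A ->
  - (pi / 2) < A < pi / 2 ->
  (exists C N : R, forall x, N < x -> x * (phi x - A) <= C) -> resolvent phi 0.
Proof.
move=> dphi Aint hb; have mphi := measurable_decreasing dphi.
have cA : 0 < cos A by exact: cos_gt0_pihalf.
have cA0 := lt0r_neq0 cA.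
have [C C0 hC] := sin_decay dphi hb.
pose th x := phi x - A.
have phiE : phi = (fun t => A + th t) by apply/funext => t; rewrite /th addrC subrK.
have mth : measurable_fun D th by apply: measurable_funB.
have [ls [B B0 hB]] := inverse0_bounded mth C0 hC.
pose tau := sin A / cos A.
pose sg x := sin (th x).
(* Since cos theta = cos phi / cos A + tau sin theta, removing this multiple of sin theta leaves a
   multiple of cos phi, the homogeneous solution that obeys the boundary condition. *)
pose K G x := inverse0 th G x - tau * ip D sg G * sg x.
have KE G x : L2 D G -> K G x = ip D sg G / cos A * cos (phi x) + volterra phi G x.
  move=> lG; rewrite [X in volterra X]phiE volterra_shift//; last exact: L2_loc_int.
  rewrite (_ : phi x = A + th x); last by rewrite /th addrC subrK.
  by rewrite /K /inverse0 -/sg cosD /tau /sg; field.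
have lK G : L2 D G -> L2 D (K G).
  move=> lG; have [lI _ _] := hB G lG.
  exact: (L2B mD lI (L2Z mD (tau * ip D sg G) ls)).
pose M := 2 * B + 2 * (tau ^+ 2 * nsq sg ^+ 2).
have nK G : L2 D G -> nsq (K G) <= M * nsq G.
  move=> lG; have [lI nI _] := hB G lG.
  apply: (le_trans (nsqB_le mD lI (L2Z mD (tau * ip D sg G) ls))).
  rewrite (nsqZ mD _ ls) exprMn.
  have CS := ip_CauchySchwarz mD ls lG.
  have s0 := nsq_ge0 D sg; have t2 := sqr_ge0 tau.
  have := ler_wpM2l (mulr_ge0 t2 s0) CS; rewrite -/sg /M; move: nI.
  move: (nsq (inverse0 th G)) (ip D sg G ^+ 2) (nsq sg) (nsq G) (tau ^+ 2).
  by clra.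
have relK G : L2 D G -> rel phi (K G) G.
  move=> lG; split => //; first exact: lK.
  by exists (ip D sg G / cos A); apply: aeW => x _; exact: KE.
split.
  move=> h ch; have [lh _] := ch; exists (K h), h; split.
    by split => //; exact: relK.
  by apply: aeW => x x0; rewrite mul0r subr0.
exists M => F G [[lF lG [c hc]] _].
have -> : (fun x => G x - 0 * F x) = G by apply/funext => x; rewrite mul0r subr0.
pose c' := c - ip D sg G / cos A.
have FK : {ae mu, forall x : R, 0 < x -> F x - K G x = c' * cos (phi x)}.
  by apply: aeS hc => x h x0; rewrite h// KE// /c'; ring.
have lc' : L2 D (fun x => c' * cos (phi x)).
  apply: L2_ae_eq FK; first exact: (L2B mD lF (lK G lG)).
  by apply: measurable_funM => //; exact: measurable_cos_fun.
have c'0 : c' = 0.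
  apply/eqP; apply: contraT => c'0.
  have gA : cos A / 2 < cos A by rewrite ltr_pdivrMr// ltr_pMr// ltr1n.
  have [_ lim_phi _ _] := dphi.
  have [a a0 ha] := cos_eventually_ge lim_phi gA.
  have g0 : 0 < `|c'| * (cos A / 2) by rewrite mulr_gt0 ?normr_gt0// divr_gt0.
  case: (L2_not_bounded_below lc' g0 a0) => x ax.
  rewrite normrM; apply: ler_wpM2l => //.
  by apply: (le_trans (ha x ax)); exact: ler_norm.
have -> : nsq F = nsq (K G).
  apply: (ae_eq_nsq mD lF (lK G lG)).
  apply: aeS (ae_half_line FK) => x h Dx; apply/eqP.
  by rewrite -subr_eq0 h// c'0 mul0r.
exact: nK.
Qed.

(** Now cos phi = sin theta is square integrable and spans the kernel. On its orthogonal complement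
    S - w is inverted by a Neumann series around the inverse [K] of S; on its span S - w is
    multiplication by -w. *)
Lemma res_gap (phi : R -> R) (A : R) : decreasing_to phi A -> A = - (pi / 2) ->
  (exists C N : R, forall x, N < x -> x * (phi x - A) <= C) ->
  L2 D (fun x => cos (phi x)) /\
  (nsq (fun x => cos (phi x)) != 0 ->
   exists2 e : R, 0 < e & forall w, 0 < w < e -> resolvent phi w).
Proof.
move=> dphi AE hb; have mphi := measurable_decreasing dphi.
have [C C0 hC] := sin_decay dphi hb.
pose th x := phi x - A.
have phiE : phi = (fun t => A + th t) by apply/funext => t; rewrite /th addrC subrK.
have mth : measurable_fun D th by apply: measurable_funB.
have [ls [B B0 hB]] := inverse0_bounded mth C0 hC.
pose sg x := sin (th x).
have cosE : (fun x => cos (phi x)) = sg.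
  apply/funext => x; rewrite (_ : phi x = A + th x); last by rewrite /th addrC subrK.
  rewrite AE cosD cosN sinN cos_pihalf sin_pihalf /sg; ring.
have volE G x : L2 D G -> volterra phi G x = volterra th G x.
  by move=> lG; rewrite [X in volterra X]phiE volterra_shift//; exact: L2_loc_int.
rewrite cosE; split => // ss0.
set ss := nsq sg in ss0 *.
have {ss0}ss0 : 0 < ss by rewrite lt_neqAle eq_sym ss0 nsq_ge0.
pose pr f := ip D sg f / ss.
(* The projection onto [sg] may be subtracted since multiples of cos phi solve the homogeneous
   equation with its boundary condition, and this does not increase the norm. *)
pose K G x := inverse0 th G x - pr (inverse0 th G) * sg x.
(* The pointwise bound determines this constant: both terms come from (a - b)^2 <= 2 a^2 + 2 b^2,
   the second one for the subtracted projection. *)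
pose B' := 2 * B + 2 * B / ss.
have BB' : B <= B'.
  have : 0 <= 2 * B / ss by rewrite divr_ge0 ?mulr_ge0// ltW.
  by rewrite /B'; move: B0; clra.
have B'0 : 0 <= B' by exact: le_trans BB'.
have hI G : L2 D G -> L2 D (inverse0 th G) by move=> lG; have [] := hB G lG.
have proj f : L2 D f -> nsq (fun x => f x - pr f * sg x) = nsq f - ip D sg f ^+ 2 / ss.
  move=> lf; rewrite (nsqB mD lf (L2Z mD (pr f) ls)) (nsqZ mD (pr f) ls) (ipZr mD (pr f) ls lf).
  by rewrite (ipC D f) -/ss /pr; field; rewrite gt_eqF.
have sg_proj f : L2 D f -> ip D sg (fun x => f x - pr f * sg x) = 0.
  move=> lf; rewrite (ipBr mD lf (L2Z mD (pr f) ls) ls) (ipZr mD (pr f) ls ls) -/ss /pr.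
  by rewrite divfK ?subrr// gt_eqF.
have CSs f : L2 D f -> ip D sg f ^+ 2 / ss <= nsq f.
  move=> lf; rewrite ler_pdivrMr// mulrC; exact: (ip_CauchySchwarz mD ls lf).
have hK G : L2 D G -> [/\ L2 D (K G), nsq (K G) <= B' * nsq G &
    forall x, 0 < x -> K G x ^+ 2 <= B' * nsq G].
  move=> lG; have [lI nI pI] := hB G lG; have G0 := nsq_ge0 D G.
  split; first exact: (L2B mD lI (L2Z mD (pr (inverse0 th G)) ls)).
    rewrite (proj _ lI); apply: (@le_trans _ _ (B * nsq G)); last exact: ler_wpM2r.
    apply: le_trans nI; rewrite gerBl divr_ge0 ?sqr_ge0// ltW//.
  move=> x x0; have sg1 : sg x ^+ 2 <= 1.
    by rewrite -[leLHS]real_normK ?num_real// exprn_ile1// ler_norm_sin.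
  have p2 : pr (inverse0 th G) ^+ 2 <= B * nsq G / ss.
    rewrite /pr expr_div_n; have := CSs _ lI => h.
    have -> : ip D sg (inverse0 th G) ^+ 2 / ss ^+ 2 = ip D sg (inverse0 th G) ^+ 2 / ss / ss.
      by field; rewrite gt_eqF.
    by rewrite ler_pM2r ?invr_gt0//; exact: le_trans nI.
  have h1 := pI x x0.
  have h2 : (pr (inverse0 th G) * sg x) ^+ 2 <= B * nsq G / ss.
    by rewrite exprMn; apply: le_trans p2; rewrite ler_piMr// sqr_ge0.
  rewrite /K /B' mulrDl.
  have -> : 2 * B / ss * nsq G = 2 * (B * nsq G / ss) by ring.
  have fin (a b p q : R) : a ^+ 2 <= p -> b ^+ 2 <= q -> (a - b) ^+ 2 <= 2 * p + 2 * q.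
    by have := sqr_ge0 (a + b); rewrite !expr2; clra.
  by rewrite -mulrA; exact: fin.
have invL F G (k : R) : L2 D F -> L2 D G -> inverse0 th (fun t => F t + k * G t) =
    (fun x => inverse0 th F x + k * inverse0 th G x).
  move=> lF lG; apply/funext => x.
  by rewrite (inverse0D x mth ls lF (L2Z mD k lG)) (inverse0Z k x mth ls lG).
have prL f g (k : R) : L2 D f -> L2 D g -> pr (fun x => f x + k * g x) = pr f + k * pr g.
  move=> lf lg; rewrite /pr (ipDr mD lf (L2Z mD k lg) ls) (ipZr mD k lg ls).
  by rewrite mulrDl mulrA.
have KL F G (k : R) x : L2 D F -> L2 D G ->
    K (fun t => F t + k * G t) x = K F x + k * K G x.
  move=> lF lG; rewrite /K (invL F G k lF lG) (prL _ _ k (hI F lF) (hI G lG)).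
  move: (inverse0 th F x) (inverse0 th G x) (pr (inverse0 th F)) (pr (inverse0 th G)).
  by move: (sg x) => *; ring.
have KB F G x : L2 D F -> L2 D G -> K (fun t => F t - G t) x = K F x - K G x.
  move=> lF lG; rewrite -[RHS]/(K F x + - K G x) -mulN1r -(KL F G (-1) x lF lG).
  by congr (K _ x); apply/funext => t; rewrite mulN1r.
have b0 : 0 < 4 * (B' + 1) by rewrite mulr_gt0// ltr_wpDl.
exists (4 * (B' + 1))^-1; first by rewrite invr_gt0.
move=> w /andP[w0 we].
(* Weakened to 1/4 this makes the Neumann series converge; as it stands it absorbs the term with
   [K G] in the bound for [G]. *)
have wB : w ^+ 2 * B' <= 16^-1.
  have w1 : w * (4 * (B' + 1)) <= 1.
    by rewrite -ler_pdivlMr// div1r ltW.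
  have w2 : 0 <= w * (4 * (B' + 1)) by rewrite mulr_ge0 ?ltW.
  have h1 : (w * (4 * (B' + 1))) ^+ 2 <= 1 by rewrite exprn_ile1.
  have h2 : B' <= (B' + 1) ^+ 2.
    have -> : (B' + 1) ^+ 2 = B' ^+ 2 + B' + B' + 1 by ring.
    have fin (b q : R) : 0 <= b -> 0 <= q -> b <= q + b + b + 1 by clra.
    exact: fin (sqr_ge0 _).
  have h3 := ler_wpM2l (sqr_ge0 w) h2.
  have e1 : (w * (4 * (B' + 1))) ^+ 2 = 16 * (w ^+ 2 * (B' + 1) ^+ 2) by ring.
  rewrite e1 in h1; move: h1 h3; move: (w ^+ 2 * B') (w ^+ 2 * _); clra.
have wB4 : w ^+ 2 * B' <= 4^-1.
  by apply: (le_trans wB); rewrite lef_pV2 ?posrE// ler_nat.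
have wn0 : w != 0 by rewrite gt_eqF.
split.
  move=> h ch; have [lh _] := ch.
  (* [h] splits into a multiple of [sg], on which S - w acts as -w, and [h1], orthogonal to [sg].
     For the latter the equation is F1 = K (h1 + w F1), the fixed point problem of [neumann]. *)
  pose h1 x := h x - pr h * sg x.
  have lh1 : L2 D h1 by exact: (L2B mD lh (L2Z mD (pr h) ls)).
  have [lu _ _] := hK _ lh1.
  have [F1 lF1 hF1] := neumann B'0 wB4 KB hK lu.
  pose G x := h1 x + w * F1 x.
  have lG : L2 D G by exact: (L2D mD lh1 (L2Z mD w lF1)).
  have KG x : 0 < x -> F1 x = K G x.
    by move=> x0; rewrite hF1// -(KL h1 F1 w x lh1 lF1).
  have sK : ip D sg F1 = 0.
    have [lK _ _] := hK _ lG.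
    rewrite -(sg_proj _ (hI G lG)); apply: eq_ip => x // .
    by rewrite half_lineE => x0; rewrite KG.
  (* Orthogonality to [sg] removes the term at infinity from [inverse0], and [F] gets the form
     required by [rel]. *)
  have sG : ip D sg G = 0.
    rewrite /G (ipDr mD lh1 (L2Z mD w lF1) ls) (ipZr mD w lF1 ls) sK mulr0 addr0.
    exact: sg_proj.
  pose F x := F1 x - pr h / w * sg x.
  have lF : L2 D F by exact: (L2B mD lF1 (L2Z mD (pr h / w) ls)).
  have relFG : rel phi F G.
    split => //; exists (- pr (inverse0 th G) - pr h / w).
    apply: aeW => x x0; rewrite volE// /F KG// /K {1}/inverse0 -/sg sG mulr0 addr0.
    by rewrite (congr1 (fun f => f x) cosE); ring.
  have GE : G = (fun x => h x + w * F x).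
    by apply/funext => x; rewrite /G /F /h1; field.
  exists F, G; split.
    split=> //; rewrite GE; exact: (clD mphi ch (clZ mphi w (rel_cl relFG))).
  by apply: aeW => x x0; rewrite GE addrK.
exists (2 / w ^+ 2 + 32 * B') => F G [[lF lG [c hc]] _].
have hF : {ae mu, forall x : R, 0 < x -> F x = c * sg x + volterra th G x}.
  apply: aeS hc => x h x0; rewrite h// volE//.
  by rewrite (congr1 (fun f => f x) cosE).
(* The range is orthogonal to the kernel: otherwise a nonzero multiple of cos theta would be square
   integrable, although cos theta tends to 1. *)
have sG : ip D sg G = 0.
  apply/eqP; apply: contraT => sG0.
  have lk : L2 D (fun x => ip D sg G * cos (th x)).
    have hae : {ae mu, forall x : R, 0 < x ->
        (c * sg x + inverse0 th G x) - F x = ip D sg G * cos (th x)}.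
      by apply: aeS hF => x h x0; rewrite h// /inverse0 -/sg; ring.
    apply: L2_ae_eq hae.
      exact: (L2B mD (L2D mD (L2Z mD c ls) (hI G lG)) lF).
    by apply: measurable_funM => //; exact: measurable_cos_fun.
  have lim_th : th x @[x --> +oo] --> 0.
    have [_ lim_phi _ _] := dphi; rewrite -(subrr A).
    by apply: cvgB => //; exact: cvg_cst.
  have g1 : 2^-1 < cos 0 :> R by rewrite cos0 invf_lt1// ltr1n.
  have [a a0 ha] := cos_eventually_ge lim_th g1.
  have g0 : 0 < `|ip D sg G| / 2 by rewrite divr_gt0// normr_gt0.
  case: (L2_not_bounded_below lk g0 a0) => x ax.
  rewrite normrM; apply: ler_wpM2l => //.
  by apply: (le_trans (ha x ax)); exact: ler_norm.
have [lK nK _] := hK _ lG.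
pose c' := c + pr (inverse0 th G).
have FK : {ae mu, forall x : R, D x -> F x = c' * sg x + K G x}.
  apply: aeS (ae_half_line hF) => x h Dx; rewrite h// /K /c' {2}/inverse0 -/sg sG.
  by ring.
have lcs := L2Z mD c' ls.
pose H x := G x - w * F x.
have lH : L2 D H by exact: (L2B mD lG (L2Z mD w lF)).
have sK : ip D sg (K G) = 0 by exact: sg_proj (hI G lG).
have sF : ip D sg F = c' * ss.
  rewrite (ipC D sg F) (ae_eq_ip mD lF (L2D mD lcs lK) ls FK).
  by rewrite (ipDl mD lcs lK ls) (ipZl mD c' ls ls) (ipC D (K G) sg) sK addr0.
have sH : ip D sg H = - w * c' * ss.
  rewrite /H (ipBr mD lG (L2Z mD w lF) ls) (ipZr mD w lF ls) sG sF; ring.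
have cs2 : w ^+ 2 * (c' ^+ 2 * ss) <= nsq H.
  apply: le_trans (CSs H lH); rewrite sH le_eqVlt; apply/orP; left; apply/eqP.
  by field; rewrite gt_eqF.
have nFle : nsq F <= 2 * (c' ^+ 2 * ss) + 2 * nsq (K G).
  rewrite (ae_eq_nsq mD lF (L2D mD lcs lK) FK).
  by apply: (le_trans (nsqD_le mD lcs lK)); rewrite (nsqZ mD c' ls).
(* G = H + w c' sg + w K G: the last term is absorbed, and the middle one is bounded through the
   component of [H] along [sg], by [cs2]. *)
have nGle : nsq G <= 16 * nsq H.
  have lX := L2D mD lH (L2Z mD (w * c') ls); have lY := L2Z mD w lK.
  have GE : {ae mu, forall x : R, D x -> G x = (H x + w * c' * sg x) + w * K G x}.
    by apply: aeS FK => x h Dx; rewrite /H h//; ring.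
  have e1 : nsq G <= 2 * nsq (fun x => H x + w * c' * sg x) + 2 * (w ^+ 2 * nsq (K G)).
    rewrite {1}(ae_eq_nsq mD lG (L2D mD lX lY) GE).
    by apply: (le_trans (nsqD_le mD lX lY)); rewrite (nsqZ mD w lK).
  have e2 := nsqD_le mD lH (L2Z mD (w * c') ls).
  rewrite (nsqZ mD _ ls) exprMn -/ss in e2.
  have e3 : w ^+ 2 * nsq (K G) <= 16^-1 * nsq G.
    apply: (@le_trans _ _ (w ^+ 2 * B' * nsq G)).
      by rewrite -mulrA; apply: ler_wpM2l => //; exact: sqr_ge0.
    by apply: ler_wpM2r => //; exact: nsq_ge0.
  have fin (g h x y k : R) : g <= 2 * x + 2 * k -> x <= 2 * h + 2 * y ->
    k <= 16^-1 * g -> y <= h -> 0 <= h -> g <= 16 * h by clra.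
  by rewrite -mulrA in e2; exact: fin e1 e2 e3 cs2 (nsq_ge0 D H).
have w20 : 0 < w ^+ 2 by rewrite exprn_gt0.
have e5 : 2 * (c' ^+ 2 * ss) <= 2 / w ^+ 2 * nsq H.
  rewrite -mulrA ler_pM2l// ler_pdivlMl//.
have e6 : nsq (K G) <= B' * (16 * nsq H).
  by apply: (le_trans nK); exact: ler_wpM2l.
have fin (f k a b h B1 : R) : f <= a + 2 * k -> a <= b -> k <= B1 * (16 * h) ->
  f <= b + 32 * B1 * h by clra.
by rewrite mulrDl; exact: fin nFle e5 e6.
Qed.

End sufficiency.

(** * Transfer between the complex matrix setting and the scalar model *)

Section transfer.
Context {R : realType}.
Local Notation mu := (@lebesgue_measure R).
Local Notation D := (@half_line R).
Local Notation nsq F := (ip D F F).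
Local Notation Re := (@complex.Re R).
Local Notation Im := (@complex.Im R).
Local Open Scope complex_scope.

Variables (H : R -> 'M[R]_2) (phi : R -> R).
Hypothesis HH : coefficient_function H.
Hypothesis mphi : measurable_fun D phi.
Hypothesis Hphi : {ae mu, forall x : R, 0 < x -> H x = projP (phi x)}.
Implicit Types f g : R -> 'cV[R[i]]_2.

(* [comp Re f] and [comp Im f] are the real and imaginary parts of the scalar
   function <e_phi, f> that represents f in L^2. *)
Definition comp (P : R[i] -> R) f (x : R) : R :=
  cos (phi x) * P (f x 0 0) + sin (phi x) * P (f x 1 0).

(** The lift (F1 + i F2) e_phi, a section of the pair [comp Re], [comp Im]; it turns scalar data
    into elements of L^2_H. *)
Definition vect (F1 F2 : R -> R) (x : R) : 'cV[R[i]]_2 :=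
  \col_i (if i == 0 then (cos (phi x) * F1 x) +i* (cos (phi x) * F2 x)
          else (sin (phi x) * F1 x) +i* (sin (phi x) * F2 x)).

Lemma comp_vect F1 F2 : comp Re (vect F1 F2) = F1 /\ comp Im (vect F1 F2) = F2.
Proof.
have h x (a : R) :
    cos (phi x) * (cos (phi x) * a) + sin (phi x) * (sin (phi x) * a) = a.
  by rewrite -[RHS]mul1r -(cos2Dsin2 (phi x)); ring.
by split; apply/funext => x; rewrite /comp !mxE /= !h.
Qed.

Lemma HformE f x : Hform H f x = \sum_i \sum_j
  H x i j * (Re (f x i 0) * Re (f x j 0) + Im (f x i 0) * Im (f x j 0)).
Proof.
rewrite /Hform -mulmxA !mxE !big_ord_recl !big_ord0 !mxE !big_ord_recl !big_ord0 !mxE.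
rewrite !addr0.
case: (f x _ _) => a1 b1; case: (f x _ _) => a2 b2 /=; ring.
Qed.

Lemma HformP f x : H x = projP (phi x) ->
  Hform H f x = comp Re f x ^+ 2 + comp Im f x ^+ 2.
Proof.
move=> Hx; rewrite HformE Hx !big_ord_recl !big_ord0 /projP !mxE !big_ord_recl !big_ord0 !mxE.
have -> : lift (ord0 : 'I_2) (ord0 : 'I_1) = 1 by apply/val_inj.
by rewrite /= /comp !addr0; ring.
Qed.

Definition mvec f := (forall i, measurable_fun D (fun x => Re (f x i 0))) /\
  (forall i, measurable_fun D (fun x => Im (f x i 0))).

Lemma measurable_comp f : mvec f ->
  measurable_fun D (comp Re f) /\ measurable_fun D (comp Im f).
Proof.
have mc := measurable_cos_fun mphi; have ms := measurable_sin_fun mphi.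
by move=> [mr mi]; split; apply: measurable_funD; apply: measurable_funM.
Qed.

Lemma measurable_Hform f : mvec f -> measurable_fun D (Hform H f).
Proof.
move=> [mr mi]; have [mH _ _] := HH.
have -> : Hform H f = (fun x =>
    H x 0 0 * (Re (f x 0 0) * Re (f x 0 0) + Im (f x 0 0) * Im (f x 0 0)) +
    H x 0 1 * (Re (f x 0 0) * Re (f x 1 0) + Im (f x 0 0) * Im (f x 1 0)) +
   (H x 1 0 * (Re (f x 1 0) * Re (f x 0 0) + Im (f x 1 0) * Im (f x 0 0)) +
    H x 1 1 * (Re (f x 1 0) * Re (f x 1 0) + Im (f x 1 0) * Im (f x 1 0)))).
  apply/funext => x; rewrite HformE !big_ord_recl !big_ord0 !addr0.
  by have -> : lift (ord0 : 'I_2) (ord0 : 'I_1) = 1 by apply/val_inj.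
by repeat (apply: measurable_funD || apply: measurable_funM).
Qed.

Lemma Hint_comp f : mvec f -> Hint H f =
  (\int[mu]_(x in D) (comp Re f x * comp Re f x + comp Im f x * comp Im f x)%:E)%E.
Proof.
move=> mf; have [m1 m2] := measurable_comp mf.
apply: ae_eq_integral; first exact: mD.
- by apply/measurable_EFinP; exact: measurable_Hform.
- by apply/measurable_EFinP; apply: measurable_funD; exact: measurable_funM.
- apply: aeS Hphi => x h; rewrite half_lineE => x0.
  by rewrite HformP ?h// !expr2.
Qed.

Lemma L2HE f : L2H H f <-> [/\ mvec f, L2 D (comp Re f) & L2 D (comp Im f)].
Proof.
split=> [[mr mi]|[mf l1 l2]].
  have mf : mvec f by split.
  have [m1 m2] := measurable_comp mf; rewrite Hint_comp// => fin.
  have i12 : mu.-integrable D (EFin \o (fun x =>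
      comp Re f x * comp Re f x + comp Im f x * comp Im f x)).
    apply/integrableP; split.
      by apply/measurable_EFinP; apply: measurable_funD; exact: measurable_funM.
    apply: le_lt_trans fin; rewrite le_eqVlt; apply/orP; left; apply/eqP.
    apply: eq_integral => x _; rewrite /= ger0_norm// addr_ge0// -expr2 sqr_ge0//.
  split=> //; split=> //; apply: (le_measurable_integrable mD _ i12).
  - exact: measurable_funX.
  - by move=> x _; rewrite ger0_norm ?sqr_ge0// expr2 lerDl -expr2 sqr_ge0.
  - exact: measurable_funX.
  - by move=> x _; rewrite ger0_norm ?sqr_ge0// expr2 lerDr -expr2 sqr_ge0.
have [mr mi] := mf; split => //; rewrite Hint_comp//.
have i1 := L2_integrableM mD l1 l1; have i2 := L2_integrableM mD l2 l2.
have := integrableD mD i1 i2 => /(integrable_fin_num mD).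
by rewrite fin_numElt => /andP[].
Qed.

Lemma Hint_nsq f : L2H H f -> Hint H f = (nsq (comp Re f) + nsq (comp Im f))%:E.
Proof.
move=> /L2HE[mf l1 l2]; rewrite Hint_comp//.
have i1 := L2_integrableM mD l1 l1; have i2 := L2_integrableM mD l2 l2.
rewrite /ip -(RintegralD mD i1 i2) /Rintegral fineK//.
by have := integrableD mD i1 i2 => /(integrable_fin_num mD).
Qed.

Lemma L2H_normE f : L2H H f ->
  L2H_norm H f = Num.sqrt (nsq (comp Re f) + nsq (comp Im f)).
Proof. by move=> lf; rewrite /L2H_norm Hint_nsq. Qed.

Lemma comp_sub (P : R[i] -> R) f g (w : R) : P = Re \/ P = Im ->
  comp P (fun x => f x - w%:C *: g x) = (fun x => comp P f x - w * comp P g x).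
Proof.
move=> hP; apply/funext => x; rewrite /comp !mxE.
case: (f x 0 0) => a b; case: (f x 1 0) => c d; case: (g x 0 0) => a' b'.
by case: hP => ->; case: (g x 1 0) => c' d' /=; ring.
Qed.

Let compB (P : R[i] -> R) f g : P = Re \/ P = Im ->
  comp P (fun x => f x - 1%:C *: g x) = (fun x => comp P f x - comp P g x).
Proof. by move=> /comp_sub ->; apply/funext => x; rewrite mul1r. Qed.

Lemma L2H_sub f g (w : R) : L2H H f -> L2H H g -> L2H H (fun x => f x - w%:C *: g x).
Proof.
move=> /L2HE[[mr mi] l1 l2] /L2HE[[mr' mi'] l1' l2']; apply/L2HE; split.
- split=> i.
    have -> : (fun x => Re ((f x - w%:C *: g x) i 0)) =
        (fun x => Re (f x i 0) - w * Re (g x i 0)).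
      apply/funext => x; rewrite !mxE; case: (f x i 0) => a b.
      by case: (g x i 0) => a' b' /=; ring.
    by apply: measurable_funB => //; exact: measurable_funM.
  have -> : (fun x => Im ((f x - w%:C *: g x) i 0)) =
      (fun x => Im (f x i 0) - w * Im (g x i 0)).
    apply/funext => x; rewrite !mxE; case: (f x i 0) => a b.
    by case: (g x i 0) => a' b' /=; ring.
  by apply: measurable_funB => //; exact: measurable_funM.
- by rewrite comp_sub; [exact: (L2B mD l1 (L2Z mD w l1'))|left].
- by rewrite comp_sub; [exact: (L2B mD l2 (L2Z mD w l2'))|right].
Qed.

Lemma sub_scale1 f g : (fun x => f x - g x) = (fun x => f x - (1 : R)%:C *: g x).
Proof. by apply/funext => x; rewrite scale1r. Qed.

Lemma L2H_eqE f g : L2H H f -> L2H H g -> L2H_eq H f g <->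
  {ae mu, forall x : R, 0 < x -> comp Re f x = comp Re g x} /\
  {ae mu, forall x : R, 0 < x -> comp Im f x = comp Im g x}.
Proof.
move=> lf lg; rewrite /L2H_eq sub_scale1.
have ls := L2H_sub 1 lf lg; have /L2HE[_ l1 l2] := ls.
rewrite Hint_nsq//; move: l1 l2; rewrite !compB; try by [left|right].
move=> l1 l2; split=> [[] /eqP|[h1 h2]].
  rewrite paddr_eq0 ?nsq_ge0// => /andP[/eqP z1 /eqP z2].
  by split; [apply: aeS (nsq_eq0 mD l1 z1)|apply: aeS (nsq_eq0 mD l2 z2)] => x + x0;
    rewrite half_lineE => /(_ x0)/eqP; rewrite subr_eq0 => /eqP.
rewrite (ae_eq0_nsq mD l1) ?(ae_eq0_nsq mD l2) ?addr0//.
  by apply: aeS (ae_half_line h2) => x h Dx; rewrite h// subrr.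
by apply: aeS (ae_half_line h1) => x h Dx; rewrite h// subrr.
Qed.

Lemma ord2P (i : 'I_2) : i = 0 \/ i = 1.
Proof. by case: i => [[|[|]]] // h; [left|right]; exact: val_inj. Qed.

Lemma L2H_vect F1 F2 : L2 D F1 -> L2 D F2 -> L2H H (vect F1 F2).
Proof.
move=> l1 l2; have mc := measurable_cos_fun mphi; have ms := measurable_sin_fun mphi.
apply/L2HE; split.
- split=> i; under eq_fun do rewrite mxE.
    by have [->|->] := ord2P i; apply: measurable_funM => //; exact: l1.1.
  by have [->|->] := ord2P i; apply: measurable_funM => //; exact: l2.1.
- by have [-> _] := comp_vect F1 F2.
- by have [_ ->] := comp_vect F1 F2.
Qed.

(** Since J^2 = -1, the equation says d = J P_a v, that is, [d] is <e_a, v> times J e_a = (- sin a,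
    cos a). *)
Lemma J_eq (a : R) (v d : 'cV[R[i]]_2) :
  Jmx R[i] *m d = - (toC (projP a) *m v) <->
  [/\ Re (d 0 0) = - (sin a * (cos a * Re (v 0 0) + sin a * Re (v 1 0))),
      Im (d 0 0) = - (sin a * (cos a * Im (v 0 0) + sin a * Im (v 1 0))),
      Re (d 1 0) = cos a * (cos a * Re (v 0 0) + sin a * Re (v 1 0)) &
      Im (d 1 0) = cos a * (cos a * Im (v 0 0) + sin a * Im (v 1 0))].
Proof.
have e1 : (Jmx R[i] *m d) 0 0 = - d 1 0.
  rewrite mxE !big_ord_recl big_ord0 !mxE /=.
  have -> : lift (ord0 : 'I_2) (ord0 : 'I_1) = 1 by apply/val_inj.
  by rewrite /=; ring.
have e2 : (Jmx R[i] *m d) 1 0 = d 0 0.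
  rewrite mxE !big_ord_recl big_ord0 !mxE /=.
  have -> : lift (ord0 : 'I_2) (ord0 : 'I_1) = 1 by apply/val_inj.
  by rewrite /=; ring.
have g1 : (- (toC (projP a) *m v)) 0 0 =
    - ((cos a * cos a)%:C * v 0 0 + (cos a * sin a)%:C * v 1 0).
  rewrite mxE mxE !big_ord_recl big_ord0.
  have -> : lift (ord0 : 'I_2) (ord0 : 'I_1) = 1 by apply/val_inj.
  by rewrite !mxE !big_ord_recl !big_ord0 !mxE /= !addr0 ?mulr0 ?addr0 ?rmorphM.
have g2 : (- (toC (projP a) *m v)) 1 0 =
    - ((sin a * cos a)%:C * v 0 0 + (sin a * sin a)%:C * v 1 0).
  rewrite mxE mxE !big_ord_recl big_ord0.
  have -> : lift (ord0 : 'I_2) (ord0 : 'I_1) = 1 by apply/val_inj.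
  by rewrite !mxE !big_ord_recl !big_ord0 !mxE /= !addr0 ?mulr0 ?addr0 ?rmorphM.
split=> [h|[h1 h2 h3 h4]].
  have := congr1 (fun M : 'cV[R[i]]_2 => M 0 0) h; rewrite /= e1 g1 => /oppr_inj E1.
  have := congr1 (fun M : 'cV[R[i]]_2 => M 1 0) h; rewrite /= e2 g2 => E2.
  rewrite E1 E2; case: (v 0 0) => a1 b1; case: (v 1 0) => a2 b2 /=.
  by split; ring.
apply/matrixP => i j; rewrite (ord1 j); have [->|->] := ord2P i.
  rewrite e1 g1; congr (- _); move: h3 h4; case: (d 1 0) => x y /= -> ->.
  by case: (v 0 0) => a1 b1; case: (v 1 0) => a2 b2; apply/eqP;
    rewrite eq_complex /=; apply/andP; split; apply/eqP; ring.
rewrite e2 g2; move: h1 h2; case: (d 0 0) => x y /= -> ->.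
by case: (v 0 0) => a1 b1; case: (v 1 0) => a2 b2; apply/eqP;
    rewrite eq_complex /=; apply/andP; split; apply/eqP; ring.
Qed.

(** Integrating the system: the second component is the integral of cos phi G, starting from 0, and
    the first is its initial value minus the integral of sin phi G. The free initial value is the
    constant [c] of [rel]. *)
Lemma rel_of_solution (P : R[i] -> R) (u0 u1 G F : R -> R) : L2 D F -> L2 D G ->
  (forall b : R, abs_cont 0 b u0) -> (forall b : R, abs_cont 0 b u1) -> u1 0 = 0 ->
  {ae mu, forall x : R, 0 < x -> is_derive x 1 u0 (- (sin (phi x) * G x)) /\
                               is_derive x 1 u1 (cos (phi x) * G x)} ->
  {ae mu, forall x : R, 0 < x -> F x = cos (phi x) * u0 x + sin (phi x) * u1 x} ->
  rel phi F G.
Proof.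
move=> lF lG ac0 ac1 u10 du FE; split => //; exists (u0 0).
have lc := loc_int_cosM mphi (L2_loc_int lG).
have ls := loc_int_sinM mphi (L2_loc_int lG).
have lms : loc_int (fun t => -1 * (sin (phi t) * G t)) by exact: loc_intZ.
apply: aeS FE => x h x0; rewrite h//.
have e1 : u1 x = prim (fun t => cos (phi t) * G t) x.
  rewrite (abs_cont_prim (ltW x0) (ac1 x) lc) ?u10 ?add0r//.
  by apply: aeS du => t ht /andP[/ht[]].
have e0 : u0 x = u0 0 - prim (fun t => sin (phi t) * G t) x.
  rewrite (abs_cont_prim (ltW x0) (ac0 x) lms) ?primZ// ?mulN1r//.
  by apply: aeS du => t ht /andP[/ht[h1 _] _]; rewrite mulN1r.
by rewrite e0 e1 /volterra; ring.
Qed.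

(** As [H] is real, the equation splits into real and imaginary parts, each of them a scalar
    relation. *)
Lemma relSE f g : relS H f g <-> [/\ L2H H f, L2H H g,
  rel phi (comp Re f) (comp Re g) & rel phi (comp Im f) (comp Im g)].
Proof.
split.
  move=> [lf lg [f0 [[lf0 ff0] ac du f00]]]; split=> //.
    have /L2HE[_ l1 l2] := lf; have /L2HE[_ l1' l2'] := lg.
    have [h1 h2] := (L2H_eqE lf lf0).1 ff0.
    apply: (@rel_of_solution Re (fun x => Re (f0 x 0 0)) (fun x => Re (f0 x 1 0))) => //.
    - by move=> b; have [] := ac b 0.
    - by move=> b; have [] := ac b 1.
    - by rewrite f00.
    - apply: aeS2 du Hphi => x hx Hx x0; have [d hd] := hx x0.
      rewrite Hx// => /J_eq[q1 _ q3 _].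
      by have [d0 _] := hd 0; have [d1 _] := hd 1; rewrite q1 in d0; rewrite q3 in d1.
  have /L2HE[_ l1 l2] := lf; have /L2HE[_ l1' l2'] := lg.
  have [h1 h2] := (L2H_eqE lf lf0).1 ff0.
  apply: (@rel_of_solution Im (fun x => Im (f0 x 0 0)) (fun x => Im (f0 x 1 0))) => //.
  - by move=> b; have [] := ac b 0.
  - by move=> b; have [] := ac b 1.
  - by rewrite f00.
  - apply: aeS2 du Hphi => x hx Hx x0; have [d hd] := hx x0.
    rewrite Hx// => /J_eq[_ q2 _ q4].
    by have [_ d0] := hd 0; have [_ d1] := hd 1; rewrite q2 in d0; rewrite q4 in d1.
move=> [lf lg [_ _ [c1 h1]] [_ _ [c2 h2]]]; split=> //.
have /L2HE[_ l1 l2] := lf; have /L2HE[_ l1' l2'] := lg.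
set G1 := comp Re g in h1 l1'; set G2 := comp Im g in h2 l2'.
pose s1 := prim (fun t => -1 * (sin (phi t) * G1 t)).
pose s2 := prim (fun t => -1 * (sin (phi t) * G2 t)).
pose p1 := prim (fun t => cos (phi t) * G1 t).
pose p2 := prim (fun t => cos (phi t) * G2 t).
have lc1 := loc_int_cosM mphi (L2_loc_int l1'); have lc2 := loc_int_cosM mphi (L2_loc_int l2').
have ls1 := loc_int_sinM mphi (L2_loc_int l1'); have ls2 := loc_int_sinM mphi (L2_loc_int l2').
have lms1 : loc_int (fun t => -1 * (sin (phi t) * G1 t)) by exact: loc_intZ.
have lms2 : loc_int (fun t => -1 * (sin (phi t) * G2 t)) by exact: loc_intZ.
(* The vector solution with initial values [c1], [c2] in the first component. It need agree with [f]
   only along e_phi, which is all that L^2_H sees. *)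
pose f0 x : 'cV[R[i]]_2 := \col_i (if i == 0 then (c1 + s1 x) +i* (c2 + s2 x)
                                    else p1 x +i* p2 x).
have f0E x : [/\ Re (f0 x 0 0) = c1 + s1 x, Im (f0 x 0 0) = c2 + s2 x,
    Re (f0 x 1 0) = p1 x & Im (f0 x 1 0) = p2 x] by rewrite !mxE.
have E1 : (fun x => Re (f0 x 0 0)) = (fun x => c1 + s1 x) by apply/funext => x; case: (f0E x).
have E2 : (fun x => Im (f0 x 0 0)) = (fun x => c2 + s2 x) by apply/funext => x; case: (f0E x).
have E3 : (fun x => Re (f0 x 1 0)) = p1 by apply/funext => x; case: (f0E x).
have E4 : (fun x => Im (f0 x 1 0)) = p2 by apply/funext => x; case: (f0E x).
have mf0 : mvec f0.
  split=> i; have [->|->] := ord2P i; rewrite ?E1 ?E2 ?E3 ?E4.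
  - by apply: measurable_funD => //; exact: measurable_prim.
  - exact: measurable_prim.
  - by apply: measurable_funD => //; exact: measurable_prim.
  - exact: measurable_prim.
have [m1 m2] := measurable_comp mf0.
have ae1 : {ae mu, forall x : R, 0 < x -> comp Re f x = comp Re f0 x}.
  apply: aeS h1 => x h x0; have [q1 q2 q3 q4] := f0E x; rewrite h// /comp q1 q3.
  by rewrite /s1 /p1 primZ// /volterra; ring.
have ae2 : {ae mu, forall x : R, 0 < x -> comp Im f x = comp Im f0 x}.
  apply: aeS h2 => x h x0; have [q1 q2 q3 q4] := f0E x; rewrite h// /comp q2 q4.
  by rewrite /s2 /p2 primZ// /volterra; ring.
have lf0 : L2H H f0.
  by apply/L2HE; split => //; [exact: L2_ae_eq l1 m1 ae1|exact: L2_ae_eq l2 m2 ae2].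
exists f0; split.
- by split=> //; apply/(L2H_eqE lf lf0).
- move=> b i; have ccst (c : R) s : abs_cont 0 b s -> abs_cont 0 b (fun x => c + s x).
    move=> ac e e0; have [d d0 hd] := ac e e0; exists d => // n u t ut disj lt.
    by under eq_bigr do rewrite opprD addrACA subrr add0r; exact: hd.
  have [->|->] := ord2P i; rewrite ?E1 ?E2 ?E3 ?E4; split.
  + by apply: ccst; exact: prim_abs_cont.
  + by apply: ccst; exact: prim_abs_cont.
  + exact: prim_abs_cont.
  + exact: prim_abs_cont.
- have d1 := prim_is_derive lms1; have d2 := prim_is_derive lms2.
  have d3 := prim_is_derive lc1; have d4 := prim_is_derive lc2.
  apply: aeS3 (aeS2 (fun x a b => conj a b) d1 d2) (aeS2 (fun x a b => conj a b) d3 d4) Hphi.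
  move=> x [D1 D2] [D3 D4] Hx x0.
  pose d : 'cV[R[i]]_2 := \col_i (if i == 0 then
     (-1 * (sin (phi x) * G1 x)) +i* (-1 * (sin (phi x) * G2 x))
     else (cos (phi x) * G1 x) +i* (cos (phi x) * G2 x)).
  exists d; last first.
    by rewrite Hx//; apply/J_eq; rewrite !mxE /= !mulN1r.
  have ccst (c l : R) s : is_derive x 1 s l -> is_derive x 1 (fun y => c + s y) l.
    by move=> ds; have := is_deriveD (is_derive_cst c x 1) ds; rewrite add0r.
  move=> i; have [->|->] := ord2P i; rewrite ?E1 ?E2 ?E3 ?E4 !mxE /=; split.
  + by apply: ccst; exact: D1.
  + by apply: ccst; exact: D2.
  + exact: D3.
  + exact: D4.
- by rewrite mxE /= /p1 /p2 !prim0.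
Qed.

Lemma ltr_L2H_norm_sub f h (e : R) : L2H H f -> L2H H h -> 0 < e ->
  (L2H_norm H (fun x => f x - h x) < e) =
  (nsq (fun x => comp Re f x - comp Re h x) +
   nsq (fun x => comp Im f x - comp Im h x) < e ^+ 2).
Proof.
move=> lf lh e0; rewrite sub_scale1 (L2H_normE (L2H_sub 1 lf lh)).
rewrite !compB; try by [left|right].
by rewrite -{1}(ger0_norm (ltW e0)) -sqrtr_sqr ltr_sqrt// exprn_gt0.
Qed.

Lemma domS_closureE f : domS_closure H f <->
  [/\ L2H H f, domain_closure phi (comp Re f) & domain_closure phi (comp Im f)].
Proof.
split=> [[lf hf]|[lf [l1 h1] [l2 h2]]].
  have /L2HE[_ l1 l2] := lf.
  have hf' e : 0 < e -> exists h k, relS H h k /\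
      nsq (fun x => comp Re f x - comp Re h x) +
      nsq (fun x => comp Im f x - comp Im h x) < e.
    move=> e0; have s0 : 0 < Num.sqrt e by rewrite sqrtr_gt0.
    have [h [k [hk he]]] := hf _ s0; exists h, k; split=> //.
    have [lh _ _] := hk; move: he; rewrite ltr_L2H_norm_sub//.
    by rewrite sqr_sqrtr// ltW.
  split=> //; split=> // e e0; have [h [k [/relSE[_ _ r1 r2] he]]] := hf' e e0.
    exists (comp Re h), (comp Re k); split=> //; apply: le_lt_trans he.
    by rewrite lerDl nsq_ge0.
  exists (comp Im h), (comp Im k); split=> //; apply: le_lt_trans he.
  by rewrite lerDr nsq_ge0.
split=> // e e0; have e2 : 0 < e ^+ 2 / 2 by rewrite divr_gt0// exprn_gt0.
have [F1 [G1 [r1 n1]]] := h1 _ e2; have [F2 [G2 [r2 n2]]] := h2 _ e2.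
have [lF1 lG1 _] := r1; have [lF2 lG2 _] := r2.
have lF := L2H_vect lF1 lF2; have lG := L2H_vect lG1 lG2.
have [c1 c2] := comp_vect F1 F2; have [c3 c4] := comp_vect G1 G2.
exists (vect F1 F2), (vect G1 G2); split.
  by apply/relSE; rewrite c1 c2 c3 c4.
by rewrite ltr_L2H_norm_sub// c1 c2 [ltRHS]splitr ltrD.
Qed.

Lemma opSE f g : opS H f g <-> [/\ L2H H f, L2H H g,
  op_graph phi (comp Re f) (comp Re g) & op_graph phi (comp Im f) (comp Im g)].
Proof.
split=> [[/relSE[lf lg r1 r2] _ /domS_closureE[_ k1 k2]]|[lf lg [r1 k1] [r2 k2]]].
  by split.
split; first exact/relSE.
  by apply/domS_closureE; split; [|exact: rel_cl r1|exact: rel_cl r2].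
exact/domS_closureE.
Qed.

Lemma opS_vect F1 G1 F2 G2 : op_graph phi F1 G1 -> op_graph phi F2 G2 ->
  opS H (vect F1 F2) (vect G1 G2).
Proof.
move=> o1 o2; have [[lF1 lG1 _] _] := o1; have [[lF2 lG2 _] _] := o2.
apply/opSE; have [-> ->] := comp_vect F1 F2; have [-> ->] := comp_vect G1 G2.
by split => //; exact: L2H_vect.
Qed.

Lemma L2H_norm_vect_sub F1 G1 F2 G2 (w : R) :
  L2 D F1 -> L2 D G1 -> L2 D F2 -> L2 D G2 ->
  L2H_norm H (fun x => vect G1 G2 x - w%:C *: vect F1 F2 x) =
  Num.sqrt (nsq (fun x => G1 x - w * F1 x) + nsq (fun x => G2 x - w * F2 x)).
Proof.
move=> lF1 lG1 lF2 lG2.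
rewrite (L2H_normE (L2H_sub w (L2H_vect lG1 lG2) (L2H_vect lF1 lF2))).
rewrite !comp_sub; try by [left|right].
by have [-> ->] := comp_vect F1 F2; have [-> ->] := comp_vect G1 G2.
Qed.

(** A scalar function is tested through its lift with zero imaginary part; conversely the two parts
    are solved separately. Scalar bounds concern squared norms, hence the constants M^2 and the
    square root of the maximum of M and 0. *)
Lemma resolvent_setE (w : R) : resolvent_set H w%:C <-> resolvent phi w.
Proof.
split=> [[surj [M hM]]|[surj [M hM]]]; split.
- move=> h hcl; have [c1 c2] := comp_vect h (fun=> 0).
  have [lh _] := hcl.
  have lvh : L2H H (vect h (fun=> 0)) by apply: L2H_vect => //; exact: L20 mD.
  have dh : domS_closure H (vect h (fun=> 0)).
    by apply/domS_closureE; rewrite c1 c2; split=> //; have [_] := (op0 phi).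
  have [f [g [/opSE[lf lg o1 _]]]] := surj _ dh.
  move=> /(L2H_eqE (L2H_sub w lg lf) lvh)[+ _].
  rewrite c1 comp_sub; last by left.
  by move=> hae; exists (comp Re f), (comp Re g).
- exists (M ^+ 2) => F G o; have := hM _ _ (opS_vect o (op0 phi)).
  have [[lF lG _] _] := o; have l0 : L2 D (fun=> 0 : R) := L20 mD.
  have -> : L2H_norm H (vect F (fun=> 0)) = Num.sqrt (nsq F).
    rewrite L2H_normE; last exact: L2H_vect.
    by have [-> ->] := comp_vect F (fun=> 0); rewrite nsq0 addr0.
  rewrite L2H_norm_vect_sub//.
  have -> : nsq (fun x => 0 - w * 0) = 0.
    by rewrite mulr0 subr0 nsq0.
  rewrite addr0 => h; have := lerXn2r 2 _ _ h.
  rewrite !nnegrE sqrtr_ge0 (le_trans _ h) ?sqrtr_ge0// => /(_ isT isT).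
  by rewrite exprMn !sqr_sqrtr// nsq_ge0.
- move=> h /domS_closureE[lh k1 k2].
  have [F1 [G1 [p1 e1]]] := surj _ k1; have [F2 [G2 [p2 e2]]] := surj _ k2.
  have oS := opS_vect p1 p2; have [[lf lg _] _ _] := oS.
  exists (vect F1 F2), (vect G1 G2); split=> //.
  apply/(L2H_eqE (L2H_sub w lg lf) lh).
  rewrite !comp_sub; try by [left|right].
  by have [-> ->] := comp_vect F1 F2; have [-> ->] := comp_vect G1 G2.
- exists (Num.sqrt (Num.max M 0)) => f g /opSE[lf lg o1 o2].
  rewrite (L2H_normE lf) (L2H_normE (L2H_sub w lg lf)).
  rewrite !comp_sub; try by [left|right].
  have m0 : 0 <= Num.max M 0 by rewrite le_max lexx orbT.
  have mM : M <= Num.max M 0 by rewrite le_max lexx.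
  rewrite -sqrtrM// ler_wsqrtr// mulrDr; apply: lerD.
    by apply: le_trans (hM _ _ o1) _; apply: ler_wpM2r => //; exact: nsq_ge0.
  by apply: le_trans (hM _ _ o2) _; apply: ler_wpM2r => //; exact: nsq_ge0.
Qed.

Local Notation cosphi := (fun x => cos (phi x)).

Lemma volterra_ae0 (G : R -> R) (x : R) : 0 < x -> measurable_fun D G ->
  {ae mu, forall x : R, 0 < x -> G x = 0} -> volterra phi G x = 0.
Proof.
move=> x0 mG G0; have pz (h : R -> R) : measurable_fun D h -> prim (fun t => h t * G t) x = 0.
  move=> mh; rewrite (@eq_prim_ae _ _ (fun=> 0)).
  - by rewrite prim_cst ?mul0r// ltW.
  - exact: measurable_funM.
  - exact: measurable_cst.
  - by apply: aeS G0 => t h0 t0; rewrite h0// mulr0.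
rewrite /volterra !pz ?mulr0 ?subrr//; [exact: measurable_sin_fun|exact: measurable_cos_fun].
Qed.

Lemma rel_kernel (F G : R -> R) : rel phi F G -> {ae mu, forall x : R, 0 < x -> G x = 0} ->
  exists c : R, {ae mu, forall x : R, 0 < x -> F x = c * cos (phi x)}.
Proof.
move=> [_ lG [c hc]] G0; exists c; apply: aeS hc => x h x0.
by rewrite h// volterra_ae0 ?addr0//; exact: lG.1.
Qed.

Lemma op_cos : L2 D cosphi -> op_graph phi cosphi (fun=> 0).
Proof.
move=> lc; split; last by have [] := (op0 phi).
split; [exact: lc|exact: L20 mD|exists 1; apply: aeW => x x0].
by rewrite mul1r volterra_ae0 ?addr0//; exact: aeW.
Qed.

Lemma eigenfunction0 f : is_eigenvector H 0 f ->
  [/\ L2H H f, ~ L2H_eq H f (fun=> 0) &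
  exists c1 c2 : R, {ae mu, forall x : R, 0 < x -> comp Re f x = c1 * cos (phi x)} /\
    {ae mu, forall x : R, 0 < x -> comp Im f x = c2 * cos (phi x)}].
Proof.
move=> [nz [g /opSE[lf lg [r1 _] [r2 _]] eg]].
have e0 : (fun x => (0 : R[i]) *: f x) = vect (fun=> 0) (fun=> 0).
  by apply/funext => x; rewrite scale0r; apply/matrixP => i j;
    rewrite !mxE !mulr0; case: ifP.
have l0 : L2H H (vect (fun=> 0) (fun=> 0)) by apply: L2H_vect; exact: L20 mD.
move: eg; rewrite e0 => /(L2H_eqE lg l0).
have [-> ->] := comp_vect (fun=> 0) (fun=> 0) => -[g1 g2].
have [c1 h1] := rel_kernel r1 g1; have [c2 h2] := rel_kernel r2 g2.
by split=> //; exists c1, c2.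
Qed.

(** The kernel of the relation consists of multiples of cos phi. The second condition excludes the
    angles with cos phi = 0 almost everywhere, where cos phi represents the zero element. *)
Lemma eigenvalue0E : is_eigenvalue H 0 <-> L2 D cosphi /\ nsq cosphi != 0.
Proof.
have l0 : L2 D (fun=> 0 : R) := L20 mD; have lv0 := L2H_vect l0 l0.
have e0 : (fun=> 0) = vect (fun=> 0) (fun=> 0).
  by apply/funext => x; apply/matrixP => i j; rewrite !mxE !mulr0; case: ifP.
have [v1 v2] := comp_vect (fun=> 0) (fun=> 0).
have mc : measurable_fun D cosphi by exact: measurable_cos_fun.
split=> [[f /eigenfunction0[lf nz [c1 [c2 [h1 h2]]]]]|[lc nz]].
  have /L2HE[_ l1 l2] := lf.
  have lcos c F : c != 0 -> L2 D F ->
      {ae mu, forall x : R, 0 < x -> F x = c * cos (phi x)} -> L2 D cosphi.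
    move=> c0 lF hF; apply: (L2_ae_eq (L2Z mD c^-1 lF)) => //.
    by apply: aeS hF => x h x0; rewrite h// mulKf.
  have lc : L2 D cosphi.
    have [c10|z] := eqVneq c1 0; last exact: lcos z l1 h1.
    have [c20|z] := eqVneq c2 0; last exact: lcos z l2 h2.
    case: nz; rewrite e0; apply/(L2H_eqE lf lv0); rewrite v1 v2.
    split; [apply: aeS h1 => x h x0|apply: aeS h2 => x h x0].
      by rewrite h// c10 mul0r.
    by rewrite h// c20 mul0r.
  split=> //; apply/eqP => /(nsq_eq0 mD lc) z; apply: nz.
  rewrite e0; apply/(L2H_eqE lf lv0); rewrite v1 v2.
  split; [apply: aeS2 z h1 => x z h x0|apply: aeS2 z h2 => x z h x0].
    by rewrite h// z ?half_lineE// mulr0.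
  by rewrite h// z ?half_lineE// mulr0.
have lv := L2H_vect lc l0.
exists (vect cosphi (fun=> 0)); split.
  rewrite e0 => /(L2H_eqE lv lv0)[+ _]; rewrite v1.
  have [-> _] := comp_vect cosphi (fun=> 0) => z.
  by move/eqP: nz; apply; apply: (ae_eq0_nsq mD lc); exact: ae_half_line.
exists (vect (fun=> 0) (fun=> 0)); first exact: opS_vect (op_cos lc) (op0 phi).
rewrite [X in L2H_eq _ _ X](_ : _ = vect (fun=> 0) (fun=> 0)).
  by apply/(L2H_eqE lv0 lv0); split; exact: aeW.
by apply/funext => x; rewrite scale0r -e0.
Qed.

Lemma finite_multiplicity0 : L2 D cosphi -> finite_multiplicity H 0.
Proof.
move=> lc; have lv := L2H_vect lc (L20 mD).
exists 1%N, (fun=> vect cosphi (fun=> 0)); split=> // f.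
move=> /eigenfunction0[lf _ [c1 [c2 [h1 h2]]]]; exists (fun=> c1 +i* c2).
have -> : (fun x => \sum_(k < 1) (c1 +i* c2) *: vect cosphi (fun=> 0) x) =
    vect (fun x => c1 * cos (phi x)) (fun x => c2 * cos (phi x)).
  apply/funext => x; rewrite big_ord1; apply/matrixP => i j; rewrite !mxE.
  by case: ifP => _; apply/eqP; rewrite eq_complex /=; apply/andP; split;
    apply/eqP; ring.
apply/(L2H_eqE lf); first by apply: L2H_vect; exact: L2Z mD _ _ lc.
by have [-> ->] := comp_vect (fun x => c1 * cos (phi x)) (fun x => c2 * cos (phi x)).
Qed.

End transfer.

(** * The three cases for the limit angle, and the theorem *)

Section main.
Context {R : realType}.
Local Notation mu := (@lebesgue_measure R).
Local Notation D := (@half_line R).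
Local Notation nsq F := (ip D F F).
Local Open Scope complex_scope.

Lemma limf_esup_pinfty (g : R -> R) :
  limf_esup (fun x : R => (g x)%:E) +oo%R = +oo%E <->
  ~ exists C N : R, forall x, N < x -> g x <= C.
Proof.
rewrite limf_esupE; split=> [supE [C [N hC]]|nb].
  have : (ereal_inf [set ereal_sup ((fun x => (g x)%:E) @` V) | V in +oo%R] <= C%:E)%E.
    apply: ge_ereal_inf; exists (ereal_sup ((fun x => (g x)%:E) @` `]N, +oo[)).
      exists `]N, +oo[%classic => //; exists N; split; [exact: num_real|move=> x].
      by rewrite /= in_itv/= andbT.
    apply: ge_ereal_sup => _ [x /= xN <-]; rewrite lee_fin hC//.
    by move: xN; rewrite in_itv/= andbT.
  by rewrite supE leye_eq.
apply/eqP; rewrite -leye_eq leNgt; apply/negP => /ereal_inf_lt[_ [V [N [_ NV]] <-] lt].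
(* The default value of [fine] is not met: the supremum is below +oo, and [le] puts it above a real
   number. *)
apply: nb; exists (fine (ereal_sup ((fun x => (g x)%:E) @` V))), N => x Nx.
have le : ((g x)%:E <= ereal_sup ((fun x => (g x)%:E) @` V))%E.
  by apply: ereal_sup_ubound; exists x => //; exact: NV.
by rewrite -lee_fin fineK// fin_numElt lt andbT (lt_le_trans _ le)// ltNyr.
Qed.

Lemma square_integrableE (f : R -> R) : square_integrable f <-> L2 D f.
Proof.
split=> [[mf fin]|[mf /integrableP[_ fin]]]; split => //.
  apply/integrableP; split; first by apply/measurable_EFinP; exact: measurable_funX.
  apply: le_lt_trans fin; rewrite le_eqVlt; apply/orP; left; apply/eqP.
  by apply: eq_integral => x _; rewrite /= ger0_norm// sqr_ge0.
apply: le_lt_trans fin; rewrite le_eqVlt; apply/orP; left; apply/eqP.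
by apply: eq_integral => x _; rewrite /= ger0_norm// sqr_ge0.
Qed.

Variables (phi : R -> R) (A : R).
Hypothesis dphi : decreasing_to phi A.
Local Notation cosphi := (fun x => cos (phi x)).

Let mphi := measurable_decreasing dphi.

(** In the last case [phi] is squeezed between its limit and the upper bound pi/2. *)
Lemma limit_cases : [\/ A = - (pi / 2), - (pi / 2) < A < pi / 2 |
  forall x : R, 0 < x -> phi x = pi / 2].
Proof.
have [_ _ le ge] := dphi.
have A_le x : 0 < x -> A <= phi x by exact: limit_le dphi.
have [->|NA] := eqVneq A (- (pi / 2)); first by constructor 1.
have [lt|AP] := ltP A (pi / 2).
  by constructor 2; apply/andP; split=> //; rewrite lt_neqAle eq_sym NA ge.
constructor 3 => x x0; apply/eqP; rewrite eq_le le//=.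
exact: le_trans AP (A_le x x0).
Qed.

Lemma form_bound_theta : form_bound phi ->
  exists C N : R, forall x, N < x -> x * (phi x - A) <= C.
Proof.
move=> fb; have [AE|Aint|pE] := limit_cases.
- exact: theta_bound_Npihalf fb.
- exact: theta_bound_interior fb.
- have [_ lim_phi _ _] := dphi.
  exists 0, 1 => x x1; have x0 : 0 < x by exact: lt_trans x1.
  rewrite pmulr_rle0// subr_le0 pE// leNgt; apply/negP => lt.
  have e0 : 0 < pi / 2 - A by rewrite subr_gt0.
  have [N N0 hN] := eventually_small dphi e0.
  by have := hN N (lexx N); rewrite pE// ltxx andbF.
Qed.

(** Near infinity theta <= 2 sin theta = 2 cos phi. Before [N] only theta <= pi is available, and pi
    times an indicator function dominates that part. *)
Lemma L2_cos_theta : A = - (pi / 2) -> L2 D cosphi ->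
  L2 D (fun x => phi x + pi / 2).
Proof.
move=> AE lc; have [_ _ le _] := dphi; have pi0 := @pi_gt0 R.
have [d /andP[d0 _] hd] := @small_angle R.
have [N N0 hN] := eventually_small dphi d0.
pose I : R -> R := \1_(`]-oo, N[%classic).
have lI : L2 D I.
  apply: (@L2_compact_support _ I N).
  - by apply: measurable_indic; exact: measurable_itv.
  - move=> b; exists 1 => x _; rewrite /I indicE; case: (_ \in _) => /=.
      by rewrite normr1.
    by rewrite normr0.
  - move=> x Nx; rewrite /I indicE memNset//= in_itv/= => xN.
    by have := lt_trans Nx xN; rewrite ltxx.
have lS := L2D mD (L2Z mD pi lI) (L2Z mD 2 lc).
apply: (L2_le mD _ lS); first by apply: measurable_funD.
move=> x; rewrite half_lineE => x0; have A_le := limit_le dphi x0; have hle := le x x0.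
have t0 : 0 <= phi x + pi / 2 by rewrite AE in A_le; lra.
rewrite ger0_norm//; apply: le_trans (ler_norm _).
have c0 : 0 <= cos (phi x).
  by apply: cos_ge0_pihalf; rewrite hle andbT; lra.
rewrite /I indicE; have [xN|Nx] := ltP x N.
  by rewrite mem_set/= ?in_itv//= mulr1; lra.
rewrite memNset/=; last by rewrite in_itv/= => xN; have := le_lt_trans Nx xN; rewrite ltxx.
have /andP[h1 h2] := hN x Nx; rewrite AE opprK in h1 h2.
have [_] := hd _ h1 h2; rewrite sinDpihalf; lra.
Qed.

(** If |A| < pi/2, then cos phi is bounded below near infinity; if [phi] is constantly pi/2, it
    vanishes. *)
Lemma limit_of_L2_cos : L2 D cosphi -> nsq cosphi != 0 -> A = - (pi / 2).
Proof.
move=> lc nz; have [//|Aint|pE] := limit_cases.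
  have cA : 0 < cos A by exact: cos_gt0_pihalf.
  have [_ lim_phi _ _] := dphi.
  have hlt : cos A / 2 < cos A by rewrite ltr_pdivrMr// ltr_pMr// ltr1n.
  have [a a0 ha] := cos_eventually_ge lim_phi hlt.
  case: (@L2_not_bounded_below _ cosphi (cos A / 2) a lc); rewrite ?divr_gt0//.
  by move=> x ax; apply: le_trans (ler_norm _); exact: ha.
move: nz; rewrite (ae_eq0_nsq mD lc) ?eqxx//.
by apply: aeW => x; rewrite half_lineE => x0; rewrite pE// cos_pihalf.
Qed.

(** The sine is 1 or -1, and its sign cancels in the projection. So pi/2 and -pi/2 give the same
    coefficient function, which is why (b) needs a normalization. *)
Lemma cos0_projP (a : R) : cos a = 0 -> projP a = projP (pi / 2).
Proof.
move=> c0; have := cos2Dsin2 a; rewrite c0 expr0n add0r => s2.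
apply/matrixP => i j; rewrite !mxE !big_ord_recl !big_ord0 !mxE.
by have [->|->] := ord2P i; have [->|->] := ord2P j;
  rewrite /= ?c0 ?cos_pihalf ?mul0r ?mulr0// -!expr2 s2 sin_pihalf expr1n.
Qed.

End main.

Theorem theorem1p5 (R : realType) (H : R -> 'M[R]_2) (phi : R -> R)
    (phi0 phioo : R)
    (HCplus : Cplus H)
    (Hphi : {ae lebesgue_measure, forall x : R, 0 < x -> H x = projP (phi x)})
    (phi_decr : forall x y : R, 0 < x -> x <= y -> phi y <= phi x)
    (phi_at0 : phi x @[x --> 0^'+] --> phi0)
    (phi_atoo : phi x @[x --> +oo] --> phioo)
    (phi0_le : phi0 <= pi / 2)
    (phioo_le : phioo <= phi0)
    (phioo_ge : - (pi / 2) <= phioo) :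
  (ess_spectrum H 0 <->
     limf_esup (fun x : R => (x * (phi x - phioo))%:E) +oo%R = +oo%E)
  /\
  (* H determines phi a.e., except if H = P_(pi/2) = P_(-pi/2) a.e.; phi is
     then normalized to be pi/2 *)
  (({ae lebesgue_measure, forall x : R, 0 < x -> H x = projP (pi / 2)} ->
    {ae lebesgue_measure, forall x : R, 0 < x -> phi x = pi / 2}) ->
   (is_eigenvalue H 0 <-> square_integrable (fun x => phi x + pi / 2))).
Proof.
have [HH Hsp] := HCplus.
have dphi : decreasing_to phi phioo.
  split=> // x x0; apply: le_trans phi0_le.
  apply: (cvgr_to_ge phi_at0).
  near=> y; apply: phi_decr; first by near: y; exact: nbhs_right_gt.
  by near: y; exact: nbhs_right_le.
have mphi := measurable_decreasing dphi; have mDR := @mD R.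
pose cosphi x := cos (phi x).
have resE := resolvent_setE HH mphi Hphi.
have evE : is_eigenvalue H 0 <-> L2 (@half_line R) cosphi /\ ip (@half_line R) cosphi cosphi != 0.
  exact: eigenvalue0E.
split.
  rewrite limf_esup_pinfty; split=> [[sp0 ness] bnd|unb].
    have nres : ~ resolvent phi 0 by move=> /resE.
    have [AE|Aint|pE] := limit_cases dphi.
    - have [lc gap] := res_gap dphi AE bnd.
      have nz : ip (@half_line R) cosphi cosphi != 0.
        apply/eqP => z; apply: nres; apply: (res0_degenerate mphi).
        by apply: aeS (nsq_eq0 mDR lc z) => x h x0; apply: h; rewrite half_lineE.
      have [e e0 he] := gap nz.
      apply: ness; split; last exact: (finite_multiplicity0 HH mphi Hphi lc).
        (* Membership in [Cplus] makes every spectral point a nonnegative real, so only the interval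
           (0, e) has to be free of spectrum. *)
        exists e => // w spw; have := Hsp _ spw; move=> /= w0.
        rewrite subr0 ger0_norm//; move: w0 spw; case: w => a b.
        rewrite lecE ltcE /= => /andP[/eqP -> a0] spw /andP[_ ae].
        have [->//|an0] := eqVneq a 0.
        by case: spw; apply/resE/he; rewrite lt_neqAle eq_sym an0 a0.
      exact/evE.
    - exact: nres (res0_interior dphi Aint bnd).
    - apply: nres; apply: (res0_degenerate mphi).
      by apply: aeW => x x0; rewrite pE// cos_pihalf.
  split=> [r0|[[e e0 iso] _ _]].
    by apply: unb; apply: (form_bound_theta dphi); apply: (form_bound_resolvent0 mphi); exact/resE.
  apply: unb; apply: (form_bound_theta dphi); apply: (form_bound_gap mphi e0) => w /andP[w0 we].
  apply: contrapT => nres; have : (w%:C)%C = 0.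
    apply: iso; first by move=> /resE.
    by rewrite subr0 ger0_norm ?ltcR// lecR ltW.
  by move=> [] /eqP; rewrite gt_eqF.
move=> normalized; rewrite evE square_integrableE; split=> [[lc nz]|lt].
  exact: L2_cos_theta (limit_of_L2_cos dphi lc nz) lc.
have pi0 := @pi_gt0 R.
have th0 x : 0 < x -> 0 <= phi x + pi / 2.
  by move=> x0; have := limit_le dphi x0; lra.
have lc : L2 (@half_line R) cosphi.
  apply: (L2_le mDR _ lt); first exact: measurable_cos_fun.
  move=> x; rewrite half_lineE => x0; have t0 := th0 x x0.
  have [_ _ le _] := dphi; have := le x x0 => lex.
  rewrite (ger0_norm t0) ger0_norm /cosphi; first by rewrite -sinDpihalf; exact: sin_le_id.
  by apply: cos_ge0_pihalf; rewrite lex andbT; lra.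
(* If cos phi vanished almost everywhere, the normalization would give phi + pi/2 = pi almost
   everywhere, and a nonzero constant is not square integrable. *)
split=> //; apply/eqP => /(nsq_eq0 mDR lc) c0.
have phiE : {ae lebesgue_measure, forall x : R, 0 < x -> phi x = pi / 2}.
  apply: normalized; apply: aeS2 Hphi c0 => x Hx hc x0.
  by rewrite Hx//; apply: cos0_projP; apply: hc; rewrite half_lineE.
have lpi : L2 (@half_line R) (fun=> pi).
  apply: (L2_ae_eq lt) => //.
  by apply: aeS phiE => x h x0; rewrite h// -splitr.
by case: (@L2_not_bounded_below _ _ pi 0 lpi) => // x _; exact: ler_norm.
Unshelve. all: by end_near. Qed.
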